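(* Let $N$ be an open subset of a connected Riemannian manifold $M$ and suppose that $\mathrm{cap}_M(M\setminus N)=0$. Then $N$ is connected and $d_M(p\,;q)=d_N(p\,;q)$ for all $p,q\in N$.
   Context: Riemannian manifolds are assumed $\sigma$-compact. $N$ carries the restricted Riemannian metric; $d_M$ and $d_N$ denote the natural (Riemannian) distances on the connected Riemannian manifolds $M$ and $N$. $H^1_{\rm loc}(M)$ is the set of $\varphi\in L_{2,\rm loc}(M)$ with $\varphi\circ x^{-1}\in H^1_{\rm loc}(x(V))$ for every chart $(V,x)$; on charts $|\nabla\varphi|^2=\sum_{i,j}g^{ij}(\partial\varphi/\partial x^i)(\partial\varphi/\partial x^j)$. $H^1(M)$ is the Hilbert space of real-valued $\varphi\in H^1_{\rm loc}(M)$ with $\varphi,|\nabla\varphi|\in L_2(M)$ (Riemannian measure), with norm $(\|\varphi\|_2^2+\||\nabla\varphi|\|_2^2)^{1/2}$. For $A\subset M$, $\mathrm{cap}_M(A)=\inf\{\|\varphi\|_{H^1(M)}^2:\varphi\in H^1(M),\ \varphi\ge1 \text{ (a.e.) on a neighbourhood of }A\}$. *)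

(* Defs.v *)
From HB Require Import structures.
From mathcomp Require Import all_boot all_order all_algebra.
From mathcomp Require Import all_classical all_reals all_analysis.

Set Implicit Arguments.
Unset Strict Implicit.
Unset Printing Implicit Defensive.

Import Order.TTheory GRing.Theory Num.Theory.
Import numFieldNormedType.Exports.

Local Open Scope classical_set_scope.
Local Open Scope ring_scope.

(* The product sigma-algebra, generated by the coordinates, which is the Borel
   one; the form is the one the library uses for tuples. *)
Section measurable_rV.
Context {R : realType} (n : nat).

Let coords : 'I_n -> 'rV[R]_n -> R := fun i v => v ord0 i.

Let rV_set0 : g_sigma_preimage coords set0.
Proof. exact: sigma_algebra0. Qed.

Let rV_setC A : g_sigma_preimage coords A -> g_sigma_preimage coords (~` A).
Proof. exact: sigma_algebraC. Qed.

Let rV_bigcup (F : (set 'rV[R]_n)^nat) :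
  (forall i, g_sigma_preimage coords (F i)) ->
  g_sigma_preimage coords (\bigcup_i (F i)).
Proof. exact: sigma_algebra_bigcup. Qed.

HB.instance Definition _ := @isMeasurable.Build default_measure_display
  'rV[R]_n (g_sigma_preimage coords) rV_set0 rV_setC rV_bigcup.

End measurable_rV.

Section lebesgue_rV.
Context {R : realType}.

Lemma measurable_coord n (i : 'I_n) :
  measurable_fun [set: 'rV[R]_n] (fun v : 'rV[R]_n => v ord0 i).
Proof.
move=> _ Y mY; rewrite setTI; apply: sub_sigma_algebra => /=.
rewrite -bigcup_seq/=; exists i => /=; first by rewrite mem_index_enum.
by exists Y => //; rewrite setTI.
Qed.

Lemma measurable_fun_coordP d (T : measurableType d) n (f : T -> 'rV[R]_n) :
  (forall i, measurable_fun [set: T] (fun x => f x ord0 i)) ->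
  measurable_fun [set: T] f.
Proof.
move=> mf _ A mA; rewrite setTI.
have : [set B : set 'rV[R]_n | measurable (f @^-1` B)] A.
  apply: (smallest_sub _ _ mA).
    split => /=.
    - by rewrite preimage_set0.
    - by move=> B mB; rewrite setTD preimage_setC; exact: measurableC.
    - by move=> F mF; rewrite preimage_bigcup; exact: bigcupT_measurable.
  apply: (big_ind (fun G => G `<=` _)) => //.
  - by move=> G H sG sH; rewrite subUset.
  - move=> i _ B [Y mY <-] /=.
    rewrite setTI -comp_preimage -[X in measurable X]setTI.
    exact: mf.
by [].
Qed.

Definition cons_rV n (xv : R * 'rV[R]_n) : 'rV[R]_n.+1 :=
  row_mx (\row_(_ < 1) xv.1) xv.2.

Definition uncons_rV n (v : 'rV[R]_n.+1) : R * 'rV[R]_n :=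
  (v ord0 ord0, \row_i v ord0 (lift ord0 i)).

Lemma cons_rV0 n (xv : R * 'rV[R]_n) : cons_rV xv ord0 ord0 = xv.1.
Proof.
rewrite (_ : ord0 = lshift n (ord0 : 'I_1) :> 'I_n.+1); last exact: ord_inj.
by apply: etrans (row_mxEl _ _ _ _) _; rewrite mxE.
Qed.

Lemma cons_rVS n (xv : R * 'rV[R]_n) i :
  cons_rV xv ord0 (lift ord0 i) = xv.2 ord0 i.
Proof.
rewrite (_ : lift ord0 i = rshift 1 i :> 'I_n.+1); last exact: ord_inj.
exact: row_mxEr.
Qed.

Lemma cons_rVK n : cancel (@cons_rV n) (@uncons_rV n).
Proof.
move=> [x v]; rewrite /uncons_rV cons_rV0; congr pair.
by apply/rowP => j; rewrite mxE cons_rVS.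
Qed.

Lemma measurable_cons_rV n : measurable_fun setT (@cons_rV n).
Proof.
apply: measurable_fun_coordP => i.
case: (unliftP ord0 i) => [j ->|->].
  under eq_fun do rewrite cons_rVS.
  by apply: (measurableT_comp (measurable_coord j)).
by under eq_fun do rewrite cons_rV0; exact: measurable_fst.
Qed.

Lemma measurable_uncons_rV n : measurable_fun setT (@uncons_rV n).
Proof.
apply: measurable_fun_pair => /=; first exact: measurable_coord.
apply: measurable_fun_coordP => i.
under eq_fun do rewrite mxE.
exact: measurable_coord.
Qed.

Section step.
Variables (n : nat) (m : {sigma_finite_measure set 'rV[R]_n -> \bar R}).

Definition cons_measure : set 'rV[R]_n.+1 -> \bar R :=
  pushforward (lebesgue_measure \x m)%E (@cons_rV n).

Let cons_measure0 : cons_measure set0 = 0%E.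
Proof. by rewrite /cons_measure /pushforward preimage_set0 measure0. Qed.

Let cons_measure_ge0 A : (0 <= cons_measure A)%E.
Proof. by rewrite /cons_measure /pushforward; exact: measure_ge0. Qed.

Let cons_measure_sigma_additive : semi_sigma_additive cons_measure.
Proof.
move=> F mF tF mUF; rewrite /cons_measure /pushforward preimage_bigcup.
have mcF A : measurable A -> measurable (@cons_rV n @^-1` A).
  by move=> mA; rewrite -[X in measurable X]setTI; exact: measurable_cons_rV.
apply: measure_semi_sigma_additive.
- by move=> k; exact: mcF.
- apply/trivIsetP => /= i j _ _ ij; rewrite -preimage_setI.
  by move/trivIsetP : tF => /(_ _ _ _ _ ij) ->//; rewrite preimage_set0.
- by rewrite -preimage_bigcup; exact: mcF.
Qed.

HB.instance Definition _ := isMeasure.Build _ _ _ cons_measure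
  cons_measure0 cons_measure_ge0 cons_measure_sigma_additive.

Let cons_measure_sigma_finite : sigma_finite setT cons_measure.
Proof.
have /sigma_finiteP[G [GT Gnd Goo]] := sigma_finiteT m.
have /sigma_finiteP[F [FT Fnd Foo]] := sigma_finiteT (@lebesgue_measure R).
exists (fun k => @uncons_rV n @^-1` (F k `*` G k)).
  rewrite -preimage_bigcup (_ : \bigcup_k _ = setT) ?preimage_setT//.
  apply/seteqP; split => // -[x v] _.
  have [i _ Fx] : (\bigcup_k F k) x by rewrite -FT.
  have [j _ Gv] : (\bigcup_k G k) v by rewrite -GT.
  exists (maxn i j) => //; split => /=.
  - by move: x Fx; exact/subsetPset/Fnd/leq_maxl.
  - by move: v Gv; exact/subsetPset/Gnd/leq_maxr.
move=> k; have [mF Fk] := Foo k; have [mG Gk] := Goo k; split.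
  rewrite -[X in measurable X]setTI.
  by apply: measurable_uncons_rV => //; exact: measurableX.
rewrite /cons_measure /pushforward -comp_preimage.
rewrite (_ : @uncons_rV n \o @cons_rV n = id); last first.
  by apply/funext => x /=; rewrite cons_rVK.
by rewrite preimage_id product_measure1E// lte_mul_pinfty// ge0_fin_numE.
Qed.

HB.instance Definition _ := Measure_isSigmaFinite.Build _ _ _ cons_measure
  cons_measure_sigma_finite.

End step.

Fixpoint lebesgue_rV n : {sigma_finite_measure set 'rV[R]_n -> \bar R} :=
  match n with
  | 0 => \d_(0 : 'rV[R]_0)
  | n.+1 => cons_measure (lebesgue_rV n)
  end.

End lebesgue_rV.
Arguments lebesgue_rV {R} n.

Section euclidean.
Context {R : realType} {n : nat}.
Implicit Types (U : set 'rV[R]_n) (f h : 'rV[R]_n -> R).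

Definition partial (i : 'I_n) f : 'rV[R]_n -> R :=
  fun y => 'D_(delta_mx 0 i) f y.

Fixpoint Ck (k : nat) U f : Prop :=
  (forall y, U y -> {for y, continuous f}) /\
  match k with
  | 0 => True
  | k.+1 => forall i, (forall y, U y -> derivable f y (delta_mx 0 i)) /\
                      Ck k U (partial i f)
  end.

Definition smooth_on U f := forall k, Ck k U f.

Definition test_function U f := smooth_on setT f /\
  exists K, [/\ compact K, K `<=` U & forall y, ~ K y -> f y = 0].

Definition L2loc U f := measurable_fun U f /\
  forall K, compact K -> K `<=` U ->
    (\int[lebesgue_rV n]_(y in K) (f y ^+ 2)%:E < +oo)%E.

Definition weak_partial U (i : 'I_n) f h := forall psi, test_function U psi ->
  \int[lebesgue_rV n]_(y in U) (f y * partial i psi y) =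
  - \int[lebesgue_rV n]_(y in U) (h y * psi y).

Definition weak_gradient U f (D : 'I_n -> 'rV[R]_n -> R) :=
  forall i, L2loc U (D i) /\ weak_partial U i f (D i).

Definition H1loc U f := L2loc U f /\ exists D, weak_gradient U f D.

End euclidean.

(* [chart_map] and [chart_inv] are only meaningful on [chart_dom] and on its
   image; outside they take arbitrary values. *)
Record chart (R : realType) (n : nat) (M : Type) := Chart {
  chart_dom : set M;
  chart_map :> M -> 'rV[R]_n;
  chart_inv : 'rV[R]_n -> M
}.

Section charts.
Context {R : realType} {n : nat} {M : ptopologicalType}.
Implicit Types (c d : chart R n M).

Definition chart_img c : set 'rV[R]_n := c @` chart_dom c.

Definition is_chart c := [/\ open (chart_dom c), open (chart_img c),
  forall p, chart_dom c p -> chart_inv c (c p) = p,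
  forall p, chart_dom c p -> {for p, continuous c} &
  forall y, chart_img c y -> {for y, continuous (chart_inv c)}].

Definition smooth_transition c d := forall j : 'I_n,
  smooth_on (c @` (chart_dom c `&` chart_dom d))
            (fun y => d (chart_inv c y) ord0 j).

(* [v *m transition_jacobian c d p] represents in [d] the tangent vector at [p]
   which the row vector [v] represents in [c]. *)
Definition transition_jacobian c d (p : M) : 'M[R]_n :=
  \matrix_(i, j) partial i (fun y => d (chart_inv c y) ord0 j) (c p).

End charts.

(* A maximal smooth atlas, so that "every chart" has its usual meaning. The
   choice [chart_at] of a chart around each point only serves to write down
   chart-independent quantities. *)
Record smooth_structure (R : realType) (n : nat) (M : ptopologicalType) := {
  atlas : set (chart R n M);
  chart_at : M -> chart R n M;
  atlas_is_chart : forall c, atlas c -> is_chart c;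
  atlas_smooth : forall c d, atlas c -> atlas d -> smooth_transition c d;
  atlas_maximal : forall c, is_chart c ->
    (forall d, atlas d -> smooth_transition c d /\ smooth_transition d c) ->
    atlas c;
  chart_at_atlas : forall p, atlas (chart_at p);
  chart_at_dom : forall p, chart_dom (chart_at p) p
}.

Record riemannian_metric (R : realType) (n : nat) (M : ptopologicalType)
    (S : smooth_structure R n M) := {
  gram :> chart R n M -> M -> 'M[R]_n;
  gram_sym : forall c p, atlas S c -> chart_dom c p ->
    (gram c p)^T = gram c p;
  gram_pos : forall c p, atlas S c -> chart_dom c p ->
    forall v : 'rV[R]_n, v != 0 -> 0 < (v *m gram c p *m v^T) ord0 ord0;
  gram_smooth : forall c, atlas S c -> forall i j,
    smooth_on (chart_img c) (fun y => gram c (chart_inv c y) i j);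
  gram_transition : forall c d p, atlas S c -> atlas S d ->
    chart_dom c p -> chart_dom d p ->
    gram c p =
      transition_jacobian c d p *m gram d p *m (transition_jacobian c d p)^T
}.

Definition sigma_compact (T : topologicalType) :=
  exists K : nat -> set T, (forall k, compact (K k)) /\ \bigcup_k K k = setT.

Notation borel M := (g_sigma_algebraType (@open M)).

Section riemannian.
Context {R : realType} {n : nat} {M : ptopologicalType}.
Context {S : smooth_structure R n M} (g : riemannian_metric S).

(* This determines [mu] when [M] is sigma-compact. *)
Definition riemannian_measure (mu : {measure set (borel M) -> \bar R}) :=
  forall c, atlas S c -> forall A : set (borel M), measurable A ->
    A `<=` chart_dom c ->
    mu A = (\int[lebesgue_rV n]_(y in c @` A)
              (Num.sqrt (\det (g c (chart_inv c y))))%:E)%E.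

Definition velocity (c : chart R n M) (gamma : R -> M) (t : R) : 'rV[R]_n :=
  derive1 (fun s => c (gamma s)) t.

Definition speed (gamma : R -> M) (t : R) : R :=
  let c := chart_at S (gamma t) in
  let v := velocity c gamma t in
  Num.sqrt ((v *m g c (gamma t) *m v^T) ord0 ord0).

(* C^1 on the closed interval [a, b], given that [gamma] is continuous there:
   the one-sided limits of the velocity make it C^1 up to the end points. *)
Definition C1_curve (gamma : R -> M) (a b : R) := forall c, atlas S c ->
  [/\ forall t, a < t < b -> chart_dom c (gamma t) ->
        derivable (fun s => c (gamma s)) t 1 /\
        {for t, continuous (velocity c gamma)},
      chart_dom c (gamma a) -> cvg (velocity c gamma t @[t --> a^'+]) &
      chart_dom c (gamma b) -> cvg (velocity c gamma t @[t --> b^'-])].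

Definition piecewise_C1 (gamma : R -> M) :=
  {within `[0, 1], continuous gamma} /\
  exists s : seq R, [/\ path <%R 0 s, last 0 s = 1 &
    forall i, (i < size s)%N -> C1_curve gamma (nth 0 (0 :: s) i) (nth 0 s i)].

Definition curve_length (gamma : R -> M) : \bar R :=
  (\int[lebesgue_measure]_(t in `[0%R, 1%R]) (speed gamma t)%:E)%E.

(* For open [N], the Riemannian distance of [N] with the restricted metric: the
   curves in the manifold [N] are the curves in [M] that stay in [N], with the
   same length. It is +oo when no curve in [N] joins [p] to [q]. *)
Definition riemannian_dist (N : set M) (p q : M) : \bar R :=
  ereal_inf [set curve_length gamma | gamma in
    [set gamma | [/\ piecewise_C1 gamma, gamma 0 = p, gamma 1 = q &
                     forall t, 0 <= t <= 1 -> N (gamma t)]]].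

Variable mu : {measure set (borel M) -> \bar R}.
Implicit Types (phi w : M -> R).

Definition L2loc_manifold phi :=
  measurable_fun [set: borel M] (phi : borel M -> R) /\
  forall K : set M, compact K -> (\int[mu]_(p in K) (phi p ^+ 2)%:E < +oo)%E.

Definition H1loc_manifold phi := L2loc_manifold phi /\
  forall c, atlas S c -> H1loc (chart_img c) (phi \o chart_inv c).

(* [w] is a version of the a.e. defined function |grad phi|^2. *)
Definition is_grad_sq phi w :=
  measurable_fun [set: borel M] (w : borel M -> R) /\
  forall c, atlas S c ->
  exists2 D, weak_gradient (chart_img c) (phi \o chart_inv c) D &
    {ae lebesgue_rV n, forall y, chart_img c y ->
      w (chart_inv c y) = \sum_(i < n) \sum_(j < n)
        invmx (g c (chart_inv c y)) i j * D i y * D j y}.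

(* [phi] is in H^1(M) with |grad phi|^2 = w and squared norm [e]. *)
Definition H1_norm_sq phi w (e : \bar R) :=
  [/\ H1loc_manifold phi, is_grad_sq phi w,
      e = (\int[mu]_p (phi p ^+ 2)%:E + \int[mu]_p (w p)%:E)%E & (e < +oo)%E].

Definition capacity (A : set M) : \bar R :=
  ereal_inf [set e | exists phi w, H1_norm_sq phi w e /\
    exists U : set M, [/\ open U, A `<=` U &
      {ae mu, forall p, U p -> 1 <= phi p}]].

End riemannian.

(* Main.v *)
Require Import Defs.
From mathcomp Require Import all_boot all_order all_algebra.
From mathcomp Require Import all_classical all_reals all_analysis.
From mathcomp Require polyrcf.
From mathcomp Require Import measurable_realfun ring lra.

Set Implicit Arguments.
Unset Strict Implicit.
Unset Printing Implicit Defensive.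

Import Order.TTheory GRing.Theory Num.Theory.
Import numFieldNormedType.Exports.

Local Open Scope classical_set_scope.
Local Open Scope ring_scope.


(** Let [E] be the complement of [N]. Capacity zero provides functions [phi] that
    are at least 1 near [E] and have arbitrarily small energy.

    The heart of the matter is that [E] cannot meet all segments of a tube. In a
    chart, consider the parallel segments [t |-> (t, u + t w')], with [T0 < t < T1]
    and [u] in a cube of side [r]. If each of them met [E], then on each of them
    [phi] would reach 1, and the integral over the tube of [|phi|] and of its
    derivative along the segments would be at least [c r ^ n]: a contradiction
    with small energy. As [phi] has only weak derivatives, restricting it to lines
    is replaced by an explicit test function ([exists_transport],
    [tube_estimate]): by compactness finitely many thin tubes suffice, and in each
    of them a unit of mass is moved, along the segments, from a fixed profile to a
    place where [phi >= 1]. The displacement has a potential [Psi], smooth and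
    compactly supported, and the weak gradient is tested against [Psi]. Hence some
    segment of the tube lies in [N] ([exists_free_segment]), and any segment of a
    chart has a segment in [N] as close to it as desired ([free_segment_near]). In
    particular [N] is dense ([capacity0_dense]).

    Around each point there is a chart ball in which the metric is constant up to
    a factor [k > 1] ([good_box]). There two points of [N] are joined inside [N]
    by a path of length at most [k] times their distance for the constant metric,
    plus [eps]: go by short segments to the end points of a nearby free segment
    ([joined_local]).

    Equality of the distances follows. A curve [gamma] of [M] from [p] to [q] may
    leave [N], but points of [N] near [gamma s] and points of [N] near [gamma t]
    are joined inside [N] by paths of length at most [k ^ 2] times the length of
    [gamma] between [s] and [t], plus [eps] ([joined_near]). This holds for [s]
    and [t] close to each other, by the local result and the fundamental theorem
    of calculus ([chart_increment]); density of [N] makes it transitive, so it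
    holds between 0 and 1; then [k] tends to 1 and [eps] to 0. Connectedness of [N]
    is obtained in the same way, from the connectedness of [M]
    ([joined_capacity0]). *)

(** * Smooth functions on the line *)

Section smooth_line.
Context {R : realType}.
Implicit Types (b f h : R -> R).

Fixpoint nderivable (k : nat) b : Prop :=
  if k is k'.+1 then (forall x : R, derivable b x 1) /\ nderivable k' (derive1 b)
  else True.

Definition smooth1 b := forall k, nderivable k b.

Lemma nderivableW k b : nderivable k.+1 b -> nderivable k b.
Proof.
elim: k b => [//|k IH] b [db /IH dk]; split => //.
Qed.

Lemma nderivableS k b b' : (forall x : R, is_derive x 1 b (b' x)) ->
  nderivable k b' -> nderivable k.+1 b.
Proof.
move=> db kb'; split; first by move=> x; have [] := db x.
suff -> : (derive1 b) = b' by [].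
by apply/funext => x; rewrite derive1E; have [_ ->] := db x.
Qed.

Lemma nderivable_cst k (c : R) : nderivable k (fun=> c).
Proof.
elim: k c => // k IH c; exact: nderivableS (IH 0).
Qed.

Lemma nderivableD k f h : nderivable k f -> nderivable k h ->
  nderivable k (fun x => f x + h x).
Proof.
elim: k f h => // k IH f h [df kf] [dh kh].
apply: nderivableS (IH _ _ kf kh) => x; rewrite !derive1E.
by apply: is_deriveD; apply: derivableP.
Qed.

Lemma nderivableM k f h : nderivable k f -> nderivable k h ->
  nderivable k (fun x => f x * h x).
Proof.
elim: k f h => // k IH f h kf kh; have [df kf'] := kf; have [dh kh'] := kh.
apply: (@nderivableS _ _ (fun x => f x * (derive1 h) x + h x * (derive1 f) x)); last first.
  by apply: nderivableD; apply: IH => //; exact: nderivableW.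
by move=> x; rewrite !derive1E; apply: is_deriveM; apply: derivableP.
Qed.

Lemma is_derive_affine f (a c x : R) : derivable f (a * x + c) 1 ->
  is_derive x 1 (fun y => f (a * y + c)) (a * (derive1 f) (a * x + c)).
Proof.
move=> df.
have dg : is_derive x 1 (fun y => a * y + c) a.
  have /is_derive_eq := is_deriveD (is_deriveZ a (is_derive_id x 1)) (is_derive_cst c x 1).
  by apply; rewrite addr0 [LHS]mulr1.
rewrite mulrC; apply: (@is_derive1_comp R f (fun y => a * y + c) x _ a).
by rewrite derive1E; exact: derivableP.
Qed.

Lemma nderivable_affine k f (a c : R) : nderivable k f ->
  nderivable k (fun x => f (a * x + c)).
Proof.
elim: k f => // k IH f [df kf].
apply: (@nderivableS _ _ (fun x => a * (derive1 f) (a * x + c))).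
  by move=> x; exact: is_derive_affine.
by apply: nderivableM; [exact: nderivable_cst|exact: IH].
Qed.

Lemma smooth1_derive b : smooth1 b ->
  (forall x : R, is_derive x 1 b ((derive1 b) x)) /\ smooth1 (derive1 b).
Proof.
move=> sb; split=> [x|k]; last by have [] := sb k.+1.
by rewrite derive1E; apply: derivableP; have [] := sb 1%N.
Qed.

Lemma smooth1_continuous b : smooth1 b -> continuous b.
Proof.
move=> sb x; apply: differentiable_continuous; apply/derivable1_diffP.
by have [] := sb 1%N.
Qed.

(** For [k = 0] this is exp(-1/x), extended by zero; the powers of [x^-1] make
    the family stable under differentiation up to linear combinations. *)
Definition flat k (x : R) : R := if 0 < x then (x^-1) ^+ k * expR (- x^-1) else 0.

Lemma flat_ge0 k x : 0 <= flat k x.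
Proof.
rewrite /flat; case: ifP => // x0.
by rewrite mulr_ge0 ?expR_ge0// exprn_ge0// invr_ge0 ltW.
Qed.

Lemma flat_gt0 k x : 0 < x -> 0 < flat k x.
Proof. by move=> x0; rewrite /flat x0 mulr_gt0 ?expR_gt0// exprn_gt0// invr_gt0. Qed.

(** One term of the exponential series absorbs the power of [x^-1]; the square
    on the right makes the derivative at the origin vanish. *)
Lemma flat_le k x : flat k x <= (k.+2)`!%:R * x ^+ 2.
Proof.
rewrite /flat; case: ifPn => [x0|_]; last by rewrite mulr_ge0 ?sqr_ge0.
set y := x^-1; have y0 : 0 < y by rewrite invr_gt0.
have -> : x ^+ 2 = (y ^+ 2)^-1 by rewrite /y exprVn invrK.
have H : y ^+ k.+2 / k.+2`!%:R <= expR y.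
  by rewrite (le_trans _ (expR_ge1Dxn k.+1 (ltW y0)))// lerDr.
have f0 : (0 : R) < k.+2`!%:R by rewrite ltr0n fact_gt0.
rewrite expRN ler_pdivrMr ?expR_gt0// mulrAC ler_pdivlMr ?exprn_gt0//.
by rewrite -exprD addn2 mulrC -ler_pdivrMr.
Qed.

Lemma is_derive_quad f (C : R) : (forall x, `|f x| <= C * x ^+ 2) ->
  is_derive (0 : R) (1 : R) f 0.
Proof.
move=> fC.
have f0 : f 0 = 0.
  by apply/eqP; rewrite -normr_le0 (le_trans (fC 0))// expr0n mulr0.
have C0 : 0 <= C by have := le_trans (normr_ge0 _) (fC 1); rewrite expr1n mulr1.
suff H : (fun h : R => h^-1 *: ((f \o shift 0) (h *: (1 : R)) - f 0)) @ 0^' --> (0 : R).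
  by apply: DeriveDef; [apply/cvg_ex; exists 0|exact/cvg_lim].
apply/cvgrPdist_le => /= e e0; near=> h.
have h0 : h != 0 by near: h; exact: nbhs_dnbhs_neq.
have he : `|h| < e / (C + 1).
  by near: h; apply: dnbhs0_lt; rewrite divr_gt0// ltr_wpDl.
rewrite f0 sub0r subr0 normrN addr0 [h *: 1]mulr1 normrZ normfV.
rewrite ler_pdivrMl ?normr_gt0// (le_trans (fC h))// -real_normK ?num_real// expr2.
rewrite mulrCA ler_wpM2l//.
rewrite (le_trans (ler_wpM2l C0 (ltW he)))//.
rewrite mulrCA ler_piMr ?(ltW e0)// ler_pdivrMr ?ltr_wpDl// mul1r lerDl.
by [].
Unshelve. all: by end_near. Qed.

Lemma is_derive_flat k (x : R) :
  is_derive x 1 (flat k) (flat k.+2 x - k%:R * flat k.+1 x).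
Proof.
have [x0|x0|->] := ltgtP x 0.
- rewrite {2 3}/flat !(ltNge 0) (ltW x0)/= mulr0 subr0.
  apply: (@near_eq_is_derive _ _ _ (cst 0)).
  near=> y; rewrite /flat ltNge (_ : y <= 0)//; apply: ltW.
  by near: y; exact: lt_nbhsl.
- have xn0 : x != 0 by rewrite gt_eqF.
  have dV : is_derive x (1:R) (fun y : R => y^-1) (- (x^-1) ^+ 2).
    have := @is_deriveV R id x 1 1 xn0 (is_derive_id _ _).
    move/is_derive_eq; apply.
    by rewrite -exprVn [LHS]mulr1.
  have dE : is_derive x (1:R) (fun y : R => expR (- y^-1)) (expR (- x^-1) * (x^-1) ^+ 2).
    apply: (@is_derive1_comp R expR (fun y => - y^-1)).
    by have := is_deriveN dV; rewrite opprK.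
  have dX : is_derive x (1:R) (fun y : R => y^-1 ^+ k) (- (k%:R * (x^-1) ^+ k.+1)).
    have -> : (fun y : R => y^-1 ^+ k) = (@GRing.inv R) ^+ k.
      by apply/funext => y; rewrite exprfctE.
    have /is_derive_eq := is_deriveX k dV; apply.
    rewrite /GRing.scale/= -mulr_natl.
    case: k => [|k]; first by rewrite !mul0r oppr0.
    by rewrite [k.+1.-1]/= !exprS; ring.
  have dM := is_deriveM dX dE.
  apply: (near_eq_is_derive _ (is_derive_eq dM _)).
    near=> y; rewrite /flat ifT//.
    by near: y; exact: lt_nbhsr.
  rewrite /flat x0 /GRing.scale/= !exprS; ring.
- have -> : flat k.+2 0 - k%:R * flat k.+1 0 = 0.
    by rewrite /flat ltxx mulr0 subr0.
  apply: (@is_derive_quad _ (k.+2)`!%:R) => y.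
  by rewrite ger0_norm ?flat_ge0// flat_le.
Unshelve. all: by end_near. Qed.

Lemma smooth1_flat k : smooth1 (flat k).
Proof.
move=> m; elim: m k => // m IH k; apply: nderivableS.
  by move=> x; exact: is_derive_flat.
have -> : (fun x => flat k.+2 x - k%:R * flat k.+1 x) =
          (fun x => flat k.+2 x + (- k%:R) * flat k.+1 x).
  by apply/funext => x; rewrite mulNr.
by apply: nderivableD => //; apply: nderivableM => //; exact: nderivable_cst.
Qed.

Lemma smooth_bump (l r : R) : exists b, [/\ smooth1 b, forall x, 0 <= b x,
  forall x, l < x < r -> 0 < b x & forall x, b x != 0 -> l < x < r].
Proof.
exists (fun x => flat 0 (1 * x + (- l)) * flat 0 ((-1) * x + r)); split.
- by move=> k; apply: nderivableM; apply: nderivable_affine; exact: smooth1_flat.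
- by move=> x; rewrite mulr_ge0// flat_ge0.
- move=> x /andP[lx xr]; rewrite mulr_gt0// flat_gt0//.
    by rewrite mul1r subr_gt0.
  by rewrite mulN1r addrC subr_gt0.
- move=> x; rewrite mulf_eq0 negb_or => /andP[]; rewrite /flat.
  case: ifP; last by rewrite eqxx.
  rewrite mul1r subr_gt0 => -> _; case: ifP; last by rewrite eqxx.
  by rewrite mulN1r addrC subr_gt0.
Qed.

(** A normalized primitive of a bump. *)
Lemma smooth_step (l r : R) : l < r -> exists b,
  [/\ smooth1 b, forall x, 0 <= b x <= 1, (forall x, x <= l -> b x = 0) /\ (forall x, r <= x -> b x = 1),
    forall x, 0 <= (derive1 b) x & forall x, (derive1 b) x != 0 -> l < x < r].
Proof.
move=> lr; have [a [sa a0 apos asupp]] := smooth_bump l r.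
have ca := smooth1_continuous sa.
(* The primitive starts at [l - 1] so that [l] is an interior point, where it
   can be differentiated. *)
pose F x := (\int[lebesgue_measure]_(t in `[(l - 1)%R, x]) (a t))%R.
have ai x : lebesgue_measure.-integrable `[l - 1, x] (EFin \o a).
  apply: continuous_compact_integrable; first exact: segment_compact.
  exact: continuous_subspaceT.
have Fl x : x <= l -> F x = 0.
  move=> xl; rewrite /F; under eq_Rintegral.
    move=> y; rewrite inE/= in_itv/= => /andP[_ yx].
    have -> : a y = 0.
      apply/eqP/negPn/negP => /asupp/andP[ly _].
      by move: (le_lt_trans (le_trans yx xl) ly); rewrite ltxx.
    over.
  by rewrite /Rintegral integral0.
have dF (x : R) : is_derive x 1 F (a x).
  have [xl|lx] := ltP x l.
    have -> : a x = 0.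
      apply/eqP/negPn/negP => /asupp/andP[ly _].
      by move: (lt_trans xl ly); rewrite ltxx.
    apply: (@near_eq_is_derive _ _ _ (cst 0)).
    near=> y; rewrite Fl//; apply: ltW; near: y; exact: lt_nbhsl.
  have lx1 : l - 1 < x by rewrite (lt_le_trans _ lx)// ltrBlDr ltrDl.
  have xx1 : x < x + 1 by rewrite ltrDl.
  have [dF F'] := continuous_FTC1_closed xx1 (ai (x + 1)) lx1 (ca x).
  by rewrite -F' derive1E; exact: derivableP.
have Fmvt x y : x <= y -> exists2 c, x <= c <= y & F y - F x = a c * (y - x).
  move=> xy; have [|c] := @MVT_segment R F a x y xy (fun z _ => dF z).
    apply: derivable_within_continuous => z _; by have [] := dF z.
  by rewrite in_itv/=; exists c.
have Fmono x y : x <= y -> F x <= F y.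
  move=> xy; have [c _] := Fmvt _ _ xy; rewrite -subr_ge0 => ->.
  by rewrite mulr_ge0// subr_ge0.
have Fr x : r <= x -> F x = F r.
  move=> rx; have [c /andP[rc _] H] := Fmvt _ _ rx.
  apply/eqP; rewrite -subr_eq0 H mulf_eq0.
  have -> : a c == 0; last by [].
  apply/negPn/negP => /asupp/andP[_ cr].
  by move: (le_lt_trans rc cr); rewrite ltxx.
have Fr0 : 0 < F r.
  have Fr0 : 0 <= F r by rewrite -(Fl l)// Fmono// ltW.
  rewrite lt_neqAle Fr0 andbT eq_sym; apply/eqP => F0.
  pose m := (l + r) / 2; have lm : l < m < r by rewrite /m; apply/andP; split; lra.
  have := apos _ lm; suff -> : a m = 0 by rewrite ltxx.
  have [_ <-] := dF m.
  rewrite (@near_eq_derive _ _ _ F (cst 0)) ?derive_cst//.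
  near=> y.
  have yr : y < r by near: y; apply: lt_nbhsl; case/andP: lm.
  have ly : l < y by near: y; apply: lt_nbhsr; case/andP: lm.
  apply/eqP; rewrite eq_le -{1}F0 Fmono ?(ltW yr)//=.
  by rewrite /cst -(Fl l)// Fmono// ltW.
pose b x := (F r)^-1 * F x.
have db (x : R) : is_derive x 1 b ((F r)^-1 * a x).
  have /is_derive_eq := is_deriveZ (F r)^-1 (dF x); exact.
have b'E x : (derive1 b) x = (F r)^-1 * a x by rewrite derive1E; have [_ ->] := db x.
have Fri : 0 <= (F r)^-1 by rewrite invr_ge0 ltW.
exists b; split.
- move=> [//|k]; apply: (nderivableS db).
  by apply: nderivableM => //; exact: nderivable_cst.
- move=> x; apply/andP; split.
    rewrite mulr_ge0//; have [xl|lx] := leP x l; first by rewrite Fl.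
    by rewrite -(Fl l)// Fmono// ltW.
  rewrite ler_pdivrMl// mulr1; have [xr|rx] := leP x r; first exact: Fmono.
  by rewrite Fr// ltW.
- split=> x xl; first by rewrite /b (Fl x)// mulr0.
  by rewrite /b (Fr x)// mulVf// gt_eqF.
- by move=> x; rewrite b'E mulr_ge0.
- by move=> x; rewrite b'E mulf_eq0 negb_or => /andP[_ /asupp].
Unshelve. all: by end_near. Qed.

End smooth_line.

(** * Test functions *)

Section row_norm.
Context {R : realType}.

Lemma coord_le_norm n (v : 'rV[R]_n) i : `|v ord0 i| <= `|v|.
Proof.
by rewrite [leRHS]/Num.Def.normr/= mx_normrE; exact: (le_bigmax _ _ (ord0, i)).
Qed.

Lemma coordB n (u v : 'rV[R]_n) i : (u - v) ord0 i = u ord0 i - v ord0 i.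
Proof. by rewrite !mxE. Qed.

Lemma rV_coordE n :
  ((forall (u v : 'rV[R]_n) j i, ((u + v) j i = u j i + v j i)%R) *
   (forall (u : 'rV[R]_n) j i, ((- u) j i = - u j i)%R) *
   (forall a (u : 'rV[R]_n) j i, ((a *: u) j i = a * u j i)%R))%type.
Proof. by split; [split|]; move=> *; rewrite mxE. Qed.

Lemma norm_le_coord n (v : 'rV[R]_n) e : 0 <= e ->
  (forall i, `|v ord0 i| <= e) -> `|v| <= e.
Proof.
move=> e0 ve; rewrite [leLHS]/Num.Def.normr/= mx_normrE.
by apply: bigmax_le => //= -[i j] _ /=; rewrite ord1.
Qed.

Lemma norm_lt_coord n (v : 'rV[R]_n) e : 0 < e ->
  (forall i, `|v ord0 i| < e) -> `|v| < e.
Proof.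
move=> e0 ve; rewrite [ltLHS]/Num.Def.normr/= mx_normrE.
by apply: bigmax_lt => //= -[i j] _ /=; rewrite ord1.
Qed.

End row_norm.

Section directional.
Context {R : realType} {V W : normedModType R}.

Lemma is_derive_line (f : V -> W) (x v : V) (d : W) :
  is_derive x v f d <-> is_derive (0 : R) (1 : R) (fun h => f (h *: v + x)) d.
Proof.
have E : 'D_v f x = 'D_1 (fun h : R => f (h *: v + x)) 0.
  rewrite /derive; congr (lim _).
  apply: (congr1 (fun F : R -> W => fmap F (0 : R)^')); apply/funext => h /=.
  by rewrite addr0 scale0r add0r [_ *: 1]mulr1.
split=> -[dv dE]; split.
- exact: (derivable1P f x v).1.
- by rewrite -E.
- exact: (derivable1P f x v).2.
- by rewrite E.
Qed.

End directional.

Section ridge_algebra.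
Context {R : realType}.

(** A class of smooth functions that is small enough for gradients to be
    computed by structural induction, and that contains plateaus and is stable
    under linear changes of variables. *)
Inductive ridge_alg n : ('rV[R]_n -> R) -> Prop :=
| ridge b (a : 'cV[R]_n) : smooth1 b ->
    ridge_alg (fun v => b ((v *m a) ord0 ord0))
| ridgeD f h : ridge_alg f -> ridge_alg h -> ridge_alg (fun v => f v + h v)
| ridgeM f h : ridge_alg f -> ridge_alg h -> ridge_alg (fun v => f v * h v).

Lemma smooth1_cst (c : R) : smooth1 (fun=> c).
Proof. by move=> k; exact: nderivable_cst. Qed.

Lemma ridge_cst n c : ridge_alg (fun _ : 'rV[R]_n => c).
Proof. exact: (ridge 0 (smooth1_cst c)). Qed.

Lemma ridge_coord n b (i : 'I_n) : smooth1 b ->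
  ridge_alg (fun v : 'rV[R]_n => b (v ord0 i)).
Proof.
move=> /(ridge (delta_mx i ord0)); congr ridge_alg.
by apply/funext => v; rewrite -colE mxE.
Qed.

Lemma ridge_linear m n (f : 'rV[R]_n -> R) (L : 'M[R]_(m, n)) :
  ridge_alg f -> ridge_alg (fun v => f (v *m L)).
Proof.
elim=> [b a sb|f1 h1 _ IHf _ IHh|f1 h1 _ IHf _ IHh].
- rewrite (_ : (fun v => _) = (fun v : 'rV_m => b ((v *m (L *m a)) ord0 ord0))).
    exact: ridge.
  by apply/funext => v; rewrite mulmxA.
- exact: ridgeD.
- exact: ridgeM.
Qed.

(** The derivative is linear in the direction, and its coefficients are again
    in the class: this is both smoothness and the passage from the coordinate
    derivatives to the direction [w]. *)
Lemma ridge_gradient n f : @ridge_alg n f -> exists G : 'I_n -> 'rV[R]_n -> R,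
  (forall i, ridge_alg (G i)) /\
  forall v w, is_derive v w f (\sum_(i < n) w ord0 i * G i v).
Proof.
elim=> [b a sb|f1 h1 sf [F [sF dF]] sh [H [sH dH]]|f1 h1 sf [F [sF dF]] sh [H [sH dH]]].
- have [db sb'] := smooth1_derive sb.
  exists (fun i v => a i ord0 * derive1 b ((v *m a) ord0 ord0)); split.
    move=> i; apply: ridgeM; [exact: ridge_cst|exact: ridge].
  move=> v w; apply/is_derive_line.
  have dl := @is_derive_affine R b ((w *m a) ord0 ord0) ((v *m a) ord0 ord0) 0 _.
  have -> : \sum_(i < n) w ord0 i * (a i ord0 * derive1 b ((v *m a) ord0 ord0)) =
    (w *m a) ord0 ord0 * derive1 b ((w *m a) ord0 ord0 * 0 + (v *m a) ord0 ord0).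
    rewrite mulr0 add0r [(w *m a) _ _]mxE mulr_suml.
    by apply: eq_bigr => i _; rewrite mulrA.
  rewrite (_ : (fun h => _) =
    (fun y => b ((w *m a) ord0 ord0 * y + (v *m a) ord0 ord0))).
    by apply: dl; have [] := db ((w *m a) ord0 ord0 * 0 + (v *m a) ord0 ord0).
  by apply/funext => h; rewrite mulmxDl -scalemxAl !mxE mulrC.
- exists (fun i v => F i v + H i v); split; first by move=> i; exact: ridgeD.
  move=> v w; have /is_derive_eq := is_deriveD (dF v w) (dH v w); apply.
  by rewrite -big_split/=; apply: eq_bigr => i _; rewrite mulrDr.
- exists (fun i v => f1 v * H i v + h1 v * F i v); split.
    by move=> i; apply: ridgeD; exact: ridgeM.
  move=> v w; have /is_derive_eq := is_deriveM (dF v w) (dH v w); apply.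
  rewrite /GRing.scale/= !mulr_sumr -big_split/=; apply: eq_bigr => i _; ring.
Qed.

Lemma continuous_row_linear n (a : 'cV[R]_n) :
  continuous (fun v : 'rV[R]_n => (v *m a) ord0 ord0).
Proof.
rewrite (_ : (fun v => _) = \sum_(i < n) (fun v : 'rV[R]_n => v ord0 i * a i ord0)).
  move=> v; elim/big_ind : _ => [|f h cf ch|i _]; first exact: cst_continuous.
    exact: continuousD.
  apply: continuousM; last exact: cst_continuous.
  exact: coord_continuous.
by apply/funext => v; rewrite mxE fct_sumE.
Qed.

Lemma ridge_continuous n f : @ridge_alg n f -> continuous f.
Proof.
elim=> [b a sb|f1 h1 _ cf _ ch|f1 h1 _ cf _ ch] v.
- apply: (@continuous_comp _ _ _ (fun v : 'rV[R]_n => (v *m a) ord0 ord0) b).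
    exact: continuous_row_linear.
  exact: smooth1_continuous.
- exact: continuousD (cf v) (ch v).
- exact: continuousM (cf v) (ch v).
Qed.

Lemma ridge_measurable n f : @ridge_alg n f -> measurable_fun setT f.
Proof.
elim=> [b a sb|f1 h1 _ cf _ ch|f1 h1 _ cf _ ch].
- apply: (@measurableT_comp _ _ _ _ _ _ b _ (fun v : 'rV[R]_n => (v *m a) ord0 ord0)).
    by apply: continuous_measurable_fun; exact: smooth1_continuous.
  under eq_fun do rewrite mxE.
  apply: measurable_sum => i; apply: measurable_funM => //.
  exact: measurable_coord.
- exact: measurable_funD.
- exact: measurable_funM.
Qed.

Lemma partial_delta n (G : 'I_n -> R) i :
  \sum_(j < n) (delta_mx ord0 i : 'rV[R]_n) ord0 j * G j = G i.
Proof.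
rewrite (bigD1 i)//= mxE !eqxx mul1r big1 ?addr0// => j /negPf ji.
by rewrite mxE ji andbF mul0r.
Qed.

Lemma ridge_smooth n f : @ridge_alg n f -> smooth_on setT f.
Proof.
move=> sf k; elim: k f sf => [|k IH] f sf; split => //;
  try by move=> y _; exact: ridge_continuous.
have [G [sG dG]] := ridge_gradient sf.
move=> i; split; first by move=> y _; have [] := dG y (delta_mx ord0 i).
rewrite (_ : partial i f = G i); first exact: IH.
by apply/funext => y; rewrite /partial; have [_ ->] := dG y (delta_mx ord0 i);
  rewrite partial_delta.
Qed.

(** The weak gradient only knows coordinate derivatives: this passes to a
    direction [w]. *)
Lemma ridge_direction n f w (d : 'rV[R]_n -> R) : @ridge_alg n f ->
  (forall v, is_derive v w f (d v)) ->
  forall v, \sum_(i < n) w ord0 i * partial i f v = d v.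
Proof.
move=> sf df v; have [G [_ dG]] := ridge_gradient sf.
have [_ <-] := df v; have [_ ->] := dG v w; apply: eq_bigr => i _.
by rewrite /partial; have [_ ->] := dG v (delta_mx ord0 i); rewrite partial_delta.
Qed.

Lemma ridge_prod n (I : finType) (F : I -> 'rV[R]_n -> R) :
  (forall i, ridge_alg (F i)) -> ridge_alg (fun v => \prod_i F i v).
Proof.
move=> sF; rewrite (_ : (fun v => _) = \big[(fun f h : 'rV[R]_n -> R => fun v => f v * h v)/(fun=> 1)]_i F i).
  apply: big_ind => //; first exact: ridge_cst.
  by move=> f h; exact: ridgeM.
apply/funext => v; elim/big_ind2 : _ => //.
by move=> x1 f x2 h -> ->.
Qed.

(** A product over the coordinates of a step up and a step down. *)
Lemma ridge_plateau n (v0 : 'rV[R]_n) r : 0 < r -> exists chi,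
  [/\ ridge_alg chi, forall v, 0 <= chi v <= 1,
      forall v, `|v - v0| <= r / 2 -> chi v = 1 &
      forall v, chi v != 0 -> `|v - v0| < r].
Proof.
move=> r0.
have lr i : v0 ord0 i - r < v0 ord0 i - r / 2 by lra.
have rl i : v0 ord0 i + r / 2 < v0 ord0 i + r by lra.
pose B i := sval (cid (smooth_step (lr i))).
pose C i := sval (cid (smooth_step (rl i))).
pose F i (v : 'rV[R]_n) := B i (v ord0 i) * (1 + (-1) * C i (v ord0 i)).
have F01 i v : 0 <= F i v <= 1.
  rewrite /F /B /C; case: cid => b /= [_ b01 _ _ _]; case: cid => c /= [_ c01 _ _ _].
  rewrite mulN1r; have /andP[b0 b1] := b01 (v ord0 i); have /andP[c0 c1] := c01 (v ord0 i).
  rewrite mulr_ge0// ?subr_ge0//= -[leRHS]mulr1 ler_pM// ?subr_ge0//.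
  by rewrite lerBlDr lerDl.
exists (fun v => \prod_i F i v); split.
- apply: ridge_prod => i; rewrite /F /B /C.
  case: cid => b /= [sb _ _ _ _]; case: cid => c /= [sc _ _ _ _].
  apply: ridgeM; first exact: ridge_coord.
  apply: ridgeD; first exact: ridge_cst.
  apply: ridgeM; first exact: ridge_cst.
  exact: ridge_coord.
- move=> v; elim/big_ind : _; first by rewrite ler01 lexx.
    move=> x y /andP[x0 x1] /andP[y0 y1]; rewrite mulr_ge0//=.
    by rewrite -[leRHS]mulr1 ler_pM.
  by move=> i _.
- move=> v vr; apply: big1 => i _; rewrite /F /B /C.
  case: cid => b /= [_ _ [_ b1] _ _]; case: cid => c /= [_ _ [c0 _] _ _].
  have := le_trans (coord_le_norm (v - v0) i) vr.
  rewrite !mxE ler_norml => /andP[h1 h2].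
  by rewrite b1 ?c0; [ring|lra|lra].
- move=> v /prodf_neq0 Fn0; apply: norm_lt_coord => // i.
  have := Fn0 i isT; rewrite /F /B /C.
  case: cid => b /= [_ _ [b0 _] _ _]; case: cid => c /= [_ _ [_ c1] _ _].
  have [vl|vl] := leP (v ord0 i) (v0 ord0 i - r); first by rewrite b0// mul0r eqxx.
  have [vr|vr _] := leP (v0 ord0 i + r) (v ord0 i).
    by rewrite c1// mulr1 subrr mulr0 eqxx.
  by rewrite !mxE ltr_norml; apply/andP; split; lra.
Qed.

End ridge_algebra.

(** * Lebesgue measure on row vectors *)

Section affine_line.
Context {R : realType}.
Local Notation mu := (@lebesgue_measure R).
Local Open Scope ereal_scope.

Lemma measurable_affine (s c : R) :
  measurable_fun [set: measurableTypeR R] (fun x : measurableTypeR R => (s * x + c)%R : measurableTypeR R).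
Proof. by apply: measurable_funD => //; apply: measurable_funM. Qed.

Lemma ge0_integral_affine (s c : R) (A : set R) (F : R -> \bar R) :
  (0 < s)%R -> measurable A -> measurable_fun A F -> (forall x, 0 <= F x) ->
  \int[mu]_(x in A) F x =
  s%:E * \int[mu]_(x in (fun x => s * x + c)%R @^-1` A) F (s * x + c)%R.
Proof.
move=> s0 mA mF F0.
pose phi (x : measurableTypeR R) : measurableTypeR R := (s * x + c)%R.
have mphi : measurable_fun setT phi by exact: measurable_affine.
have s0' : (0 <= s)%R by exact: ltW.
have E B : measurable B -> mu B = pushforward (mscale (NngNum s0') mu) phi B.
  apply: lebesgue_measure_unique => //= _ [[a b]] _ <-.
  rewrite /pushforward /mscale/=.
  rewrite (_ : phi @^-1` _ = `]((a - c) / s)%R, ((b - c) / s)%R]%classic); last first.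
    apply/seteqP; split => x /=; rewrite /phi !in_itv/=.
      by rewrite ltr_pdivrMr// ler_pdivlMr// ltrBlDr lerBrDr mulrC.
    by rewrite ltr_pdivrMr// ler_pdivlMr// ltrBlDr lerBrDr mulrC.
  rewrite !lebesgue_measure_itv/= !lte_fin ltr_pM2r ?invr_gt0// ltrD2r.
  case: ifP => _; last by rewrite mule0.
  rewrite -EFinM; congr EFin; rewrite -mulrBl mulrCA mulfV ?gt_eqF// mulr1.
  by ring.
transitivity (\int[pushforward (mscale (NngNum s0') mu) phi]_(x in A) F x).
  by apply: eq_measure_integral => //= B mB _; exact: E.
rewrite ge0_integral_pushforward//= ge0_integral_mscale//=.
- by rewrite -[X in measurable X]setTI; exact: mphi.
- apply: (measurable_comp mA) => //; first exact: image_preimage_subset.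
  exact: measurable_funS mphi.
Qed.

End affine_line.

Section lebesgue_rV_theory.
Context {R : realType}.
Local Notation mu := (@lebesgue_measure R).
Local Open Scope ereal_scope.

Lemma ge0_integral_cons n (F : 'rV[R]_n.+1 -> \bar R) :
  measurable_fun setT F -> (forall v, 0 <= F v) ->
  \int[lebesgue_rV n.+1]_v F v =
  \int[mu]_t \int[lebesgue_rV n]_u F (cons_rV (t, u)).
Proof.
move=> mF F0.
transitivity (\int[pushforward (mu \x lebesgue_rV n) (@cons_rV R n)]_v F v) => //.
rewrite ge0_integral_pushforward//; last exact: measurable_cons_rV.
rewrite fubini_tonelli1//=.
by apply: measurableT_comp => //; exact: measurable_cons_rV.
Qed.

Lemma cons_rVB n (t s : R) (u v : 'rV[R]_n) :
  (cons_rV (t, u) - cons_rV (s, v) = cons_rV ((t - s)%R, u - v))%R.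
Proof.
apply/rowP => i; case: (unliftP ord0 i) => [j ->|->].
  by rewrite [LHS]mxE [X in (_ + X)%R]mxE !cons_rVS/= !mxE.
by rewrite [LHS]mxE [X in (_ + X)%R]mxE !cons_rV0.
Qed.

Lemma uncons_rVK n (v : 'rV[R]_n.+1) : cons_rV (uncons_rV v) = v.
Proof.
apply/rowP => i; case: (unliftP ord0 i) => [j ->|->].
  by rewrite cons_rVS/= mxE.
by rewrite cons_rV0.
Qed.

Lemma measurable_shift n (a : 'rV[R]_n) :
  measurable_fun setT (fun v : 'rV[R]_n => (v - a)%R).
Proof.
apply: measurable_fun_coordP => i; under eq_fun do rewrite !mxE.
by apply: measurable_funB => //; exact: measurable_coord.
Qed.

(** Tonelli reduces translation invariance to the line. *)
Lemma ge0_integral_shift n (a : 'rV[R]_n) (F : 'rV[R]_n -> \bar R) :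
  measurable_fun setT F -> (forall v, 0 <= F v) ->
  \int[lebesgue_rV n]_v F (v - a)%R = \int[lebesgue_rV n]_v F v.
Proof.
elim: n a F => [|n IH] a F mF F0.
  by apply: eq_integral => v _; congr F; apply/rowP => -[].
have mFs : measurable_fun setT (fun v : 'rV[R]_n.+1 => F (v - a)%R).
  by apply: measurableT_comp => //; exact: measurable_shift.
rewrite !ge0_integral_cons//.
rewrite -(uncons_rVK a); set a0 := (uncons_rV a).1; set a' := (uncons_rV a).2.
under eq_integral => t _.
  under eq_integral => u _ do rewrite cons_rVB.
  rewrite (IH a' (fun u => F (cons_rV ((t - a0)%R, u)))) //; last first.
    apply: measurableT_comp => //.
    by apply: measurableT_comp; [exact: measurable_cons_rV|exact: measurable_pair1].
  over.
have mG : measurable_fun setT (fun t : R => \int[lebesgue_rV n]_u F (cons_rV (t, u))).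
  apply: (@measurable_fun_fubini_tonelli_F _ _ _ _ _ (lebesgue_rV n) (fun x => F (cons_rV x))) => //.
  by apply: measurableT_comp => //; exact: measurable_cons_rV.
rewrite /= [RHS](@ge0_integral_affine _ 1 (- a0))//; last first.
  by move=> x; exact: integral_ge0.
rewrite mul1e preimage_setT; apply: eq_integral => t _; by rewrite mul1r.
Qed.

Definition box n (v0 : 'rV[R]_n) (r : R) : set 'rV[R]_n :=
  [set v | forall i, (`|(v - v0) ord0 i| <= r)%R].

Lemma measurable_box n (v0 : 'rV[R]_n) r : measurable (box v0 r).
Proof.
rewrite (_ : box v0 r = \bigcap_(i in [set: 'I_n])
    ((fun v : 'rV[R]_n => v ord0 i - v0 ord0 i)%R @^-1` `[(- r)%R, r]%classic)).
  apply: fin_bigcap_measurable => // i _; rewrite -[X in measurable X]setTI.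
  by apply: measurable_funB => //; exact: measurable_coord.
apply/seteqP; split => v /= vr i; have := vr i; rewrite ?in_itv/= !mxE ler_norml//.
by move=> /(_ I).
Qed.

Lemma lebesgue_rV_box n (v0 : 'rV[R]_n) r : (0 <= r)%R ->
  lebesgue_rV n (box v0 r) = ((2 * r) ^+ n)%:E.
Proof.
move=> r0; elim: n v0 => [|n IH] v0.
  transitivity (@dirac _ _ (0%R : 'rV[R]_0) R (box v0 r)) => //.
  by rewrite expr0 diracE mem_set//= => -[].
transitivity ((mu \x lebesgue_rV n) (@cons_rV R n @^-1` box v0 r)) => //.
pose a := v0 ord0 ord0.
rewrite (_ : _ @^-1` _ = `[(a - r)%R, (a + r)%R]%classic `*` box (uncons_rV v0).2 r).
  rewrite product_measure1E//; last exact: measurable_box.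
  transitivity (mu `[(a - r)%R, (a + r)%R]%classic * ((2 * r) ^+ n)%:E).
    by rewrite -(IH (uncons_rV v0).2).
  rewrite lebesgue_measure_itv/= lte_fin.
  have [r00|r00] := eqVneq r 0%R.
    by rewrite r00 subr0 addr0 ltxx mul0e mulr0 exprS mul0r.
  rewrite ifT; last first.
    have : (0 < r)%R by rewrite lt_neqAle eq_sym r00.
    by lra.
  by rewrite -EFinB -EFinM exprS; congr ((_ * _)%:E)%R; rewrite /a; lra.
apply/seteqP; split => [[t u] /= tu|[t u] /= [ta ub] i].
  split.
    have := tu ord0; rewrite coordB cons_rV0/= in_itv/= ler_norml => /andP[h1 h2].
    by apply/andP; split; rewrite /a; lra.
  move=> i; have := tu (lift ord0 i).
  by rewrite !coordB cons_rVS/= mxE.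
case: (unliftP ord0 i) => [j ->|->].
  by have := ub j; rewrite !coordB cons_rVS/= mxE.
rewrite coordB cons_rV0/=; move: ta; rewrite in_itv/= /a ler_norml => /andP[h1 h2].
by apply/andP; split; lra.
Qed.

(** An open set is a countable union of boxes with rational centres. *)
Lemma measurable_open_rV n (U : set 'rV[R]_n) : open U -> measurable U.
Proof.
move=> oU.
pose B (x : 'rV[rat]_n * nat) : set 'rV[R]_n :=
  box (map_mx ratr x.1 : 'rV[R]_n) (x.2.+1%:R^-1)%R.
rewrite (_ : U = \bigcup_(x in [set x | B x `<=` U]) B x).
  rewrite bigcup_mkcond; apply: countable_bigcupT_measurable => // x.
  by case: ifP => // _; exact: measurable_box.
apply/seteqP; split => [x Ux|x [y /= + yx]]; last exact.
have /nbhs_ballP[e/= e0 xU] : nbhs x U by exact: open_nbhs_nbhs.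
have [k ke] : exists k : nat, (k.+1%:R^-1 < e / 2 :> R)%R.
  have e2 : (0 < e / 2 :> R)%R by rewrite divr_gt0.
  exists (Num.trunc (e / 2)^-1); rewrite invf_plt ?posrE//.
  by rewrite truncnS_gt.
have k0 : (0 < k.+1%:R^-1 :> R)%R by rewrite invr_gt0.
have /choice[q qx] : forall i, exists q : rat, (`|x ord0 i - ratr q| < k.+1%:R^-1)%R.
  move=> i; have [|q] := @rat_in_itvoo R (x ord0 i - k.+1%:R^-1)%R (x ord0 i + k.+1%:R^-1)%R.
    by rewrite ltrBlDr -addrA ltrDl addr_gt0.
  rewrite in_itv/= => /andP[h1 h2]; exists q.
  have D (a b c : R) : (a - c < b -> b < a + c -> `|a - b| < c)%R.
    by move=> ? ?; rewrite ltr_norml; apply/andP; split; lra.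
  exact: D.
exists ((\row_i q i)%R, k) => /=.
  move=> v vq; apply: xU; rewrite -ball_normE/=.
  apply: norm_lt_coord => // i.
  have := vq i; have := qx i; rewrite !mxE/= => h1 h2.
  rewrite -(subrKA (ratr (q i))).
  have := ler_normD (x ord0 i - ratr (q i))%R (ratr (q i) - v ord0 i)%R.
  rewrite [X in (_ <= _ + X)%R]distrC => /le_lt_trans; apply.
  by rewrite [ltRHS]splitr ltrD// ?(lt_trans h1)// (le_lt_trans h2).
move=> i /=; rewrite !mxE; exact/ltW/qx.
Qed.

End lebesgue_rV_theory.

(** * Transport along parallel segments *)

Section shear.
Context {R : realType} {n : nat}.
Implicit Types (u : 'rV[R]_n) (z : 'rV[R]_n.+1) (t : R).

(** The foot, in the hyperplane [z_0 = 0], of the line through [z] directed by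
    [(1, w')]. *)
Definition shear (w' : 'rV[R]_n) z : 'rV[R]_n := (uncons_rV z).2 - z ord0 ord0 *: w'.

Definition shear_mx (w' : 'rV[R]_n) : 'M[R]_(n.+1, n) :=
  \matrix_(i, j) (if unlift ord0 i is Some k then (k == j)%:R else - w' ord0 j).

Lemma shear_linear (w' : 'rV[R]_n) z : shear w' z = z *m shear_mx w'.
Proof.
apply/rowP => i; rewrite [RHS]mxE big_ord_recl !mxE unlift_none mulrN addrC.
congr (_ + _); rewrite (bigD1 i)//= big1 ?addr0; last first.
  by move=> j /negPf ji; rewrite !mxE liftK ji mulr0.
by rewrite !mxE liftK eqxx mulr1.
Qed.

Lemma shear_cons (w' : 'rV[R]_n) t u : shear w' (cons_rV (t, u)) = u - t *: w'.
Proof. by rewrite /shear cons_rVK cons_rV0. Qed.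

Lemma ridge_shear (w' : 'rV[R]_n) (f : 'rV[R]_n -> R) : ridge_alg f ->
  ridge_alg (fun z => f (shear w' z)).
Proof.
move=> /(ridge_linear (shear_mx w')); congr ridge_alg.
by apply/funext => z; rewrite shear_linear.
Qed.

Lemma is_derive_shear (w' : 'rV[R]_n) (f : 'rV[R]_n -> R) z :
  is_derive z (cons_rV (1, w')) (fun z => f (shear w' z)) 0.
Proof.
apply/is_derive_line.
rewrite (_ : (fun h : R => _) = cst (f (shear w' z))).
  exact: (is_derive_cst (f (shear w' z)) (0 : R) (1 : R)).
apply/funext => h /=; congr f.
rewrite !shear_linear mulmxDl -scalemxAl -(shear_linear _ (cons_rV _)) shear_cons.
by rewrite scale1r subrr scaler0 add0r.
Qed.

(** The first coordinate is the parameter of the lines directed by [(1, w')]. *)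
Lemma is_derive_coord0 (w' : 'rV[R]_n) (b : R -> R) z : smooth1 b ->
  is_derive z (cons_rV (1, w')) (fun z => b (z ord0 ord0))
    (derive1 b (z ord0 ord0)).
Proof.
move=> sb; have [db _] := smooth1_derive sb; apply/is_derive_line.
rewrite (_ : (fun h : R => _) = (fun h => b (1 * h + z ord0 ord0))).
  have := @is_derive_affine R b 1 (z ord0 ord0) 0.
  rewrite mulr0 add0r mul1r; apply; by have [] := db (z ord0 ord0).
by apply/funext => h; rewrite 2!mxE cons_rV0/= mulr1 mul1r.
Qed.

End shear.

Section step_integral.
Context {R : realType}.
Local Notation mu := (@lebesgue_measure R).

Lemma ge0_integral_step (l r : R) (b : R -> R) : l < r -> smooth1 b ->
  b l = 0 -> b r = 1 -> (forall x, 0 <= derive1 b x) ->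
  (forall x, derive1 b x != 0 -> l < x < r) ->
  (\int[mu]_x (derive1 b x)%:E = 1)%E.
Proof.
move=> lr sb bl br b'0 b'supp; have [db sb'] := smooth1_derive sb.
have cb := smooth1_continuous sb; have cb' := smooth1_continuous sb'.
rewrite (_ : (\int[mu]_x (derive1 b x)%:E)%E =
    (\int[mu]_(x in `[l, r]) (derive1 b x)%:E)%E).
  rewrite (@continuous_FTC2 _ _ b)//.
  - by rewrite br bl sube0.
  - exact: continuous_subspaceT.
  - split; first by move=> x _; have [] := db x.
      exact: cvg_at_right_filter (cb l).
    exact: cvg_at_left_filter (cb r).
rewrite [RHS]integral_mkcond; apply: eq_integral => x _.
rewrite patchE; case: ifPn => //; rewrite notin_setE/= in_itv/= => /negP xlr.
congr EFin; apply/eqP/negPn/negP => /b'supp /andP[lx xr].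
by move: xlr; rewrite !ltW.
Qed.

(** On the slice [z_0 = t] the second factor is a translate of [f], and the
    first factor has total mass 1. *)
Lemma ge0_integral_shear_step n (w' : 'rV[R]_n) (l r : R) (b : R -> R) f :
  l < r -> smooth1 b -> b l = 0 -> b r = 1 -> (forall x, 0 <= derive1 b x) ->
  (forall x, derive1 b x != 0 -> l < x < r) ->
  ridge_alg f -> (forall u, 0 <= f u) ->
  (\int[lebesgue_rV n.+1]_z (derive1 b (z ord0 ord0) * f (shear w' z))%:E =
   \int[lebesgue_rV n]_u (f u)%:E)%E.
Proof.
move=> lr sb bl br b'0 b'supp rf f0; have [_ sb'] := smooth1_derive sb.
have mf : measurable_fun setT (fun u : 'rV[R]_n => (f u)%:E).
  by apply/measurable_EFinP; exact: ridge_measurable.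
have mb' : measurable_fun setT (fun t : R => (derive1 b t)%:E).
  by apply/measurable_EFinP; apply: continuous_measurable_fun; exact: smooth1_continuous.
rewrite ge0_integral_cons; last 2 first.
- apply/measurable_EFinP; apply: ridge_measurable; apply: ridgeM.
    exact: ridge_coord.
  exact: ridge_shear.
- by move=> z; rewrite lee_fin mulr_ge0.
under eq_integral => t _.
  under eq_integral => u _ do rewrite cons_rV0 shear_cons /= EFinM.
  rewrite ge0_integralZl_EFin//; last 2 first.
  - by move=> u _; rewrite lee_fin.
  - exact: (measurableT_comp mf (measurable_shift _)).
  rewrite (@ge0_integral_shift _ _ (t *: w') (fun u => (f u)%:E))//.
  over.
rewrite /= ge0_integralZr//.
- by rewrite (ge0_integral_step lr)// mul1e.
- by move=> t _; rewrite lee_fin.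
- by apply: integral_ge0 => u _; rewrite lee_fin.
Qed.

End step_integral.

Lemma boxE {R : realType} n (v0 : 'rV[R]_n) r : 0 <= r ->
  box v0 r = [set v | `|v - v0| <= r].
Proof.
move=> r0; apply/seteqP; split => v /= vr; first exact: norm_le_coord.
by move=> i; exact: le_trans (coord_le_norm _ _) vr.
Qed.

Lemma compact_box {R : realType} n (v0 : 'rV[R]_n) r : compact (box v0 r).
Proof.
rewrite (_ : box v0 r =
  [set v : 'rV[R]_n | forall i, `[v0 ord0 i - r, v0 ord0 i + r]%classic (v ord0 i)]).
  apply: (@rV_compact _ _ (fun i => `[v0 ord0 i - r, v0 ord0 i + r]%classic)) => i.
  exact: segment_compact.
by apply/seteqP; split => v /= vr i; have := vr i;
  rewrite coordB in_itv/= ler_norml => /andP[h1 h2]; apply/andP; split; lra.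
Qed.

Section covering.
Context {R : realType} {n : nat}.
Variables (w' u0 : 'rV[R]_n) (r T0 T1 : R) (U : set 'rV[R]_n.+1).
Variable b0 : R -> R.
Hypotheses (T01 : T0 < T1) (sb0 : smooth1 b0)
  (b0_01 : forall x, 0 <= b0 x <= 1)
  (b0l : forall x, x <= T0 -> b0 x = 0) (b0r : forall x, T1 <= x -> b0 x = 1)
  (b0'_ge0 : forall x, 0 <= derive1 b0 x)
  (b0'_supp : forall x, derive1 b0 x != 0 -> T0 < x < T1).

Let w : 'rV[R]_n.+1 := cons_rV (1, w').

(** The triple [x] stands for the foot, the time and the radius of a small
    tube. *)
Let good (x : 'rV[R]_n * R * R) :=
  [/\ 0 < x.2, T0 <= x.1.2 - x.2, x.1.2 + x.2 <= T1 &
    forall t u, `|t - x.1.2| < x.2 -> `|u - x.1.1| < x.2 ->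
      `|u - u0| < r /\ U (cons_rV (t, u + t *: w'))].

(** [s] cuts off the transversal variable and [alpha] is the mass of
    [derive1 b0 (z 0) * s (shear z)] transported along [w] into [U]; [Psi] is
    the potential of this transport. *)
Definition transport (s : 'rV[R]_n -> R) (Psi alpha : 'rV[R]_n.+1 -> R) :=
  [/\ [/\ ridge_alg s, ridge_alg Psi & ridge_alg alpha],
     [/\ forall u, 0 <= s u <= 1, forall u, s u != 0 -> `|u - u0| < r,
       forall z, `|Psi z| <= s (shear w' z) &
       forall z, Psi z != 0 -> T0 < z ord0 ord0 < T1],
     (forall z, 0 <= alpha z) /\ (forall z, alpha z != 0 -> U z),
     forall z, is_derive z w Psi
       (alpha z - derive1 b0 (z ord0 ord0) * s (shear w' z)) &
     (\int[lebesgue_rV n.+1]_z (alpha z)%:E = \int[lebesgue_rV n]_u (s u)%:E)%E].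

(** Each new tube takes the part [th = chi * (1 - s)] of its plateau that the
    previous ones leave, so that [s] stays below 1 and equals 1 on all the
    plateaus treated. The mass [th] is moved from the step [b0], common to all
    tubes, to a step [a] inside [U]. Its potential is [(a - b0) * th]: both
    steps go from 0 to 1, so their difference vanishes at both ends. *)
Let transport_cover (l : seq ('rV[R]_n * R * R)) :
  (forall x, x \in l -> good x) ->
  exists s Psi alpha, transport s Psi alpha /\
    forall u x, x \in l -> `|u - x.1.1| <= x.2 / 2 -> s u = 1.
Proof.
elim: l => [_|[[uj tj] rho] l IH gl].
  exists (fun=> 0), (fun=> 0), (fun=> 0); split => //; split => //.
  - by split; exact: ridge_cst.
  - split => //; try by move=> u; rewrite ?eqxx ?lexx ?ler01 ?normr0.
  - by split => // z; rewrite eqxx.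
  - move=> z; rewrite mulr0 subr0.
    exact: (is_derive_cst (0 : R) z w).
  - by rewrite !integral0.
have [|s [Psi [alpha [[[rs rPsi ralpha] [s01 ssupp Psis Psisupp] [a0 asupp] dPsi inta] scov]]]] := IH.
  by move=> x xl; apply: gl; rewrite in_cons xl orbT.
have /= [rho0 Tl Tr gj] := gl (uj, tj, rho) (mem_head _ _).
have [chi [rchi chi01 chi1 chisupp]] := ridge_plateau uj rho0.
have lr : tj - rho < tj + rho by rewrite ltrD2l gtrN.
have [a [sa a01 [al ar] a'0 a'supp]] := smooth_step lr.
have [_ sa'] := smooth1_derive sa.
pose th u := chi u * (1 + (-1) * s u).
have rth : ridge_alg th.
  apply: ridgeM => //; apply: ridgeD; first exact: ridge_cst.
  by apply: ridgeM => //; exact: ridge_cst.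
have th0 u : 0 <= th u.
  have /andP[c0 c1] := chi01 u; have /andP[s0 s1] := s01 u.
  by rewrite /th mulN1r mulr_ge0// subr_ge0.
have sth u : s u + th u <= 1.
  have /andP[c0 c1] := chi01 u; have /andP[s0 s1] := s01 u.
  have := mulr_ge0 (_ : 0 <= 1 - chi u) (_ : 0 <= 1 - s u).
  by rewrite !subr_ge0 => /(_ c1 s1); rewrite /th; nra.
have thsupp u : th u != 0 -> `|u - uj| < rho.
  by rewrite /th mulf_eq0 negb_or => /andP[/chisupp].
have tjr : `|tj - tj| < rho by rewrite subrr normr0.
have rA : ridge_alg (fun z : 'rV[R]_n.+1 => derive1 a (z ord0 ord0) * th (shear w' z)).
  by apply: ridgeM; [exact: ridge_coord|exact: ridge_shear].
have rB : ridge_alg (fun z : 'rV[R]_n.+1 =>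
    a (z ord0 ord0) + (-1) * b0 (z ord0 ord0)).
  apply: ridgeD; first exact: ridge_coord.
  by apply: ridgeM; [exact: ridge_cst|exact: ridge_coord].
exists (fun u => s u + th u),
  (fun z => Psi z + (a (z ord0 ord0) + (-1) * b0 (z ord0 ord0)) * th (shear w' z)),
  (fun z => alpha z + derive1 a (z ord0 ord0) * th (shear w' z)).
split; first split.
- split; [exact: ridgeD| |exact: ridgeD].
  by apply: ridgeD => //; apply: ridgeM => //; exact: ridge_shear.
- split.
  + by move=> u; rewrite sth andbT addr_ge0//; have /andP[] := s01 u.
  + move=> u; have [->|/ssupp//] := eqVneq (s u) 0.
    by rewrite add0r => /thsupp/(gj tj u tjr)[].
  + move=> z; rewrite (le_trans (ler_normD _ _))// lerD//.
    rewrite normrM (ger0_norm (th0 _)) -[leRHS]mul1r ler_wpM2r// mulN1r.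
    have /andP[? ?] := a01 (z ord0 ord0); have /andP[? ?] := b0_01 (z ord0 ord0).
    by rewrite ler_norml; apply/andP; split; lra.
  + move=> z; have [->|/Psisupp//] := eqVneq (Psi z) 0.
    rewrite add0r mulf_eq0 negb_or => /andP[ab _].
    have [zl|zl] := leP (z ord0 ord0) T0.
      by move: ab; rewrite b0l// al ?mulr0 ?addr0 ?eqxx// (le_trans zl).
    have [zr|//] := leP T1 (z ord0 ord0).
    by move: ab; rewrite b0r// ar ?mulr1 ?subrr ?eqxx// (le_trans Tr).
- split; first by move=> z; rewrite addr_ge0// mulr_ge0.
  move=> z; have [->|/asupp//] := eqVneq (alpha z) 0.
  rewrite add0r mulf_eq0 negb_or => /andP[/a'supp ta /thsupp uz].
  have ztj : `|z ord0 ord0 - tj| < rho.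
    by case/andP: ta => ? ?; rewrite ltr_norml; apply/andP; split; lra.
  have [_] := gj _ _ ztj uz; congr U.
  rewrite -[RHS]uncons_rVK /shear subrK; congr cons_rV.
- move=> z.
  have d1 := is_derive_coord0 w' z sa; have d2 := is_derive_coord0 w' z sb0.
  have d3 := is_derive_shear w' th z.
  have d4 := is_deriveM (is_deriveD d1 (is_deriveZ (-1) d2)) d3.
  have /is_derive_eq := is_deriveD (dPsi z) d4; apply.
  rewrite /GRing.scale/= ; ring.
- under eq_integral do rewrite EFinD.
  rewrite ge0_integralD//=; last 4 first.
  + by move=> z _; rewrite lee_fin.
  + by apply/measurable_EFinP; exact: ridge_measurable.
  + by move=> z _; rewrite lee_fin mulr_ge0.
  + by apply/measurable_EFinP; exact: ridge_measurable.
  rewrite inta (ge0_integral_shear_step w' lr)//; last 2 first.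
  + by rewrite al.
  + by rewrite ar.
  under [in RHS]eq_integral do rewrite EFinD.
  rewrite ge0_integralD//=.
  + by move=> u _; rewrite lee_fin; have /andP[] := s01 u.
  + by apply/measurable_EFinP; exact: ridge_measurable.
  + by move=> z _; rewrite lee_fin.
  + by apply/measurable_EFinP; exact: ridge_measurable.
- move=> u x; rewrite in_cons => /predU1P[->/= /chi1 c1|xl ux].
    rewrite /th c1; ring.
  by rewrite /th (scov u x)//; ring.
Qed.

(** Compactness of the cube reduces the pointwise hypothesis to finitely many
    tubes. *)
Lemma exists_transport : 0 < r -> open U ->
  (forall u, `|u - u0| <= r / 2 ->
     exists2 t, T0 < t < T1 & U (cons_rV (t, u + t *: w'))) ->
  exists s Psi alpha, transport s Psi alpha /\
    forall u, `|u - u0| <= r / 2 -> s u = 1.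
Proof.
move=> r0 oU hit.
have := @compact_box R n u0 (r / 2); rewrite compact_cover => /(_ _ [set x | good x]
  (fun x => ball x.1.1 (x.2 / 2))) [].
- by move=> x [x0 _ _ _]; apply: ball_open; rewrite divr_gt0.
- rewrite boxE ?divr_ge0 ?ltW// => u /= ur.
  have [t /andP[Tt tT] Ut] := hit u ur.
  have /nbhs_ballP[e/= e0 eU] : nbhs (cons_rV (t, u + t *: w')) U by exact: open_nbhs_nbhs.
  have w0 : 0 < 1 + `|w'| by rewrite ltr_pwDl.
  (* Moving [u] and [t] by [rho] moves the point by at most
     [rho * (1 + `|w'|)]. *)
  pose rho := Num.min (Num.min (t - T0) (T1 - t)) (Num.min (r / 2) (e / (1 + `|w'|))).
  have rho0 : 0 < rho by rewrite /rho !lt_min !subr_gt0 Tt tT !divr_gt0.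
  have : rho <= rho by [].
  rewrite {2}/rho !le_min => /andP[/andP[h1 h2] /andP[h3 h4]].
  exists (u, t, rho); last by apply: ballxx; rewrite divr_gt0.
  split => //=; first by rewrite lerBrDl -lerBrDr.
    by rewrite -lerBrDl.
  move=> t' u' tt uu; split.
    rewrite -(subrKA u) (le_lt_trans (ler_normD _ _))// [ltRHS]splitr ltr_leD//.
    exact: lt_le_trans uu h3.
  apply: eU; rewrite -ball_normE/= cons_rVB.
  move: h4; rewrite ler_pdivlMr// => h4.
  have h5 : rho <= e by rewrite (le_trans _ h4)// -[leLHS]mulr1 ler_wpM2l ?lerDl// ltW.
  apply: norm_lt_coord => // i; case: (unliftP ord0 i) => [k ->|->].
    rewrite cons_rVS/=.
    rewrite (_ : _ ord0 k = (u - u') ord0 k + (t - t') * w' ord0 k); last first.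
      by rewrite !mxE; ring.
    rewrite (le_lt_trans (ler_normD _ _))// (lt_le_trans _ h4)// mulrDr mulr1.
    rewrite ltr_leD//; first by rewrite (le_lt_trans (coord_le_norm _ _))// distrC.
    by rewrite normrM ler_pM ?coord_le_norm// distrC ltW.
  by rewrite cons_rV0/= (lt_le_trans _ h5)// distrC.
- move=> D Dgood Dcov.
  have [x|s [Psi [alpha [tr scov]]]] := @transport_cover (finmap.enum_fset D).
    by move=> /Dgood; rewrite inE.
  exists s, Psi, alpha; split => // u ur.
  have /Dcov[x /= xD ux] : box u0 (r / 2) u by rewrite boxE ?divr_ge0 ?ltW.
  by move: ux; rewrite -ball_normE/= distrC => /ltW; exact: scov.
Qed.

End covering.

(** * The tube estimate *)

Section locally_integrable.
Context {R : realType} {n : nat}.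
Local Notation lam := (@lebesgue_rV R n).
Implicit Types (f h : 'rV[R]_n -> R) (K Omega : set 'rV[R]_n).

Lemma ridge_bounded K f : compact K -> ridge_alg f ->
  exists2 C, 0 <= C & forall z, K z -> `|f z| <= C.
Proof.
move=> cK rf.
have : compact (f @` K).
  by apply: continuous_compact => //; apply: continuous_subspaceT; exact: ridge_continuous.
move=> /compact_bounded[M [_ MK]]; exists (`|M| + 1) => // z Kz.
apply: (MK (`|M| + 1)); last by exists z.
by rewrite (le_lt_trans (ler_norm _))// ltrDl.
Qed.

Lemma lebesgue_rV_box_fin (c : 'rV[R]_n) rho : (lam (box c rho) < +oo)%E.
Proof.
have [rho0|rho0] := leP 0 rho; first by rewrite lebesgue_rV_box// ltry.
have E : (lam (box c 0) < +oo)%E by rewrite lebesgue_rV_box// ltry.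
apply: (le_lt_trans (le_measure _ _ _ (_ : box c rho `<=` box c 0))).
- by rewrite inE; exact: measurable_box.
- by rewrite inE; exact: measurable_box.
- by move=> u ub i; have := ub i => /le_trans; apply; exact: ltW.
- exact: E.
Qed.

Lemma L2loc_integrable Omega f (c : 'rV[R]_n) rho : measurable Omega ->
  L2loc Omega f ->
  box c rho `<=` Omega -> lam.-integrable (box c rho) (EFin \o f).
Proof.
move=> mO [mf f2] KO.
have mfK : measurable_fun (box c rho) f by exact: measurable_funS mf.
apply/integrableP; split; first exact/measurable_EFinP.
apply: (@le_lt_trans _ _ (\int[lam]_(z in box c rho) (1 + (f z ^+ 2))%:E)%E).
  apply: ge0_le_integral => //=.
  - exact: measurable_box.
  - by apply/measurable_EFinP; exact: measurableT_comp.
  - apply/measurable_EFinP; apply: measurable_funD => //.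
    exact: measurable_funX.
  - move=> z _; rewrite lee_fin.
    have := sqr_ge0 (`|f z| - 1); rewrite -(real_normK (num_real (f z))) => h.
    have := normr_ge0 (f z); nra.
under eq_integral do rewrite EFinD.
rewrite ge0_integralD//=.
- rewrite integral_cst//=; last exact: measurable_box.
  rewrite mul1e lte_add_pinfty//; first exact: lebesgue_rV_box_fin.
  by apply: f2 => //; exact: compact_box.
- exact: measurable_box.
- by move=> z _; rewrite lee_fin sqr_ge0.
- by apply/measurable_EFinP; exact: measurable_funX.
Qed.

(** The supremum of the cutoff on its support [K] gives an integrable
    majorant. *)
Lemma integrable_mul_cutoff Omega K f h C : measurable Omega -> measurable K ->
  K `<=` Omega -> measurable_fun Omega f -> lam.-integrable K (EFin \o f) ->
  measurable_fun setT h -> (forall z, K z -> `|h z| <= C) ->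
  (forall z, ~ K z -> h z = 0) ->
  lam.-integrable Omega (fun z => (f z * h z)%:E).
Proof.
move=> mO mK KO mf fK mh hC h0.
have fK' : lam.-integrable Omega ((EFin \o f) \_ K).
  by apply/integrable_restrict => //; rewrite setIidr.
apply: (@le_integrable _ _ _ lam Omega mO _ (fun z => C%:E * ((EFin \o f) \_ K) z)%E).
- apply/measurable_EFinP; apply: measurable_funM => //.
  exact: measurable_funTS.
- move=> z Oz; rewrite patchE; case: ifPn => [/set_mem Kz|].
    rewrite -[leRHS]/(`|C * f z|%:E)%E lee_fin normrM mulrC normrM ler_wpM2r//.
    exact: le_trans (hC z Kz) (ler_norm _).
  by rewrite notin_setE => /h0 ->; rewrite mulr0 mule0.
- exact: integrableZl.
Qed.

Lemma Rintegral_lincomb Omega m (a : 'I_m -> R) (F : 'I_m -> 'rV[R]_n -> R) :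
  measurable Omega -> (forall i, lam.-integrable Omega (EFin \o F i)) ->
  lam.-integrable Omega (EFin \o (fun z => \sum_(i < m) a i * F i z)) /\
  \int[lam]_(z in Omega) (\sum_(i < m) a i * F i z) =
  \sum_(i < m) a i * \int[lam]_(z in Omega) F i z.
Proof.
move=> mO iF; elim: (index_enum _) => [|i s [IH1 IH2]].
  split.
    rewrite (_ : EFin \o _ = cst 0%E); first exact: integrable0.
    by apply/funext => z /=; rewrite big_nil.
  rewrite big_nil; under eq_Rintegral do rewrite big_nil.
  by rewrite /Rintegral integral0.
have iai : lam.-integrable Omega (EFin \o (fun z => a i * F i z)).
  rewrite (_ : EFin \o _ = (fun z => (a i)%:E * (F i z)%:E)%E)//.
  by apply: integrableZl => //; exact: iF.
split.
  rewrite (_ : EFin \o _ = (EFin \o (fun z => (a i * F i z))) \+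
    (EFin \o (fun z => \sum_(j <- s) a j * F j z))); first exact: integrableD.
  by apply/funext => z /=; rewrite big_cons.
rewrite big_cons -IH2 -RintegralZl// -RintegralD//.
by under eq_Rintegral do rewrite big_cons.
Qed.

End locally_integrable.

Section tube.
Context {R : realType} {n : nat}.
Local Notation lam := (@lebesgue_rV R n.+1).

(** As [1 <= f] on [U], the transported mass [alpha], which is at least [r ^+
    n], is at most the integral of [f * alpha]. Now [alpha] is the derivative
    of [Psi] along [w] plus [b0' s], so that testing the weak gradient against
    [Psi] bounds this integral by those of [Cb * |f|] and of the derivative of
    [f] along [w]. The factor [1 / 2] in the last hypothesis makes the sides
    of the cube equal to [r]. *)
Lemma tube_estimate (Omega U : set 'rV[R]_n.+1) f D (w' u0 : 'rV[R]_n) (r T0 T1 : R)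
    (c : 'rV[R]_n.+1) (rho : R) (b0 : R -> R) (Cb : R) :
  open Omega -> L2loc Omega f -> weak_gradient Omega f D ->
  box c rho `<=` Omega ->
  (forall z : 'rV[R]_n.+1, T0 < z ord0 ord0 < T1 -> `|shear w' z - u0| < r -> box c rho z) ->
  T0 < T1 -> smooth1 b0 -> (forall x, 0 <= b0 x <= 1) ->
  (forall x, x <= T0 -> b0 x = 0) -> (forall x, T1 <= x -> b0 x = 1) ->
  (forall x, 0 <= derive1 b0 x <= Cb) ->
  (forall x, derive1 b0 x != 0 -> T0 < x < T1) ->
  0 < r -> open U ->
  {ae lam, forall z, U z -> Omega z -> 1 <= f z} ->
  (forall u, `|u - u0| <= r / 2 ->
     exists2 t, T0 < t < T1 & U (cons_rV (t, u + t *: w'))) ->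
  ((r ^+ n)%:E <= \int[lam]_(z in box c rho) (Cb * `|f z| +
     `|\sum_(i < n.+1) (cons_rV (1, w') : 'rV_n.+1) ord0 i * D i z|)%:E)%E.
Proof.
move=> oO f2 fD KO tubeK T01 sb0 b001 b0l b0r b0'C b0'supp r0 oU fU hit.
have b0'0 x : 0 <= derive1 b0 x by case/andP: (b0'C x).
have [s [Psi [alpha [[[rs rPsi ralpha] [s01 ssupp Psis Psisupp] [a0 asupp] dPsi inta] scov]]]] :=
  exists_transport sb0 b001 b0l b0r r0 oU hit.
set K := box c rho; set w : 'rV[R]_n.+1 := cons_rV (1, w').
have mK : measurable K by exact: measurable_box.
have mO : measurable Omega by exact: measurable_open_rV.
have cK : compact K by exact: compact_box.
have PsiK z : ~ K z -> Psi z = 0.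
  move=> Kz; apply/eqP/negPn/negP => Pz; apply/Kz/tubeK; first exact: Psisupp.
  apply: ssupp; apply/eqP => s0; have := Psis z; rewrite s0 normr_le0.
  by apply/negP.
have [G [rG dG]] := ridge_gradient rPsi.
have partE i : partial i Psi = G i.
  by apply/funext => z; rewrite /partial; have [_ ->] := dG z (delta_mx ord0 i);
    rewrite partial_delta.
have clK : closed K by apply: compact_closed cK; exact: norm_hausdorff.
have GK i z : ~ K z -> G i z = 0.
  move=> Kz; rewrite -partE /partial.
  rewrite (@near_eq_derive _ _ _ Psi (cst 0)) ?derive_cst//.
  have : nbhs z (~` K) by apply: open_nbhs_nbhs; split => //; exact: closed_openC.
  by apply: filterS => y /PsiK.
have mR (h : 'rV[R]_n.+1 -> R) : ridge_alg h -> measurable_fun setT h by exact: ridge_measurable.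
have cutoff_int h g : L2loc Omega h -> ridge_alg g -> (forall z, ~ K z -> g z = 0) ->
    lam.-integrable Omega (EFin \o (fun z => h z * g z)).
  move=> h2 rg gK; have [C _ gC] := ridge_bounded cK rg.
  apply: (integrable_mul_cutoff mO mK KO _ _ (mR _ rg) gC gK).
    by case: h2.
  exact: L2loc_integrable KO.
have [tF Kpsi] : test_function Omega Psi.
  by split; [exact: ridge_smooth|exists K].
have weak : \int[lam]_(z in Omega) (f z * (\sum_(i < n.+1) w ord0 i * partial i Psi z)) =
  - \int[lam]_(z in Omega) ((\sum_(i < n.+1) w ord0 i * D i z) * Psi z).
  have [] := @Rintegral_lincomb R n.+1 Omega _ (fun i => w ord0 i) (fun i z => f z * G i z) mO.
    by move=> i; apply: cutoff_int => //; exact: GK.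
  move=> _ L1.
  have [] := @Rintegral_lincomb R n.+1 Omega _ (fun i => w ord0 i) (fun i z => D i z * Psi z) mO.
    by move=> i; apply: cutoff_int => //; have [] := fD i.
  move=> _ L2.
  transitivity (\int[lam]_(z in Omega) \sum_(i < n.+1) w ord0 i * (f z * G i z)).
    apply: eq_Rintegral => z _; rewrite mulr_sumr; apply: eq_bigr => i _.
    by rewrite partE; ring.
  rewrite L1.
  transitivity (- \int[lam]_(z in Omega) \sum_(i < n.+1) w ord0 i * (D i z * Psi z)).
    rewrite L2 -sumrN; apply: eq_bigr => i _; have [_ wi] := fD i.
    rewrite -mulrN -(wi Psi)//; congr (_ * _).
    by apply: eq_Rintegral => z _; rewrite partE.
  congr (- _); apply: eq_Rintegral => z _; rewrite mulr_suml.
  by apply: eq_bigr => i _; ring.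
set Dw := fun z => \sum_(i < n.+1) w ord0 i * D i z in weak *.
pose B (z : 'rV[R]_n.+1) := derive1 b0 (z ord0 ord0) * s (shear w' z).
have [_ sb0'] := smooth1_derive sb0.
have rB : ridge_alg B by apply: ridgeM; [exact: ridge_coord|exact: ridge_shear].
have BK z : ~ K z -> B z = 0.
  move=> Kz; apply/eqP/negPn/negP; rewrite mulf_eq0 negb_or => /andP[b0z sz].
  by apply/Kz/tubeK; [exact: b0'supp|exact: ssupp].
have dirE z : \sum_(i < n.+1) w ord0 i * partial i Psi z = alpha z - B z.
  exact: (ridge_direction rPsi dPsi).
have alphaK z : ~ K z -> alpha z = 0.
  move=> Kz; have := dirE z; rewrite BK// subr0 => <-.
  by rewrite big1// => i _; rewrite partE GK// mulr0.
have ialpha : lam.-integrable Omega (EFin \o alpha).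
  rewrite (_ : EFin \o alpha = (fun z => (1 * alpha z)%:E)); last first.
    by apply/funext => z /=; rewrite mul1r.
  have [C _ aC] := ridge_bounded cK ralpha.
  apply: (integrable_mul_cutoff mO mK KO _ _ (mR _ ralpha) aC alphaK) => //.
  apply: measurable_bounded_integrable => //.
    exact: lebesgue_rV_box_fin.
  exact: bounded_cst.
have ifa := cutoff_int _ _ f2 ralpha alphaK.
have ifB := cutoff_int _ _ f2 rB BK.
have iDPsi : lam.-integrable Omega (EFin \o (fun z => Dw z * Psi z)).
  have [] := @Rintegral_lincomb R n.+1 Omega _ (fun i => w ord0 i) (fun i z => D i z * Psi z) mO.
    by move=> i; apply: cutoff_int => //; have [] := fD i.
  move=> + _; congr (lam.-integrable Omega (EFin \o _)); apply/funext => z.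
  by rewrite /Dw mulr_suml; apply: eq_bigr => i _; rewrite mulrA.
have mass_ge : ((r ^+ n)%:E <= (\int[lam]_(z in Omega) alpha z)%:E)%E.
  rewrite /Rintegral fineK; last exact: integrable_fin_num.
  rewrite integral_mkcond (_ : (fun z => (alpha z)%:E) \_ Omega = EFin \o alpha); last first.
    apply/funext => z; rewrite patchE; case: ifPn => //.
    by rewrite notin_setE => Oz; rewrite /= alphaK// => /KO.
  rewrite inta (_ : r ^+ n = (2 * (r / 2)) ^+ n); last by congr (_ ^+ _); lra.
  rewrite -(lebesgue_rV_box u0); last by rewrite divr_ge0// ltW.
  rewrite -[leLHS]mul1e -integral_cst; last exact: measurable_box.
  rewrite integral_mkcond; apply: ge0_le_integral => //.
  - by move=> u _; apply: erestrict_ge0.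
  - apply/(measurable_restrictT _ _).1 => //; exact: measurable_box.
  - by apply/measurable_EFinP; exact: ridge_measurable.
  - move=> u _; rewrite patchE; case: ifPn => [/set_mem|_].
      by rewrite boxE; [move=> /scov ->|rewrite divr_ge0// ltW].
    by rewrite lee_fin; have /andP[] := s01 u.
have mass_le : \int[lam]_(z in Omega) alpha z <= \int[lam]_(z in Omega) (f z * alpha z).
  rewrite -subr_ge0 -RintegralB// /Rintegral.
  rewrite (@ae_eq_integral _ _ _ lam Omega (fun z => `|f z * alpha z - alpha z|%:E))//.
  - by rewrite fine_ge0// integral_ge0.
  - apply/measurable_EFinP; apply: measurable_funB; last exact: measurable_funTS (mR _ _).
    by apply: measurable_funM; [case: f2|exact: measurable_funTS (mR _ _)].
  - apply/measurable_EFinP; apply: measurableT_comp => //.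
    apply: measurable_funB; last exact: measurable_funTS (mR _ _).
    by apply: measurable_funM; [case: f2|exact: measurable_funTS (mR _ _)].
  - apply: filterS fU => z fz Oz; congr EFin; rewrite ger0_norm//.
    have [->|/asupp Uz] := eqVneq (alpha z) 0; first by rewrite mulr0 subrr.
    by rewrite subr_ge0 ler_peMl// fz.
have key : \int[lam]_(z in Omega) (f z * alpha z) =
    \int[lam]_(z in Omega) (f z * B z - Dw z * Psi z).
  rewrite RintegralB// -weak -[LHS](subrK (\int[lam]_(z in Omega) (f z * B z))) addrC.
  congr (_ + _); rewrite -RintegralB//; apply: eq_Rintegral => z _.
  by rewrite dirE mulrBr.
apply: (le_trans mass_ge); rewrite -lee_fin key in mass_le.
apply: (le_trans mass_le).
have ih : lam.-integrable Omega (EFin \o (fun z => f z * B z - Dw z * Psi z)).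
  exact: (integrableB mO ifB iDPsi).
rewrite /Rintegral fineK; last exact: integrable_fin_num.
have mh := measurable_int _ ih.
apply: (le_trans (lee_abs _)); apply: (le_trans (le_abse_integral lam mO mh)).
have mDw : measurable_fun Omega Dw.
  apply: measurable_sum => i; apply: measurable_funM => //.
  by have [[]] := fD i.
have OK : Omega `&` K = K by exact: setIidr.
rewrite -[in leRHS]OK integral_mkcondr; apply: ge0_le_integral => //.
- exact: measurableT_comp.
- apply/(measurable_restrict _ mK mO) => //; rewrite setIidr//.
  apply/measurable_EFinP; apply: measurable_funD.
    apply: measurable_funM => //; apply: measurableT_comp => //.
    by apply: measurable_funS KO _ => //; case: f2.
  by apply: measurableT_comp => //; exact: measurable_funS KO mDw.
- move=> z Oz; rewrite patchE; case: ifPn => [/set_mem Kz|].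
    rewrite lee_fin (le_trans (ler_normB _ _))// !normrM lerD//.
      rewrite mulrC ler_wpM2r// -[leRHS]mulr1 ler_pM//.
        by rewrite ger0_norm//; case/andP: (b0'C (z ord0 ord0)).
      by rewrite ger0_norm; have /andP[] := s01 (shear w' z).
    rewrite -[leRHS]mulr1 ler_wpM2l// (le_trans (Psis z))//.
    by have /andP[] := s01 (shear w' z).
  by rewrite notin_setE => Kz; rewrite [(EFin \o _) z]/= (BK z Kz) (PsiK z Kz) !mulr0 subrr abse0.
Qed.

End tube.

(** * Positive definite forms *)

Section posdef.
Context {R : realType} {n : nat}.
Implicit Types (g : 'M[R]_n) (u v : 'rV[R]_n).

Definition qform g v : R := (v *m g *m v^T) ord0 ord0.
Definition posdef g := g^T = g /\ forall v, v != 0 -> 0 < qform g v.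
Definition bform g u v : R := (u *m g *m v^T) ord0 ord0.

Lemma bformDl g u u' v : bform g (u + u') v = bform g u v + bform g u' v.
Proof. by rewrite /bform !mulmxDl mxE. Qed.

Lemma bformZl g a u v : bform g (a *: u) v = a * bform g u v.
Proof. by rewrite /bform -!scalemxAl mxE. Qed.

Lemma bform_sym g u v : g^T = g -> bform g u v = bform g v u.
Proof.
move=> gs; rewrite /bform (_ : (v *m _ *m _) _ _ = (v *m g *m u^T)^T ord0 ord0).
  by rewrite !trmx_mul trmxK gs mulmxA.
by rewrite [RHS]mxE.
Qed.

Lemma qform_ge0 g v : posdef g -> 0 <= qform g v.
Proof.
move=> [_ pg]; have [->|/pg/ltW//] := eqVneq v 0.
by rewrite /qform !mul0mx mxE.
Qed.

Lemma qformD g u v : g^T = g ->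
  qform g (u + v) = qform g u + 2 * bform g u v + qform g v.
Proof.
move=> gs; rewrite -![qform _ _]/(bform g _ _) bformDl.
rewrite ![bform g _ (u + v)]bform_sym// !bformDl (bform_sym v u gs); ring.
Qed.

Lemma qformZ g a v : qform g (a *: v) = a ^+ 2 * qform g v.
Proof.
by rewrite /qform linearZ/= -!scalemxAl -scalemxAr scalerA mxE expr2.
Qed.

Lemma cauchy_schwarz g u v : posdef g ->
  bform g u v ^+ 2 <= qform g u * qform g v.
Proof.
move=> pg; have [gs gp] := pg; have [->|v0] := eqVneq v 0.
  by rewrite bform_sym// /bform /qform !mul0mx mxE expr0n mulr0.
have qv := gp v v0.
have := qform_ge0 (u + (- bform g u v / qform g v) *: v) pg.
rewrite qformD// qformZ bform_sym// bformZl (bform_sym v u gs).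
set b := bform g u v; set q := qform g v; set p := qform g u => H.
have : 0 <= (p + 2 * (- b / q * b) + (- b / q) ^+ 2 * q) * q.
  by rewrite mulr_ge0// ltW.
rewrite (_ : _ * q = p * q - b ^+ 2); first by rewrite subr_ge0.
by field; rewrite gt_eqF.
Qed.

Lemma posdef_unit g : posdef g -> g \in unitmx.
Proof.
move=> [gs gp]; rewrite -row_free_unit -kermx_eq0; apply/negPn/negP => k0.
have /rowV0Pn[v /sub_kermxP vg v0] := k0.
by have := gp v v0; rewrite /qform vg mul0mx mxE ltxx.
Qed.

Lemma posdefD g (t : R) : posdef g -> 0 <= t -> posdef (g + t%:M).
Proof.
move=> [gs gp] t0; split; first by rewrite linearD/= gs tr_scalar_mx.
move=> v v0; rewrite /qform mulmxDr mulmxDl mxE ltr_pwDl//; first exact: gp.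
rewrite mul_mx_scalar -scalemxAl mxE mulr_ge0// mxE sumr_ge0// => i _.
by rewrite mxE -expr2 sqr_ge0.
Qed.

(** The determinant cannot vanish along [g + t%:M] for [0 <= t], and is positive
    for large [t]. *)
Lemma posdef_det_gt0 g : posdef g -> 0 < \det g.
Proof.
move=> pg; pose p := char_poly (- g).
have pE t : p.[t] = \det (g + t%:M).
  rewrite /p /char_poly -horner_evalE -det_map_mx; congr (\det _).
  apply/matrixP => i j; rewrite !mxE/= /horner_eval hornerD hornerN hornerMn hornerX hornerC.
  by rewrite opprK addrC.
have p0 t : 0 <= t -> p.[t] != 0.
  move=> t0; rewrite pE -unitfE -unitmxE; apply: posdef_unit.
  exact: posdefD.
have pm : 0 < lead_coef p by rewrite (monicP (char_poly_monic _)).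
have -> : \det g = p.[0].
  by rewrite pE (_ : 0%:M = 0) ?addr0//; apply/matrixP => i j; rewrite !mxE mul0rn.
rewrite ltNge; apply/negP => p00.
have [m pmm] := polyrcf.poly_pinfty_gt_lc pm.
have : 0 <= p.[Num.max 0 m] by rewrite (le_trans (ltW pm))// pmm// le_max lexx orbT.
move=> pM; have [||x /andP[x0 _] /rootP px] := @poly_ivt R p 0 (Num.max 0 m).
  by rewrite le_max lexx.
  by rewrite p00 pM.
by have := p0 x x0; rewrite px eqxx.
Qed.

(** Cauchy-Schwarz against the vector [e] dual to the coordinate. *)
Lemma coord_le_qform g v i : posdef g ->
  v ord0 i ^+ 2 <= qform g v * (invmx g) i i.
Proof.
move=> pg; have gu := posdef_unit pg.
pose e : 'rV[R]_n := delta_mx ord0 i *m invmx g.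
have [gs _] := pg.
have gis : (invmx g)^T = invmx g by rewrite trmx_inv gs.
have bE : bform g v e = v ord0 i.
  by rewrite /bform /e trmx_mul gis -mulmxA (mulmxA g) mulmxV// mul1mx trmx_delta -colE mxE.
have qE : qform g e = invmx g i i.
  rewrite /qform /e -(mulmxA _ _ g) mulVmx// mulmx1 trmx_mul gis mulmxA.
  by rewrite -rowE trmx_delta -colE !mxE.
by have := cauchy_schwarz v e pg; rewrite bE qE.
Qed.

(** The inverse form on covectors is the form on the vectors dual to them. *)
Lemma inv_formE g (D : 'I_n -> R) : posdef g ->
  \sum_(i < n) \sum_(j < n) invmx g i j * D i * D j =
  qform g ((\row_i D i) *m invmx g).
Proof.
move=> pg; have gu := posdef_unit pg; have [gs _] := pg.
have gis : (invmx g)^T = invmx g by rewrite trmx_inv gs.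
rewrite /qform -(mulmxA _ _ g) mulVmx// mulmx1 trmx_mul gis mxE.
apply: eq_bigr => i _; rewrite [X in _ = _ * X]mxE mulr_sumr; apply: eq_bigr => j _.
by rewrite !mxE; ring.
Qed.

Lemma inv_form_ge0 g (D : 'I_n -> R) : posdef g ->
  0 <= \sum_(i < n) \sum_(j < n) invmx g i j * D i * D j.
Proof. by move=> pg; rewrite inv_formE//; exact: qform_ge0. Qed.

(** Cauchy-Schwarz for [w] and the vector dual to [D]. *)
Lemma gradient_le g (w : 'rV[R]_n) (D : 'I_n -> R) : posdef g ->
  (\sum_(i < n) w ord0 i * D i) ^+ 2 <=
  qform g w * \sum_(i < n) \sum_(j < n) invmx g i j * D i * D j.
Proof.
move=> pg; have gu := posdef_unit pg; have [gs _] := pg.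
rewrite inv_formE//; set e := _ *m invmx g.
have gis : (invmx g)^T = invmx g by rewrite trmx_inv gs.
have <- : bform g w e = \sum_(i < n) w ord0 i * D i.
  rewrite /bform /e trmx_mul gis -mulmxA (mulmxA g) mulmxV// mul1mx mxE.
  by apply: eq_bigr => i _; rewrite !mxE.
exact: cauchy_schwarz.
Qed.

Definition qnorm g v : R := Num.sqrt (qform g v).

Lemma qnorm_triangle g u v : posdef g -> qnorm g (u + v) <= qnorm g u + qnorm g v.
Proof.
move=> pg; have [gs _] := pg.
have qu := qform_ge0 u pg; have qv := qform_ge0 v pg.
rewrite -(ler_pXn2r (_ : 0 < 2)%N) ?nnegrE ?addr_ge0 ?sqrtr_ge0//.
rewrite sqr_sqrtr ?qform_ge0// qformD// sqrrD !sqr_sqrtr//.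
rewrite lerD2r lerD2l -[leRHS]mulr_natl ler_wpM2l// /qnorm -sqrtrM//.
have := cauchy_schwarz u v pg => /ler_wsqrtr; rewrite sqrtr_sqr.
exact: le_trans (ler_norm _).
Qed.

Lemma qnormZ g a v : posdef g -> qnorm g (a *: v) = `|a| * qnorm g v.
Proof.
by move=> pg; rewrite /qnorm qformZ sqrtrM ?sqr_ge0// sqrtr_sqr.
Qed.

Lemma qnorm_bounded g : posdef g -> exists2 C, 0 < C & forall v, qnorm g v <= C * `|v|.
Proof.
move=> pg.
exists (Num.sqrt (\sum_(i < n) \sum_(j < n) `|g i j|) + 1) => [|v].
  by rewrite ltr_wpDl// sqrtr_ge0.
set S := \sum_i _.
have S0 : 0 <= S by apply: sumr_ge0 => i _; apply: sumr_ge0.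
apply: (@le_trans _ _ (Num.sqrt S * `|v|)); last by rewrite ler_wpM2r// lerDl.
rewrite -[X in _ * X]ger0_norm// -sqrtr_sqr -sqrtrM//; apply: ler_wsqrtr.
rewrite /qform mxE.
under eq_bigr => j _ do rewrite mxE mulr_suml.
rewrite exchange_big /S mulr_suml; apply: ler_sum => i _; rewrite mulr_suml.
apply: ler_sum => j _; rewrite mxE expr2 (le_trans (ler_norm _))// !normrM.
rewrite mulrAC [X in _ <= X]mulrC ler_wpM2r//.
by rewrite ler_pM// coord_le_norm.
Qed.

End posdef.

(** * Curves in charts *)

Section chain_rule.
Context {R : realType}.

Lemma is_derive_along (V : normedModType R) (F : V -> R) (p v : V) (s : R) :
  derivable F (s *: v + p) v ->
  is_derive s (1 : R) (fun s : R => F (s *: v + p)) ('D_v F (s *: v + p)).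
Proof.
move=> /derivableP/is_derive_line dF; set d := 'D_v F _ in dF *.
pose phi (h : R) := F (h *: v + (s *: v + p)).
have dphi : derivable phi (1 * s + - s) 1 by rewrite mul1r subrr; case: dF.
have := is_derive_affine dphi; rewrite mul1r derive1E.
have -> : 'D_1 phi (1 * s - s) = d by rewrite mul1r subrr; case: dF.
congr (is_derive _ _ _ _); apply/funext => h.
by rewrite /phi mul1r addrA -scalerDl subrK.
Qed.

(** The increment is split into steps parallel to the axes, and the mean value
    theorem applies to each of them. *)
Lemma increment_C1 n (F : 'rV[R]_n -> R) (y : 'rV[R]_n) :
  (\near y, forall i, derivable F y (delta_mx ord0 i)) ->
  (forall i, {for y, continuous (partial i F)}) ->
  forall e, 0 < e -> \forall k \near (0 : 'rV[R]_n),
    `|F (k + y) - F y - \sum_(i < n) k ord0 i * partial i F y| <= e * `|k|.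
Proof.
move=> dF cF e e0; pose e' := e / (n%:R + 1).
have n0 : 0 < n%:R + 1 :> R by rewrite ltr_wpDl.
have e'0 : 0 < e' by rewrite divr_gt0.
have [r /= r0 yr] : exists2 r, 0 < r & forall z, `|z - y| < r ->
    forall i, derivable F z (delta_mx ord0 i) /\ `|partial i F z - partial i F y| <= e'.
  have H : \forall z \near y, forall i, derivable F z (delta_mx ord0 i) /\
      `|partial i F z - partial i F y| <= e'.
    near=> z => i; split.
      by move: i; near: z.
    rewrite distrC; move: i; near: z; apply: filter_forall => i.
    by move/cvgrPdist_le : (cF i) => /(_ e' e'0).
  move/nbhs_ballP : H => [r /= r0 yr]; exists r => // z zy.
  by apply: yr; rewrite -ball_normE/= distrC.
near=> k.
have kr : `|k| < r.
  near: k; apply/nbhs_ballP; exists r => // k.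
  by rewrite -ball_normE/= sub0r normrN.
(* [p j] has moved the first [j] coordinates. *)
pose p (j : nat) : 'rV[R]_n := (\row_i (if (i < j)%N then k ord0 i else 0)) + y.
have step (j : 'I_n) : `|F (p j.+1) - F (p j) - k ord0 j * partial j F y| <= e' * `|k|.
  pose phi (s : R) := F (s *: delta_mx ord0 j + p j).
  have near_y (s : R) : 0 <= s <= 1 -> `|(k ord0 j * s + 0) *: delta_mx ord0 j + p j - y| < r.
    move=> /andP[s0 s1]; apply: le_lt_trans kr; rewrite addr0 /p addrA addrK.
    apply: norm_le_coord => // i; rewrite !mxE eqxx/=.
    have [->|ij] := eqVneq i j.
      rewrite ltnn addr0 mulr1 (le_trans _ (coord_le_norm k j))// normrM.
      by rewrite ler_piMr// ger0_norm.
    rewrite mulr0 add0r; case: ifP => _; first exact: coord_le_norm.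
    by rewrite normr0.
  have dphi (s : R) : 0 <= s <= 1 -> is_derive s (1 : R) (fun s => phi (k ord0 j * s + 0))
      (k ord0 j * partial j F ((k ord0 j * s + 0) *: delta_mx ord0 j + p j)).
    move=> s01; have [dFj _] := yr _ (near_y s s01) j.
    have [d1 d2] := is_derive_along dFj.
    have := is_derive_affine d1; rewrite derive1E d2.
    by [].
  have [|||s] := @MVT_segment R (fun s => phi (k ord0 j * s + 0))
    (fun s => k ord0 j * partial j F ((k ord0 j * s + 0) *: delta_mx ord0 j + p j)) 0 1.
  - exact: ler01.
  - by move=> s /[!in_itv]/= /andP[s0 s1]; apply: dphi; rewrite !ltW.
  - apply: derivable_within_continuous => s /[!in_itv]/= s01.
    by have [] := dphi s s01.
  - move=> /[!in_itv]/= s01; rewrite subr0 [X in _ = X -> _]mulr1.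
    have -> : phi (k ord0 j * 1 + 0) = F (p j.+1).
      rewrite /phi /p addrA mulr1 addr0; congr (F (_ + _)); apply/rowP => i.
      rewrite !mxE eqxx/= ltnS [(i <= j)%N]leq_eqVlt.
      have [->|ij] := eqVneq i j; first by rewrite eqxx/= ltnn mulr1 addr0.
      by rewrite val_eqE (negPf ij) mulr0 add0r.
    have -> : phi (k ord0 j * 0 + 0) = F (p j).
      by rewrite /phi mulr0 addr0 scale0r add0r.
    move=> ->; rewrite -mulrBr normrM mulrC ler_pM//.
      by have [_] := yr _ (near_y s s01) j.
    exact: coord_le_norm.
have pn : p n = k + y.
  by congr (_ + _); apply/rowP => i; rewrite mxE ltn_ord.
have p0 : p 0%N = y.
  by rewrite /p (_ : \row_i _ = 0) ?add0r//; apply/rowP => i; rewrite !mxE.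
rewrite -pn -[in F y]p0 -(telescope_sumr (F \o p)) // big_mkord -sumrB.
rewrite (le_trans (ler_norm_sum _ _ _))//.
apply: (@le_trans _ _ (\sum_(j < n) e' * `|k|)); first by apply: ler_sum => j _; exact: step.
rewrite sumr_const card_ord -mulr_natl mulrA ler_wpM2r// /e' mulrCA.
by rewrite ler_piMr ?(ltW e0)// ler_pdivrMr// mul1r lerDl.
Unshelve. all: by end_near. Qed.

(** The difference quotient of [F] along [s] is compared, by [increment_C1],
    with the one of the linear part of [F]. *)
Lemma is_derive_curve n (F : 'rV[R]_n -> R) (s : R -> 'rV[R]_n) t v :
  (\forall z \near s t, forall i, derivable F z (delta_mx ord0 i)) ->
  (forall i, {for s t, continuous (partial i F)}) ->
  is_derive t (1 : R) s v ->
  is_derive t (1 : R) (F \o s) (\sum_(i < n) v ord0 i * partial i F (s t)).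
Proof.
move=> dF cF ds.
set y := s t; set L := \sum_(i < n) _.
pose q (h : R) : 'rV[R]_n := h^-1 *: (s (h + t) - y).
have qv : q h @[h --> 0^'] --> v.
  have [/cvg_ex[l sl] sv] := ds.
  have E : (fun h : R => h^-1 *: ((s \o shift t) (h *: (1 : R)) - s t)) = q.
    by apply/funext => h; rewrite /q /= [h *: 1]mulr1.
  by move: sl sv; rewrite /derive E => sl; move/cvg_lim : (sl) => -> // <-.
have cs : s (h + t) - y @[h --> 0^'] --> (0 : 'rV[R]_n).
  have -> : (0 : 'rV[R]_n) = (0 : R) *: v by rewrite scale0r.
  rewrite (_ : (0 : R) *: v = 0 *: v)//.
  have : h *: q h @[h --> 0^'] --> (0 : R) *: v.
    by apply: cvgZ => //; exact: nbhs_dnbhs.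
  apply: cvg_trans; apply: near_eq_cvg; near=> h.
  have h0 : h != 0 by near: h; exact: nbhs_dnbhs_neq.
  by rewrite /q scalerA mulfV// scale1r.
suff H : (fun h : R => h^-1 *: ((F \o s \o shift t) (h *: (1 : R)) - (F \o s) t)) @ 0^' --> L.
  by apply: DeriveDef; [apply/cvg_ex; exists L|exact/cvg_lim].
have L1 : \sum_(i < n) q h ord0 i * partial i F y @[h --> 0^'] --> L.
  rewrite /L; elim: (index_enum _) => [|i r IH].
    rewrite big_nil; under eq_fun do rewrite big_nil; exact: cvg_cst.
  rewrite big_cons; under eq_fun do rewrite big_cons.
  apply: cvgD => //; apply: cvgM; last exact: cvg_cst.
  apply: (cvg_comp q (fun w : 'rV[R]_n => w ord0 i) qv); exact: coord_continuous.
suff rest : (h^-1 * ((F (s (h + t)) - F y) - h * \sum_(i < n) q h ord0 i * partial i F y))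
    @[h --> 0^'] --> (0 : R).
  have H := cvgD L1 rest; rewrite addr0 in H; refine (cvg_trans _ (H _)).
  apply: near_eq_cvg; near=> h.
  have h0 : h != 0 by near: h; exact: nbhs_dnbhs_neq.
  rewrite -[LHS]/(\sum_(i < n) q h ord0 i * partial i F y + h^-1 *
    (F (s (h + t)) - F y - h * \sum_(i < n) q h ord0 i * partial i F y)).
  by rewrite mulrBr mulrA mulVf// mul1r addrC subrK /= [h *: 1]mulr1.
apply/cvgrPdist_le => e e0.
pose e' := e / (`|v| + 1).
have v0 : 0 < `|v| + 1 by rewrite ltr_wpDl.
have e'0 : 0 < e' by rewrite divr_gt0.
have incr := increment_C1 dF cF e'0.
have {}incr := cs _ incr.
near=> h.
have h0 : h != 0 by near: h; exact: nbhs_dnbhs_neq.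
rewrite sub0r normrN normrM normfV ler_pdivrMl ?normr_gt0//.
have hq : h *: q h = s (h + t) - y by rewrite /q scalerA mulfV// scale1r.
have : `|F (s (h + t) - y + y) - F y - \sum_(i < n) (s (h + t) - y) ord0 i * partial i F y|
    <= e' * `|s (h + t) - y|.
  by near: h; exact: incr.
rewrite subrK -hq normrZ.
under eq_bigr do rewrite mxE -mulrA.
rewrite -mulr_sumr => /le_trans; apply.
rewrite mulrCA ler_wpM2l// /e' -mulrA ler_piMr ?(ltW e0)// ler_pdivrMl// mulr1.
rewrite -(subrK v (q h)) addrC (le_trans (ler_normD _ _))// lerD2l distrC.
by near: h; move/cvgrPdist_le : qv => /(_ 1 ltr01).
Unshelve. all: by end_near. Qed.

End chain_rule.

Section chart_theory.
Context {R : realType} {n : nat} {M : ptopologicalType}.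
Context {S : smooth_structure R n M}.

Lemma chart_open_image (c : chart R n M) (V : set M) : is_chart c -> open V ->
  open (c @` (chart_dom c `&` V)).
Proof.
move=> [od oi ck cc ci] oV; rewrite openE => y [p [dp Vp] cpy].
have yi : chart_img c y by exists p.
have ip : chart_inv c y = p by rewrite -cpy ck.
have H1 : \forall z \near y, (chart_dom c `&` V) (chart_inv c z).
  apply: (ci y yi); rewrite ip; apply: open_nbhs_nbhs; split; last by [].
  exact: openI.
have H2 : \forall z \near y, chart_img c z by exact: open_nbhs_nbhs.
rewrite /interior; near=> z.
exists (chart_inv c z); first by near: z.
have [p' dp' <-] : chart_img c z by near: z.
by rewrite ck.
Unshelve. all: by end_near. Qed.

Lemma velocity_transition (c d : chart R n M) (gamma : R -> M) t :
  atlas S c -> atlas S d -> {for t, continuous gamma} ->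
  chart_dom c (gamma t) -> chart_dom d (gamma t) ->
  derivable (fun s => c (gamma s)) t 1 ->
  derivable (fun s => d (gamma s)) t 1 /\
  velocity d gamma t = velocity c gamma t *m transition_jacobian c d (gamma t).
Proof.
move=> ac ad cg dc dd dcg.
have [odc _ ck _ _] := atlas_is_chart ac.
have [odd _ _ _ _] := atlas_is_chart ad.
pose F j (y : 'rV[R]_n) := d (chart_inv c y) ord0 j.
pose U := c @` (chart_dom c `&` chart_dom d).
have oU : open U by exact: chart_open_image (atlas_is_chart ac) odd.
have Uy : U (c (gamma t)) by exists (gamma t).
have sF j : smooth_on U (F j) by exact: (atlas_smooth ac ad j).
have dF j : is_derive t (1 : R) (F j \o (fun s => c (gamma s)))
    (\sum_(i < n) velocity c gamma t ord0 i * partial i (F j) (c (gamma t))).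
  have [_ s1] := sF j 1%N.
  apply: is_derive_curve.
  - have : \forall z \near c (gamma t), U z by exact: open_nbhs_nbhs.
    by apply: filterS => y Uy' i; have [+ _] := s1 i; exact.
  - by move=> i; have [_ [+ _]] := s1 i; exact.
  - by rewrite /velocity derive1E; exact: derivableP.
have near_c : \forall s \near t, chart_dom c (gamma s).
  by apply: cg; exact: open_nbhs_nbhs.
have dG j : is_derive t (1 : R) (fun s => d (gamma s) ord0 j)
    (\sum_(i < n) velocity c gamma t ord0 i * partial i (F j) (c (gamma t))).
  apply: near_eq_is_derive (dF j); near=> s; rewrite /F /= ck//.
  by near: s.
have dd' : derivable (fun s => d (gamma s)) t 1.
  by apply/derivable_mxP => i j; rewrite (ord1 i); have [] := dG j.
split => //; rewrite [LHS]/velocity derive1E derive_mx//.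
apply/matrixP => i j; rewrite !mxE (ord1 i); have [_ ->] := dG j.
by apply: eq_bigr => k _; rewrite mxE.
Unshelve. all: by end_near. Qed.

Variable g : riemannian_metric S.

Lemma gram_posdef c p : atlas S c -> chart_dom c p -> posdef (g c p).
Proof.
by move=> ac dp; split; [exact: gram_sym|move=> v; exact: gram_pos].
Qed.

(** The chart used by [speed] varies with [t]; the transformation rules of
    velocities and of the metric compensate each other, so that one chart
    suffices along a piece of curve. *)
Lemma speed_chart (c : chart R n M) (gamma : R -> M) t :
  atlas S c -> {for t, continuous gamma} -> chart_dom c (gamma t) ->
  derivable (fun s => c (gamma s)) t 1 ->
  speed g gamma t = qnorm (g c (gamma t)) (velocity c gamma t).
Proof.
move=> ac cg dc dcg; rewrite /speed /qnorm.
set d := chart_at S (gamma t).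
have ad : atlas S d by exact: chart_at_atlas.
have dd : chart_dom d (gamma t) by exact: chart_at_dom.
have [_ ->] := velocity_transition ac ad cg dc dd dcg.
congr Num.sqrt; rewrite /qform (gram_transition g ac ad dc dd).
by rewrite trmx_mul !mulmxA.
Qed.

End chart_theory.

(** * Comparison of the metric with a constant one *)

Section metric_comparison.
Context {R : realType} {n : nat}.

(** The form controls the coordinates ([coord_le_qform]), so a change of its
    coefficients is small relative to the form itself. *)
Lemma qform_perturb (g0 : 'M[R]_n) (th : R) : posdef g0 -> 0 < th ->
  exists2 eta, 0 < eta & forall g : 'M[R]_n,
    (forall i j, `|g i j - g0 i j| <= eta) ->
    forall v, `|qform g v - qform g0 v| <= th * qform g0 v.
Proof.
move=> pg th0; pose C := \sum_(i < n) `|invmx g0 i i|.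
have C0 : 0 <= C by apply: sumr_ge0.
have Ci i : invmx g0 i i <= C.
  by rewrite /C (bigD1 i)//= (le_trans (ler_norm _))// lerDl sumr_ge0.
pose K := n%:R * (n%:R * C) + 1.
have K0 : 0 < K by rewrite ltr_wpDl// !mulr_ge0.
exists (th / K); first by rewrite divr_gt0.
move=> g gg0 v; set q := qform g0 v.
have q0 : 0 <= q by exact: qform_ge0.
have vi i : v ord0 i ^+ 2 <= C * q.
  by rewrite (le_trans (coord_le_qform v i pg))// mulrC ler_wpM2r.
have vv i j : `|v ord0 i * v ord0 j| <= C * q.
  have h1 := vi i; have h2 := vi j.
  rewrite normrM; rewrite -(real_normK (num_real (v ord0 i))) in h1.
  rewrite -(real_normK (num_real (v ord0 j))) in h2.
  have := sqr_ge0 (`|v ord0 i| - `|v ord0 j|); nra.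
have -> : qform g v - q = \sum_(j < n) \sum_(i < n) (g i j - g0 i j) * (v ord0 i * v ord0 j).
  rewrite /q /qform !mxE -sumrB; apply: eq_bigr => j _.
  rewrite !mxE !mulr_suml -sumrB; apply: eq_bigr => i _; ring.
rewrite (le_trans (ler_norm_sum _ _ _))//.
apply: (@le_trans _ _ (\sum_(j < n) \sum_(i < n) th / K * (C * q))).
  apply: ler_sum => j _; rewrite (le_trans (ler_norm_sum _ _ _))//.
  by apply: ler_sum => i _; rewrite normrM ler_pM.
rewrite !sumr_const card_ord -mulrnA -[leLHS]mulr_natl natrM.
rewrite (_ : _ * _ = th * q * ((n%:R * (n%:R * C)) / K)); last first.
  by field; rewrite gt_eqF.
rewrite ler_piMr ?mulr_ge0// ?(ltW th0)// ler_pdivrMr// mul1r lerDl.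
exact: ler01.
Qed.

Lemma qnorm_perturb (g0 : 'M[R]_n) (k : R) : posdef g0 -> 1 < k ->
  exists2 eta, 0 < eta & forall g : 'M[R]_n,
    (forall i j, `|g i j - g0 i j| <= eta) ->
    forall v, qnorm g v <= k * qnorm g0 v /\ qnorm g0 v <= k * qnorm g v.
Proof.
move=> pg k1; have k0 : 0 < k by rewrite (lt_trans ltr01).
have k2 : 1 < k ^+ 2 by rewrite expr_gt1// ltW.
have k20 : 0 < k ^+ 2 by exact: lt_trans k2.
have th0 : 0 < 1 - (k ^+ 2)^-1 by rewrite subr_gt0 invf_lt1.
have [eta eta0 He] := qform_perturb pg th0; exists eta => // g gg v.
have := He g gg v; rewrite ler_norml => /andP[h1 h2].
have q0 := qform_ge0 v pg.
have kk : k = Num.sqrt (k ^+ 2) by rewrite sqrtr_sqr gtr0_norm.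
rewrite /qnorm [X in X * _]kk [X in _ /\ _ <= X * _]kk -!sqrtrM ?(ltW k20)//.
have [r r0 kr] : exists2 r, 0 < r & k ^+ 2 = r^-1.
  by exists (k ^+ 2)^-1; rewrite ?invr_gt0// invrK.
move: h1 h2; rewrite kr invrK => h1 h2.
have r1 : r < 1 by move: k2; rewrite kr -invf_lt1 ?invr_gt0// invrK.
split; apply: ler_wsqrtr.
  rewrite ler_pdivlMl//.
  have h3 : 0 <= (1 - r) ^+ 2 * qform g0 v by rewrite mulr_ge0// sqr_ge0.
  have h4 : r * qform g v <= r * (qform g0 v + (1 - r) * qform g0 v).
    by apply: ler_wpM2l; [exact: ltW|lra].
  by rewrite (le_trans h4)//; nra.
by rewrite ler_pdivlMl//; lra.
Qed.

End metric_comparison.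

Section continuous_bigop.
Context {R : realType} {T : topologicalType} {I : Type}.
Implicit Types (F : I -> T -> R) (r : seq I) (y : T).

Lemma continuous_sum_seq F r y : (forall i, {for y, continuous (F i)}) ->
  {for y, continuous (fun z => \sum_(i <- r) F i z)}.
Proof.
move=> cF; elim: r => [|i r IH].
  rewrite (_ : (fun z => _) = cst 0); first exact: cst_continuous.
  by apply/funext => z; rewrite big_nil.
rewrite (_ : (fun z => _) = F i \+ (fun z => \sum_(j <- r) F j z)).
  exact: continuousD.
by apply/funext => z; rewrite big_cons.
Qed.

Lemma continuous_prod_seq F r y : (forall i, {for y, continuous (F i)}) ->
  {for y, continuous (fun z => \prod_(i <- r) F i z)}.
Proof.
move=> cF; elim: r => [|i r IH].
  rewrite (_ : (fun z => _) = cst 1); first exact: cst_continuous.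
  by apply/funext => z; rewrite big_nil.
rewrite (_ : (fun z => _) = F i \* (fun z => \prod_(j <- r) F j z)).
  exact: continuousM.
by apply/funext => z; rewrite big_cons.
Qed.

End continuous_bigop.

Section chart_geometry.
Context {R : realType} {n : nat} {M : ptopologicalType}.
Context {S : smooth_structure R n M} (g : riemannian_metric S).
Implicit Types (c : chart R n M).

Definition gram_at c (y : 'rV[R]_n) := g c (chart_inv c y).

Lemma gram_at_continuous c y i j : atlas S c -> chart_img c y ->
  {for y, continuous (fun z => gram_at c z i j)}.
Proof. by move=> ac cy; have [+ _] := gram_smooth g ac i j 0%N; exact. Qed.

Lemma gram_at_posdef c y : atlas S c -> chart_img c y -> posdef (gram_at c y).
Proof.
move=> ac [p dp <-]; have [_ _ ck _ _] := atlas_is_chart ac.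
by rewrite /gram_at ck//; exact: gram_posdef.
Qed.

Lemma det_gram_continuous c y : atlas S c -> chart_img c y ->
  {for y, continuous (fun z => \det (gram_at c z))}.
Proof.
move=> ac cy; apply: continuous_sum_seq => s; apply: continuousM; first exact: cst_continuous.
by apply: continuous_prod_seq => i; exact: gram_at_continuous.
Qed.

(** [k] compares lengths of vectors with those at the centre, and [kappa]
    compares the Riemannian measure with Lebesgue measure. *)
Definition good_box c (y0 : 'rV[R]_n) (k rho kappa : R) :=
  [/\ 0 < rho, 0 < kappa & forall y, `|y - y0| <= rho ->
    [/\ chart_img c y, kappa <= Num.sqrt (\det (gram_at c y)) &
      forall v, qnorm (gram_at c y) v <= k * qnorm (gram_at c y0) v /\
                qnorm (gram_at c y0) v <= k * qnorm (gram_at c y) v]].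

Lemma exists_good_box c y0 k : atlas S c -> chart_img c y0 -> 1 < k ->
  exists rho kappa, good_box c y0 k rho kappa.
Proof.
move=> ac cy0 k1; have [_ oi _ _ _] := atlas_is_chart ac.
have pg := gram_at_posdef ac cy0.
have [eta eta0 He] := qnorm_perturb pg k1.
pose d0 := \det (gram_at c y0).
have d00 : 0 < d0 by exact: posdef_det_gt0.
have Hg : \forall y \near y0, forall ij : 'I_n * 'I_n,
    `|gram_at c y0 ij.1 ij.2 - gram_at c y ij.1 ij.2| <= eta.
  apply: (@filter_forall _ ('I_n * 'I_n)%type (fun ij y =>
    `|gram_at c y0 ij.1 ij.2 - gram_at c y ij.1 ij.2| <= eta) (nbhs y0)) => ij.
  by move/cvgrPdist_le : (gram_at_continuous (i := ij.1) (j := ij.2) ac cy0); exact.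
have H : \forall y \near y0, [/\ chart_img c y, d0 / 2 <= \det (gram_at c y) &
    forall i j, `|gram_at c y i j - gram_at c y0 i j| <= eta].
  near=> y; split.
  - by near: y; exact: open_nbhs_nbhs.
  - have : `|d0 - \det (gram_at c y)| <= d0 / 2.
      near: y; move/cvgrPdist_le : (det_gram_continuous ac cy0); apply.
      by rewrite divr_gt0.
    by rewrite ler_norml => /andP[_]; lra.
  - move=> i j; rewrite distrC.
    have : forall ij : 'I_n * 'I_n, `|gram_at c y0 ij.1 ij.2 - gram_at c y ij.1 ij.2| <= eta.
      by near: y.
    by move/(_ (i, j)).
have [rho /= rho0 Hr] := (nbhs_ballP _ _).1 H.
exists (rho / 2), (Num.sqrt (d0 / 2)); split.
- by rewrite divr_gt0.
- by rewrite sqrtr_gt0 divr_gt0.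
- move=> y yr; have [] := Hr y _.
    rewrite -ball_normE/= distrC (le_lt_trans yr)// ltr_pdivrMr// ltr_pMr//.
    by rewrite ltr1n.
  by move=> h1 h2 h3; split => //; [exact: ler_wsqrtr|exact: He].
Unshelve. all: by end_near. Qed.

Lemma chart_image_preimage (c : chart R n M) (A : set M) : is_chart c ->
  c @` (chart_dom c `&` A) = chart_img c `&` chart_inv c @^-1` A.
Proof.
move=> [_ _ ck _ _]; apply/seteqP; split => y /=.
  by move=> [p [dp Ap] <-]; rewrite ck//; split => //; exists p.
by move=> [[p dp <-]]; rewrite ck// => Ap; exists p.
Qed.

Lemma preimage_chart_inv_open c (V : set M) : is_chart c -> open V ->
  open (chart_img c `&` chart_inv c @^-1` V).
Proof.
move=> ic oV.
by rewrite -chart_image_preimage//; exact: chart_open_image.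
Qed.

Lemma measurable_chart_inv c : is_chart c ->
  measurable_fun (chart_img c) (chart_inv c : 'rV[R]_n -> borel M).
Proof.
move=> ic; apply: (measurability _ (erefl : @measurable _ (borel M) = <<s open >>)).
move=> _ [V oV <-]; apply: measurable_open_rV; exact: preimage_chart_inv_open.
Qed.

Lemma measurable_continuous_rV (U : set 'rV[R]_n) (f : 'rV[R]_n -> R) :
  open U -> (forall y, U y -> {for y, continuous f}) -> measurable_fun U f.
Proof.
move=> oU cf; apply: (measurability _ (RGenOpens.measurableE R)).
move=> _ [_ [a [b ->]] <-]; apply: measurable_open_rV.
rewrite openE => y [Uy fy]; apply: filterI; first exact: open_nbhs_nbhs.
by apply: (cf y Uy); apply: open_nbhs_nbhs; split => //; exact: interval_open.
Qed.

End chart_geometry.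

(** * Measure and energy in charts, and free segments *)

Section measure_in_charts.
Context {R : realType} {n : nat} {M : ptopologicalType}.
Context {S : smooth_structure R n M} (g : riemannian_metric S).
Variable mu : {measure set (borel M) -> \bar R}.
Hypothesis mu_riemannian : riemannian_measure g mu.
Local Notation lam := (@lebesgue_rV R n).
Local Open Scope ereal_scope.

Lemma measurable_open_borel (V : set M) : open V -> measurable (V : set (borel M)).
Proof. exact: sub_sigma_algebra. Qed.

Lemma mu_chart (c : chart R n M) (A : set (borel M)) : atlas S c -> measurable A ->
  mu (chart_dom c `&` A) =
  \int[lam]_(y in chart_img c `&` chart_inv c @^-1` A)
    (Num.sqrt (\det (gram_at g c y)))%:E.
Proof.
move=> ac mA; have [oc _ _ _ _] := atlas_is_chart ac.
rewrite (mu_riemannian ac); last 2 first.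
- by apply: measurableI => //; exact: measurable_open_borel.
- by move=> p [].
by rewrite chart_image_preimage//; exact: (atlas_is_chart ac).
Qed.

Lemma measurable_img_preimage (c : chart R n M) (A : set (borel M)) : atlas S c ->
  measurable A -> measurable (chart_img c `&` chart_inv c @^-1` A).
Proof.
move=> ac mA; have [_ oi _ _ _] := atlas_is_chart ac.
apply: measurable_chart_inv => //; first exact: (atlas_is_chart ac).
exact: measurable_open_rV.
Qed.

Lemma measurable_sqrt_det (c : chart R n M) : atlas S c ->
  measurable_fun (chart_img c) (fun y => (Num.sqrt (\det (gram_at g c y)))%:E).
Proof.
move=> ac; have [_ oi _ _ _] := atlas_is_chart ac.
apply/measurable_EFinP; apply: measurable_continuous_rV => // y cy.
apply: (@continuous_comp _ _ _ (fun z => \det (gram_at g c z)) Num.sqrt).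
  exact: det_gram_continuous.
exact: sqrt_continuous.
Qed.

Lemma mu_dominates (c : chart R n M) y0 k rho kappa (A : set (borel M)) :
  atlas S c -> good_box g c y0 k rho kappa -> measurable A ->
  kappa%:E * lam (box y0 rho `&` chart_inv c @^-1` A) <= mu A.
Proof.
move=> ac [rho0 kappa0 Hb] mA.
have BI : box y0 rho `<=` chart_img c.
  by rewrite boxE ?(ltW rho0)// => y /Hb[].
have mIA := measurable_img_preimage ac mA.
have mBA : measurable (box y0 rho `&` chart_inv c @^-1` A).
  rewrite (_ : _ `&` _ = box y0 rho `&` (chart_img c `&` chart_inv c @^-1` A)).
    by apply: measurableI => //; exact: measurable_box.
  by rewrite setIA (setIidl BI).
have [oc _ _ _ _] := atlas_is_chart ac.
apply: (@le_trans _ _ (mu (chart_dom c `&` A))); last first.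
  apply: le_measure; last by move=> p [].
    by rewrite inE; apply: measurableI => //; exact: measurable_open_borel.
  by rewrite inE.
rewrite mu_chart// -integral_cst//.
have sB : box y0 rho `&` chart_inv c @^-1` A `<=` chart_img c `&` chart_inv c @^-1` A.
  by move=> y [/BI].
apply: (@le_trans _ _ (\int[lam]_(y in box y0 rho `&` chart_inv c @^-1` A)
    (Num.sqrt (\det (gram_at g c y)))%:E)).
  apply: ge0_le_integral => //.
  - by move=> y _; rewrite lee_fin ltW.
  - by apply: measurable_funS (measurable_sqrt_det ac) => //;
      [exact: measurable_open_rV (let: And5 _ oi _ _ _ := atlas_is_chart ac in oi)|move=> y [/BI]].
  - by move=> y [+ _]; rewrite boxE ?(ltW rho0)// => /Hb[_ + _]; rewrite lee_fin.
apply: ge0_subset_integral => //.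
apply: measurable_funS (measurable_sqrt_det ac) => //.
exact: measurable_open_rV (let: And5 _ oi _ _ _ := atlas_is_chart ac in oi).
Qed.

(** [mu_dominates], with functions in place of sets. *)
Lemma integral_chart_le (c : chart R n M) y0 k rho kappa (F : M -> \bar R) :
  atlas S c -> good_box g c y0 k rho kappa ->
  measurable_fun [set: borel M] (F : borel M -> \bar R) -> (forall p, 0 <= F p) ->
  kappa%:E * \int[lam]_(y in box y0 rho) F (chart_inv c y) <=
  \int[mu]_p F p.
Proof.
move=> ac gb mF F0; have [rho0 kappa0 Hb] := gb.
have BI : box y0 rho `<=` chart_img c.
  by rewrite boxE ?(ltW rho0)// => y /Hb[].
have mB : measurable (box y0 rho) by exact: measurable_box.
have [_ oi _ _ _] := atlas_is_chart ac.
(* Outside the box, [chart_inv] is replaced by a constant, which makes it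
   measurable on the whole space. *)
pose inv (y : 'rV[R]_n) : borel M := if y \in box y0 rho then chart_inv c y else point.
have invE y : box y0 rho y -> inv y = chart_inv c y by move=> By; rewrite /inv mem_set.
have minv : measurable_fun setT inv.
  apply: measurable_fun_if => //.
  - apply: (measurable_fun_bool true); rewrite setTI.
    rewrite (_ : _ @^-1` _ = box y0 rho)//.
    by apply/seteqP; split => y /=; [move/set_mem|move/mem_set].
  - apply: measurable_funS (measurable_chart_inv (atlas_is_chart ac)).
      exact: measurable_open_rV.
    by move=> y [_ /= /set_mem /BI].
have k0 : (0 <= kappa)%R by exact: ltW.
pose m := mscale (NngNum k0) (mrestr lam mB).
have mFi : measurable_fun setT (F \o inv) by exact: measurableT_comp mF minv.
have -> : kappa%:E * \int[lam]_(y in box y0 rho) F (chart_inv c y) =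
    \int[m]_(y in box y0 rho) F (inv y).
  rewrite ge0_integral_mscale//; last exact: measurable_funTS.
  congr (_ * _); transitivity (\int[lam]_(y in box y0 rho) F (inv y)).
    by apply: eq_integral => y /set_mem By; rewrite invE.
  apply: eq_measure_integral => A mA AB.
  by rewrite -[RHS]/(lam (A `&` box y0 rho)) setIidl.
apply: (@le_trans _ _ (\int[m]_y F (inv y))).
  by apply: ge0_subset_integral => //.
rewrite -[leLHS]/(\int[m]_(y in inv @^-1` setT) (F \o inv) y).
rewrite -ge0_integral_pushforward//.
apply: ge0_le_measure_integral => // A mA.
rewrite -[leLHS]/(kappa%:E * lam (inv @^-1` A `&` box y0 rho)).
rewrite (_ : inv @^-1` A `&` box y0 rho = box y0 rho `&` chart_inv c @^-1` A).
  exact: mu_dominates gb mA.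
apply/seteqP; split => y [/= h1 h2]; split => //=; first by rewrite -invE.
by rewrite invE.
Qed.

Hypothesis M_sigma_compact : sigma_compact M.

(** By sigma-compactness countably many charts cover [M]. *)
Lemma mu_null_charts (A : set (borel M)) : measurable A ->
  (forall c, atlas S c -> mu (chart_dom c `&` A) = 0) -> mu A = 0.
Proof.
move=> mA A0; have [K [cK KT]] := M_sigma_compact.
have /choice[D DK] : forall k, exists D : seq M,
    K k `<=` [set p | exists2 q, q \in D & chart_dom (chart_at S q) p].
  move=> k; have := cK k; rewrite compact_cover.
  move=> /(_ M setT (fun q => chart_dom (chart_at S q))) [].
  - by move=> q _; have [] := atlas_is_chart (chart_at_atlas S q).
  - by move=> p _; exists p => //; exact: chart_at_dom.
  - move=> D _ KD; exists (finmap.enum_fset D) => p /KD[q /= qD dq].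
    by exists q.
apply/negligibleP => //.
have sA : A `<=` \bigcup_k [set p | exists2 q, q \in D k & (chart_dom (chart_at S q) `&` A) p].
  move=> p Ap; have [k _ Kp] : (\bigcup_k K k) p by rewrite KT.
  by have [q qD dq] := DK k p Kp; exists k => //; exists q.
apply: negligibleS sA _; apply: negligible_bigcup => k.
elim: (D k) => [|q s IH].
  by apply: negligibleS (negligible_set0 _) => p [].
have : mu.-negligible ((chart_dom (chart_at S q) `&` A) : set (borel M)).
  have [od _ _ _ _] := atlas_is_chart (chart_at_atlas S q).
  apply/negligibleP; first by apply: measurableI => //; exact: measurable_open_borel.
  by apply: A0; exact: chart_at_atlas.
move=> h; apply: negligibleS (negligibleU h IH) => p [r].
by rewrite in_cons => /predU1P[->|rs] hr; [left|right; exists r].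
Qed.

(** The function [w] is only constrained almost everywhere in each chart. *)
Lemma grad_sq_ge0 phi w : is_grad_sq g phi w -> mu [set p : borel M | (w p < 0)%R] = 0.
Proof.
move=> [mw Hw].
have mN : measurable [set p : borel M | (w p < 0)%R].
  rewrite -[X in measurable X]setTI (_ : [set p | _] = w @^-1` `]-oo, 0%R[).
    by apply: mw => //; exact: measurable_itv.
  by apply/seteqP; split => p /=; rewrite in_itv.
apply: mu_null_charts => // c ac; rewrite mu_chart//.
have mI := measurable_img_preimage ac mN.
apply: null_set_integral => //.
  by apply: measurable_funS (measurable_sqrt_det ac) => //;
    exact: measurable_open_rV (let: And5 _ oi _ _ _ := atlas_is_chart ac in oi).
have [D _ HD] := Hw c ac.
apply/negligibleP => //; apply: negligibleS HD => y [cy /= wy].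
move=> /= /(_ cy) wE; move: wy; rewrite /preimage/= wE ltNge.
by rewrite inv_form_ge0//; exact: (gram_at_posdef g ac cy).
Qed.

Lemma energy_bounds phi w e : H1_norm_sq g mu phi w e ->
  \int[mu]_p ((phi p) ^+ 2)%:E <= e /\ \int[mu]_p (Num.max (w p) 0)%:E <= e.
Proof.
move=> [_ gw -> _]; have [mw _] := gw.
have -> : \int[mu]_p (w p)%:E = \int[mu]_p (Num.max (w p) 0)%:E.
  apply: ae_eq_integral => //.
  - by apply/measurable_EFinP.
  - by apply/measurable_EFinP; exact: measurable_maxr.
  - exists [set p : borel M | (w p < 0)%R]; split.
    + rewrite -[X in measurable X]setTI (_ : [set p | _] = w @^-1` `]-oo, 0%R[).
        by apply: mw => //; exact: measurable_itv.
      by apply/seteqP; split => p /=; rewrite in_itv.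
    + exact: grad_sq_ge0 gw.
    + move=> p /= /not_implyP[_]; rewrite ltNge => wE; apply/negP => w0; apply: wE.
      by rewrite max_l.
by split; [apply: leeDl|apply: leeDr]; apply: integral_ge0 => p _;
  rewrite lee_fin ?sqr_ge0// le_max lexx orbT.
Qed.

End measure_in_charts.

Lemma small_energy (R : realType) n (M : ptopologicalType)
    (S : smooth_structure R n M) (g : riemannian_metric S)
    (mu : {measure set (borel M) -> \bar R}) (A : set M) e0 :
  capacity g mu A = 0%E -> 0 < e0 -> exists phi w e,
  [/\ H1_norm_sq g mu phi w e, (e < e0%:E)%E & exists U : set M,
    [/\ open U, A `<=` U & {ae mu, forall p, U p -> 1 <= phi p}]].
Proof.
move=> cap0 e00; have : (capacity g mu A < e0%:E)%E by rewrite cap0 lte_fin.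
by move=> /ereal_inf_lt[e [phi [w [H U]]] ee]; exists phi, w, e.
Qed.

Section free_segments.
Context {R : realType} {n : nat} {M : ptopologicalType}.
Context {S : smooth_structure R n.+1 M} (g : riemannian_metric S).
Variable mu : {measure set (borel M) -> \bar R}.
Hypothesis mu_riemannian : riemannian_measure g mu.
Hypothesis M_sigma_compact : sigma_compact M.
Variable N : set M.
Hypothesis cap0 : capacity g mu (~` N) = 0%E.
Local Notation lam := (@lebesgue_rV R n.+1).

(** Energy controls squares, and the tube estimate involves first powers: [|x|
    <= eta + x^2 / eta] relates them, with a constant [eta] fixed before the
    energy is chosen. *)
Lemma small_energy_tube (c : chart R n.+1 M) (y0 w : 'rV[R]_n.+1) (k rho kappa Cb a : R) :
  atlas S c -> good_box g c y0 k rho kappa -> 0 < k -> 0 <= Cb -> 0 < a ->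
  exists2 e0, 0 < e0 & forall phi ws e D, H1_norm_sq g mu phi ws e -> (e < e0%:E)%E ->
  weak_gradient (chart_img c) (phi \o chart_inv c) D ->
  {ae lam, forall y, chart_img c y ->
      ws (chart_inv c y) = \sum_(i < n.+1) \sum_(j < n.+1)
        invmx (g c (chart_inv c y)) i j * D i y * D j y} ->
  (\int[lam]_(z in box y0 rho) (Cb * `|phi (chart_inv c z)| +
     `|\sum_(i < n.+1) w ord0 i * D i z|)%:E < a%:E)%E.
Proof.
move=> ac gb k0 Cb0 a0; have [rho0 kappa0 Hb] := gb.
set B := box y0 rho.
have mB : measurable B by exact: measurable_box.
have BI : B `<=` chart_img c by rewrite /B boxE ?(ltW rho0)// => y /Hb[].
pose L := (2 * rho) ^+ n.+1.
have LE : lam B = L%:E by rewrite /B lebesgue_rV_box// ltW.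
have L0 : 0 <= L by rewrite exprn_ge0// mulr_ge0// ltW.
have [_ oi _ _ _] := atlas_is_chart ac.
have y0y0 : `|y0 - y0| <= rho by rewrite subrr normr0 ltW.
have [cy0 _ _] := Hb y0 y0y0.
pose q0 := qform (gram_at g c y0) w.
have q00 : 0 <= q0 by apply: qform_ge0; exact: gram_at_posdef.
(* With this [eta] the constant terms contribute at most [a / 4], and with the
   bound on [e] below so do the quadratic terms. *)
pose eta := a / (4 * (Cb + 1) * (L + 1)).
have eta0 : 0 < eta by rewrite divr_gt0// !mulr_gt0// ltr_wpDl.
pose Q := (Cb + k ^+ 2 * q0) / eta / kappa.
have Q0' : 0 <= Cb + k ^+ 2 * q0 by rewrite addr_ge0// mulr_ge0// sqr_ge0.
have Q0 : 0 <= Q by exact: divr_ge0 (divr_ge0 Q0' (ltW eta0)) (ltW kappa0).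
exists (a / (4 * (Q + 1))); first by rewrite divr_gt0// mulr_gt0// ltr_wpDl.
move=> phi ws e D H ee fD wsD.
have [phie wse] := energy_bounds mu_riemannian M_sigma_compact H.
have [[[mphi _] _] [mws _] _ _] := H.
pose wp p := Num.max (ws p) 0.
have wp0 p : 0 <= wp p by rewrite le_max lexx orbT.
have mwp : measurable_fun [set: borel M] (wp : borel M -> R) by exact: measurable_maxr.
have mI : measurable (chart_img c) by exact: measurable_open_rV.
have minv : measurable_fun B (chart_inv c : _ -> borel M).
  by apply: measurable_funS (measurable_chart_inv (atlas_is_chart ac)).
have mDw : measurable_fun B (fun z => \sum_(i < n.+1) w ord0 i * D i z).
  apply: measurable_sum => i; apply: measurable_funM => //.
  by have [[mD _] _] := fD i; exact: measurable_funS mD.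
have mphiB : measurable_fun B (fun z => phi (chart_inv c z)).
  exact: (measurable_comp measurableT _ mphi minv).
have mwpB : measurable_fun B (fun z => wp (chart_inv c z)).
  exact: (measurable_comp measurableT _ mwp minv).
have e0 : (0 <= e)%E.
  by apply: le_trans phie; apply: integral_ge0 => p _; rewrite lee_fin sqr_ge0.
have efin : e \is a fin_num by rewrite ge0_fin_numE// (lt_trans ee)// ltry.
have phiB : (\int[lam]_(z in B) ((phi (chart_inv c z)) ^+ 2)%:E <= (kappa^-1)%:E * e)%E.
  rewrite lee_pdivlMl// (le_trans _ phie)//.
  apply: (@integral_chart_le R n.+1 M S g mu mu_riemannian c y0 k rho kappa
    (fun p => (phi p ^+ 2)%:E)) => //.
    by apply/measurable_EFinP; exact: measurable_funX.
  by move=> p; rewrite lee_fin sqr_ge0.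
have wpB : (\int[lam]_(z in B) (wp (chart_inv c z))%:E <= (kappa^-1)%:E * e)%E.
  rewrite lee_pdivlMl// (le_trans _ wse)//.
  apply: (@integral_chart_le R n.+1 M S g mu mu_riemannian c y0 k rho kappa
    (fun p => (wp p)%:E)) => //.
  by apply/measurable_EFinP.
have young (x : R) : `|x| <= eta + x ^+ 2 / eta.
  have -> : eta + x ^+ 2 / eta = (eta ^+ 2 + `|x| ^+ 2) / eta.
    by rewrite real_normK ?num_real// mulrDl expr2 mulfK// gt_eqF.
  rewrite ler_pdivlMr//; have := sqr_ge0 (eta - `|x|); have := normr_ge0 x; nra.
pose A2 := Cb / eta; pose A3 := k ^+ 2 * q0 / eta; pose A1 := (Cb + 1) * eta.
have A10 : 0 <= A1 by rewrite mulr_ge0 ?(ltW eta0)// addr_ge0.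
have A20 : 0 <= A2 by rewrite divr_ge0// ltW.
have A30 : 0 <= A3 by rewrite divr_ge0 ?(ltW eta0)// mulr_ge0// sqr_ge0.
apply: (@le_lt_trans _ _ (\int[lam]_(z in B) (A1%:E +
    (A2%:E * (phi (chart_inv c z) ^+ 2)%:E + A3%:E * (wp (chart_inv c z))%:E)))%E).
  apply: ae_ge0_le_integral => //.
  - by move=> z _; rewrite lee_fin addr_ge0// mulr_ge0.
  - apply/measurable_EFinP; apply: measurable_funD; last exact: measurableT_comp.
    by apply: measurable_funM => //; exact: measurableT_comp.
  - by move=> z _; rewrite -!EFinM -!EFinD lee_fin !addr_ge0// mulr_ge0// sqr_ge0.
  - under eq_fun do rewrite -!EFinM -!EFinD.
    apply/measurable_EFinP; apply: measurable_funD => //; apply: measurable_funD.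
      by apply: measurable_funM => //; exact: measurable_funX.
    exact: measurable_funM.
  - apply: filterS wsD => z Hz Bz; rewrite -!EFinM -!EFinD lee_fin.
    have cz : chart_img c z by exact: BI.
    have h1 := young (phi (chart_inv c z)).
    have h2 := young (\sum_(i < n.+1) w ord0 i * D i z).
    have h3 := gradient_le w (D ^~ z) (gram_at_posdef g ac cz).
    rewrite /gram_at -(Hz cz) in h3.
    have h4 : qform (gram_at g c z) w <= k ^+ 2 * q0.
      have Bz' : `|z - y0| <= rho by move: Bz; rewrite /B boxE ?(ltW rho0).
      have [_ _ /(_ w)[h _]] := Hb z Bz'.
      have : qnorm (gram_at g c z) w ^+ 2 <= (k * qnorm (gram_at g c y0) w) ^+ 2.
        by rewrite ler_pXn2r// nnegrE ?mulr_ge0 ?sqrtr_ge0// ltW.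
      rewrite exprMn !sqr_sqrtr//; apply: qform_ge0; exact: gram_at_posdef.
    have h5 : (\sum_(i < n.+1) w ord0 i * D i z) ^+ 2 <= k ^+ 2 * q0 * wp (chart_inv c z).
      have q1 : 0 <= qform (gram_at g c z) w by apply: qform_ge0; exact: gram_at_posdef.
      rewrite (le_trans h3)//; apply: (@le_trans _ _ (qform (gram_at g c z) w * wp (chart_inv c z))).
        by rewrite ler_wpM2l// /wp le_max lexx.
      by rewrite ler_wpM2r.
    have h6 : Cb * `|phi (chart_inv c z)| <= Cb * eta + A2 * phi (chart_inv c z) ^+ 2.
      rewrite (_ : _ + _ = Cb * (eta + phi (chart_inv c z) ^+ 2 / eta)).
        by rewrite ler_wpM2l.
      by rewrite /A2; ring.
    have h7 : `|\sum_(i < n.+1) w ord0 i * D i z| <= eta + A3 * wp (chart_inv c z).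
      have -> : A3 * wp (chart_inv c z) = k ^+ 2 * q0 * wp (chart_inv c z) / eta.
        by rewrite /A3 mulrAC.
      by rewrite (le_trans h2)// lerD2l ler_wpM2r// invr_ge0 ltW.
    rewrite (le_trans (lerD h6 h7))// /A1; lra.
have mA2 : measurable_fun B (fun z => A2%:E * (phi (chart_inv c z) ^+ 2)%:E)%E.
  apply/measurable_EFinP; apply: measurable_funM => //; exact: measurable_funX.
have mA3 : measurable_fun B (fun z => A3%:E * (wp (chart_inv c z))%:E)%E.
  by apply/measurable_EFinP; apply: measurable_funM.
rewrite ge0_integralD//; last 2 first.
- by move=> z _; rewrite -!EFinM -!EFinD lee_fin !addr_ge0// mulr_ge0// sqr_ge0.
- exact: emeasurable_funD.
rewrite integral_cst// [X in (_ * X)%E]LE.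
rewrite ge0_integralD//; last 2 first.
- by move=> z _; rewrite -!EFinM lee_fin mulr_ge0// sqr_ge0.
- by move=> z _; rewrite -!EFinM lee_fin mulr_ge0.
have Zl := @ge0_integralZl_EFin _ _ _ lam B mB.
rewrite (Zl (fun z => (phi (chart_inv c z) ^+ 2)%:E)) ?(Zl (fun z => (wp (chart_inv c z))%:E))//; last 4 first.
- by move=> z _; rewrite lee_fin.
- exact/measurable_EFinP.
- by move=> z _; rewrite lee_fin sqr_ge0.
- by apply/measurable_EFinP; exact: measurable_funX.
apply: (@le_lt_trans _ _ ((A1 * L)%:E + (A2%:E * ((kappa^-1)%:E * e) + A3%:E * ((kappa^-1)%:E * e)))%E).
  rewrite leeD2l//; apply: leeD; exact: lee_wpmul2l.
move: ee e0; rewrite -(fineK efin); set er := fine e => ee e0.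
rewrite -!EFinM -!EFinD lte_fin; rewrite lte_fin in ee; rewrite lee_fin in e0.
have -> : A2 * (kappa^-1 * er) + A3 * (kappa^-1 * er) = Q * er.
  by rewrite /Q /A2 /A3; ring.
have b1 : A1 * L <= a / 4.
  have -> : A1 * L = a / 4 * (L / (L + 1)).
    by rewrite /A1 /eta; field; rewrite !gt_eqF// ltr_wpDl.
  by rewrite ler_piMr ?divr_ge0 ?(ltW a0)// ler_pdivrMr ?ltr_wpDl// mul1r lerDl.
have b2 : Q * er <= a / 4.
  apply: (@le_trans _ _ ((Q + 1) * (a / (4 * (Q + 1))))).
    by rewrite ler_pM ?(ltW ee)// lerDl.
  have -> : (Q + 1) * (a / (4 * (Q + 1))) = a / 4 by field; rewrite gt_eqF// ltr_wpDl.
  by [].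
rewrite (le_lt_trans (lerD b1 b2))//; lra.
Qed.

(** If every segment met the complement of [N], the transport estimate would
    bound [r ^+ n] by an arbitrarily small energy. *)
Lemma exists_free_segment (c : chart R n.+1 M) (y0 : 'rV[R]_n.+1)
    (w' u0 : 'rV[R]_n) (k rho kappa r T0 T1 : R) :
  atlas S c -> good_box g c y0 k rho kappa -> 0 < k -> 0 < r -> T0 < T1 ->
  (forall z : 'rV[R]_n.+1, T0 < z ord0 ord0 < T1 -> `|shear w' z - u0| < r -> `|z - y0| < rho) ->
  exists2 u, `|u - u0| <= r / 2 &
    forall t, T0 < t < T1 -> N (chart_inv c (cons_rV (t, u + t *: w'))).
Proof.
move=> ac gb k0 r0 T01 tubeB; apply: contrapT => noseg.
have hit u : `|u - u0| <= r / 2 -> exists2 t, T0 < t < T1 &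
    ~ N (chart_inv c (cons_rV (t, u + t *: w'))).
  move=> ur; apply: contrapT => nohit; apply: noseg; exists u => // t tT.
  by apply: contrapT => nN; apply: nohit; exists t.
have [rho0 kappa0 Hb] := gb.
have [b0 [sb0 b001 [b0l b0r] b0'0 b0'supp]] := smooth_step T01.
have [_ sb0'] := smooth1_derive sb0.
have [Cb Cb0 b0'C] : exists2 Cb, 0 <= Cb & forall x, derive1 b0 x <= Cb.
  have [x _ xmax] := @EVT_max R (derive1 b0) T0 T1 (ltW T01)
    (continuous_subspaceT (smooth1_continuous sb0')).
  exists (derive1 b0 x) => // y; have [->//|/b0'supp/andP[h1 h2]] := eqVneq (derive1 b0 y) 0.
  by apply: xmax; rewrite in_itv/= !ltW.
have a0 : 0 < r ^+ n by rewrite exprn_gt0.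
have [e0 e00 He] := small_energy_tube (cons_rV (1, w')) ac gb k0 Cb0 a0.
have [phi [w [e [H ee [U [oU NU phi1]]]]]] := small_energy cap0 e00.
have [[_ /(_ c ac) [f2 _]] [_ /(_ c ac) [D fD wD]] _ _] := H.
have := He phi w e D H ee fD wD; rewrite ltNge => /negP; apply.
have [odc oi ck _ _] := atlas_is_chart ac.
have BI : box y0 rho `<=` chart_img c by rewrite boxE ?(ltW rho0)// => y /Hb[].
pose V := [set z : 'rV[R]_n.+1 | `|z - y0| < rho] `&` (c @` (chart_dom c `&` U)).
apply: (@tube_estimate R n (chart_img c) V (phi \o chart_inv c) D w' u0 r T0 T1
  y0 rho b0 Cb) => //.
- by move=> z zT zr; rewrite boxE ?(ltW rho0)//=; exact/ltW/tubeB.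
- by move=> x; rewrite b0'0 b0'C.
- apply: openI; last exact: chart_open_image (atlas_is_chart ac) oU.
  rewrite (_ : [set z | _] = ball y0 rho); first exact: ball_open.
  by apply/seteqP; split => z; rewrite -ball_normE/= distrC.
- have [A [mA A0 sA]] := phi1.
  exists (box y0 rho `&` chart_inv c @^-1` A); split.
  + rewrite (_ : _ `&` _ = box y0 rho `&` (chart_img c `&` chart_inv c @^-1` A)).
      apply: measurableI; first exact: measurable_box.
      exact: measurable_img_preimage ac mA.
    by rewrite setIA (setIidl BI).
  + have := mu_dominates mu_riemannian ac gb mA; rewrite A0.
    rewrite pmule_rle0 ?lte_fin// => h.
    by apply/eqP; rewrite eq_le h measure_ge0.
  + move=> z /= /not_implyP[[zr [p [dp Up] pz]] /not_implyP[_ nphi]].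
    split; first by rewrite boxE ?(ltW rho0)//=; exact: ltW.
    apply: sA => /= h; apply: nphi; apply: h.
    by rewrite -pz ck.
- move=> u ur; have [t tT nN] := hit u ur; exists t => //.
  set z := cons_rV _ in nN *.
  have zr : `|z - y0| < rho.
    apply: tubeB; first by rewrite /z cons_rV0.
    rewrite /z shear_cons addrK (le_lt_trans ur)// ltr_pdivrMr// ltr_pMr//.
    by rewrite ltr1n.
  split => //; have [p dp pz] : chart_img c z by have [] := Hb z (ltW zr).
  exists p => //; split => //; apply: NU; rewrite -pz ck// in nN.
Qed.

End free_segments.

(** * Density, and free segments near a given one *)

Section density.
Context {R : realType} {n : nat} {M : ptopologicalType}.
Context {S : smooth_structure R n M} (g : riemannian_metric S).
Variable mu : {measure set (borel M) -> \bar R}.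
Hypothesis mu_riemannian : riemannian_measure g mu.
Hypothesis M_sigma_compact : sigma_compact M.

Lemma open_measure_gt0 (W : set M) p : open W -> W p ->
  exists2 m : R, 0 < m & (m%:E <= mu (W : set (borel M)))%E.
Proof.
move=> oW Wp; pose c := chart_at S p.
have ac : atlas S c by exact: chart_at_atlas.
have dp : chart_dom c p by exact: chart_at_dom.
have cp : chart_img c (c p) by exists p.
have [rho [kappa gb]] := exists_good_box g ac cp (ltr1n R 2).
have [rho0 kappa0 Hb] := gb.
have oV := preimage_chart_inv_open (atlas_is_chart ac) oW.
have Vcp : (chart_img c `&` chart_inv c @^-1` W) (c p).
  split => //; rewrite /preimage/=.
  by have [_ _ -> //] := atlas_is_chart ac.
have /nbhs_ballP[e /= e0 eV] := open_nbhs_nbhs (conj oV Vcp).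
pose r := Num.min rho (e / 2).
have r20 : 0 < r by rewrite lt_min rho0 divr_gt0.
have h1 : r <= rho by rewrite ge_min lexx.
have h2 y : `|y - c p| <= r -> chart_img c y /\ W (chart_inv c y).
  move=> yr; apply: eV; rewrite -ball_normE/= distrC (le_lt_trans yr)//.
  by rewrite gt_min orbC ltr_pdivrMr// ltr_pMr// ltr1n.
exists (kappa * (2 * r) ^+ n).
  by rewrite mulr_gt0// exprn_gt0// mulr_gt0.
apply: le_trans (mu_dominates mu_riemannian ac gb (measurable_open_borel oW)).
rewrite EFinM lee_pmul2l ?lte_fin// -(@lebesgue_rV_box R n (c p) r (ltW r20)).
apply: le_measure.
- by rewrite inE; exact: measurable_box.
- rewrite inE (_ : _ `&` _ = box (c p) rho `&` (chart_img c `&` chart_inv c @^-1` W)).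
    by apply: measurableI; [exact: measurable_box|exact: measurable_open_rV].
  rewrite setIA; congr (_ `&` _); apply/esym/setIidl.
  by rewrite boxE ?(ltW rho0)// => y /Hb[].
- rewrite !boxE ?(ltW rho0) ?(ltW r20)// => y /= yr; split => /=.
    exact: le_trans yr h1.
  by have [] := h2 y yr.
Qed.

(** On an open set inside the complement of [N] the function [phi] would be at
    least 1, and its energy at least the measure of this set. *)
Lemma capacity0_dense (N W : set M) p : capacity g mu (~` N) = 0%E ->
  open W -> W p -> exists2 q, W q & N q.
Proof.
move=> cap0 oW Wp; apply: contrapT => WN.
have [m m0 mW] := open_measure_gt0 oW Wp.
have [phi [w [e [H em [U [oU NU phi1]]]]]] := small_energy cap0 m0.
have [phie _] := energy_bounds mu_riemannian M_sigma_compact H.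
have [[[mphi _] _] _ _ _] := H.
have mWb := measurable_open_borel oW.
suff : (m%:E <= e)%E by rewrite leNgt em.
apply: le_trans mW (le_trans _ phie).
have mphi2 : measurable_fun [set: borel M] (fun p : borel M => (phi p ^+ 2)%:E).
  by apply/measurable_EFinP; exact: measurable_funX.
apply: (@le_trans _ _ (\int[mu]_(p in W) (phi p ^+ 2)%:E)%E); last first.
  by apply: ge0_subset_integral => //= x _; rewrite lee_fin sqr_ge0.
rewrite -[leLHS]mul1e -integral_cst//.
apply: ae_ge0_le_integral => //.
- by move=> x _; rewrite lee_fin sqr_ge0.
- exact: measurable_funTS.
- have [A [mA A0 sA]] := phi1; exists A; split => // x /= /not_implyP[Wx nx].
  apply: sA => /= h; apply: nx.
  have : 1 <= phi x by apply/h/NU => Nx; apply: WN; exists x.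
  by move=> phix; rewrite lee_fin expr_ge1// (le_trans ler01 phix).
Qed.

End density.

Section free_segment_near.
Context {R : realType}.

Lemma cons_rV_axis n (x : 'rV[R]_n.+1) (w' v : 'rV[R]_n) t :
  cons_rV (t, shear w' x + v + t *: w') =
  x + (t - x ord0 ord0) *: cons_rV (1, w') + cons_rV (0, v).
Proof.
apply/rowP => i; case: (unliftP ord0 i) => [j ->|->].
  by rewrite !rV_coordE !cons_rVS /= /shear !rV_coordE !mxE; ring.
by rewrite !rV_coordE !cons_rV0 /=; ring.
Qed.

Lemma norm_cons_rV0 n (v : 'rV[R]_n) : `|cons_rV ((0 : R), v)| <= `|v|.
Proof.
apply: norm_le_coord => // i; case: (unliftP ord0 i) => [j ->|->].
  by rewrite cons_rVS; exact: coord_le_norm.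
by rewrite cons_rV0/= normr0.
Qed.

Lemma cons_rV_quotient n (x y : 'rV[R]_n.+1) : x ord0 ord0 < y ord0 ord0 ->
  exists w' : 'rV[R]_n,
    y = x + (y ord0 ord0 - x ord0 ord0) *: cons_rV (1, w').
Proof.
move=> xy; have d0 : y ord0 ord0 - x ord0 ord0 != 0 by rewrite subr_eq0 gt_eqF.
exists ((y ord0 ord0 - x ord0 ord0)^-1 *: (uncons_rV (y - x)).2).
apply/rowP => i; case: (unliftP ord0 i) => [j ->|->].
  by rewrite !rV_coordE cons_rVS /= rV_coordE mulVKf// !mxE; ring.
by rewrite !rV_coordE cons_rV0/=; ring.
Qed.


Section free_segment_near_manifold.
Context {n : nat} {M : ptopologicalType}.
Context {S : smooth_structure R n.+1 M} (g : riemannian_metric S).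
Variable mu : {measure set (borel M) -> \bar R}.
Hypothesis mu_riemannian : riemannian_measure g mu.
Hypothesis M_sigma_compact : sigma_compact M.
Variable N : set M.
Hypothesis cap0 : capacity g mu (~` N) = 0%E.
Variables (c : chart R n.+1 M) (y0 : 'rV[R]_n.+1) (k rho kappa : R).
Hypotheses (ac : atlas S c) (gb : good_box g c y0 k rho kappa) (k0 : 0 < k).

(** A thin tube around the segment is parametrized by the first coordinate; the
    free segment which it contains is shortened at both ends. *)
Let free_segment_lt (x y : 'rV[R]_n.+1) eta : x ord0 ord0 < y ord0 ord0 ->
  `|x - y0| < rho -> `|y - y0| < rho -> 0 < eta ->
  exists x' y', [/\ `|x' - x| < eta, `|y' - y| < eta &
    forall s, 0 <= s <= 1 -> N (chart_inv c (x' + s *: (y' - x')))].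
Proof.
move=> xy xr yr eta0; have [w' yE] := cons_rV_quotient xy.
set d := y ord0 ord0 - x ord0 ord0 in yE.
have d0 : 0 < d by rewrite subr_gt0.
set ew := cons_rV (1, w') in yE.
pose m := Num.max `|x - y0| `|y - y0|.
have mr : m < rho by rewrite /m gt_max xr yr.
pose r := Num.min (rho - m) eta.
have r0 : 0 < r by rewrite lt_min subr_gt0 mr eta0.
have seg s : 0 <= s <= 1 -> `|x + (s * d) *: ew - y0| <= m.
  move=> /andP[s0 s1].
  have -> : x + (s * d) *: ew - y0 = (1 - s) *: (x - y0) + s *: (y - y0).
    rewrite [in RHS]yE; apply/rowP => i.
    by rewrite !rV_coordE; ring.
  rewrite (le_trans (ler_normD _ _))// !normrZ ger0_norm ?subr_ge0// ger0_norm//.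
  rewrite (_ : m = (1 - s) * m + s * m); last by ring.
  by rewrite lerD// ler_wpM2l ?subr_ge0// /m le_max lexx ?orbT.
have [|u ur uN] := @exists_free_segment R n M S g mu mu_riemannian M_sigma_compact N
  cap0 c y0 w' (shear w' x) k rho kappa r (x ord0 ord0) (y ord0 ord0) ac gb k0 r0 xy.
  move=> z /andP[z0 z1] zr.
  have -> : z - y0 = (x + ((z ord0 ord0 - x ord0 ord0) / d * d) *: ew - y0) +
      cons_rV (0, shear w' z - shear w' x).
    rewrite mulfVK ?gt_eqF// -[in LHS](uncons_rVK z).
    rewrite addrAC -cons_rV_axis; congr (cons_rV (_, _) - _).
    by rewrite addrCA subrr addr0 subrK.
  rewrite (le_lt_trans (ler_normD _ _))//.
  have h1 := seg ((z ord0 ord0 - x ord0 ord0) / d).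
  have h2 := norm_cons_rV0 (shear w' z - shear w' x).
  have /h1 h3 : 0 <= (z ord0 ord0 - x ord0 ord0) / d <= 1.
    apply/andP; split; last by rewrite ler_pdivrMr// mul1r lerD2r ltW.
    by apply: divr_ge0 (ltW d0); rewrite subr_ge0 ltW.
  have h4 : r <= rho - m by rewrite ge_min lexx.
  by rewrite (le_lt_trans (lerD h3 h2))//; move: zr h4; lra.
pose l := 1 + `|ew|.
have l0 : 0 < l by rewrite ltr_wpDr.
pose s0 := Num.min (d / 4) (eta / (4 * l)).
have s00 : 0 < s0 by rewrite lt_min !divr_gt0// mulr_gt0.
have s0d : s0 <= d / 4 by rewrite ge_min lexx.
have s0e : s0 * `|ew| <= eta / 4.
  apply: (@le_trans _ _ (eta / (4 * l) * l)).
    by apply: ler_pM; rewrite ?(ltW s00)//; [rewrite ge_min lexx orbT|rewrite /l lerDr].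
  by rewrite invfM mulrA mulfVK ?gt_eqF.
pose pt t := cons_rV (t, u + t *: w').
have ptE t : pt t = x + (t - x ord0 ord0) *: ew + cons_rV (0, u - shear w' x).
  by rewrite -cons_rV_axis addrCA subrr addr0.
have ue : `|cons_rV (0, u - shear w' x)| <= eta / 2.
  apply: (le_trans (norm_cons_rV0 _)); apply: (le_trans ur).
  by rewrite ler_pM2r// ge_min lexx orbT.
exists (pt (x ord0 ord0 + s0)), (pt (y ord0 ord0 - s0)); split.
- rewrite ptE.
  have -> : x + (x ord0 ord0 + s0 - x ord0 ord0) *: ew + cons_rV (0, u - shear w' x) - x =
      s0 *: ew + cons_rV (0, u - shear w' x).
    by apply/rowP => i; rewrite !rV_coordE; ring.
  rewrite (le_lt_trans (ler_normD _ _))// normrZ gtr0_norm//.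
  by rewrite (le_lt_trans (lerD s0e ue))//; lra.
- rewrite ptE.
  have -> : x + (y ord0 ord0 - s0 - x ord0 ord0) *: ew + cons_rV (0, u - shear w' x) - y =
      - (s0 *: ew) + cons_rV (0, u - shear w' x).
    rewrite (_ : x + _ *: ew = x + d *: ew - s0 *: ew); last first.
      by apply/rowP => i; rewrite !rV_coordE /d; ring.
    by rewrite -yE; apply/rowP => i; rewrite !rV_coordE; ring.
  rewrite (le_lt_trans (ler_normD _ _))// normrN normrZ gtr0_norm//.
  by rewrite (le_lt_trans (lerD s0e ue))//; lra.
- move=> s /andP[s1 s2].
  pose t := x ord0 ord0 + s0 + s * (d - 2 * s0).
  have -> : pt (x ord0 ord0 + s0) + s *: (pt (y ord0 ord0 - s0) - pt (x ord0 ord0 + s0)) = pt t.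
    rewrite !ptE; apply/rowP => i.
    by rewrite !rV_coordE /t /d; ring.
  apply: uN; rewrite /t; rewrite /d in s0d *; nra.
Qed.

Lemma free_segment_near_pos (x y : 'rV[R]_n.+1) eta :
  `|x - y0| < rho -> `|y - y0| < rho -> 0 < eta ->
  exists x' y', [/\ `|x' - x| < eta, `|y' - y| < eta &
    forall s, 0 <= s <= 1 -> N (chart_inv c (x' + s *: (y' - x')))].
Proof.
move=> xr yr eta0; have [xy|yx|xy] := ltgtP (x ord0 ord0) (y ord0 ord0).
- exact: free_segment_lt.
- have [y' [x' [h1 h2 h3]]] := free_segment_lt yx yr xr eta0.
  exists x', y'; split => // s /andP[s0 s1].
  have -> : x' + s *: (y' - x') = y' + (1 - s) *: (x' - y').
    by apply/rowP => i; rewrite !mxE; ring.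
  by apply: h3; lra.
(* A segment inside a hyperplane [z_0 = cst] is first tilted. *)
- pose tau := Num.min ((rho - `|x - y0|) / 2) (eta / 2).
  have tau0 : 0 < tau by rewrite lt_min !divr_gt0// subr_gt0.
  have nd : `|delta_mx 0 0 : 'rV[R]_n.+1| <= 1.
    by apply: norm_le_coord => // i; rewrite mxE; case: (_ && _); rewrite ?normr1 ?normr0.
  pose z := x - tau *: delta_mx 0 0.
  have zx : `|z - x| <= tau.
    by rewrite /z addrAC subrr sub0r normrN normrZ gtr0_norm// ler_piMr// ltW.
  have t1 : tau <= (rho - `|x - y0|) / 2 by rewrite ge_min lexx.
  have t2 : tau <= eta / 2 by rewrite ge_min lexx orbT.
  have zr : `|z - y0| < rho.
    by rewrite (le_lt_trans (ler_distD x _ _))//; move: zx t1 xr; lra.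
  have zy : z ord0 ord0 < y ord0 ord0 by rewrite -xy /z !mxE/= mulr1 gtrBl.
  have [x' [y' [h1 h2 h3]]] := free_segment_lt zy zr yr (divr_gt0 eta0 (ltr0n R 2)).
  exists x', y'; split => //; last by move: h2; lra.
  by rewrite (le_lt_trans (ler_distD z _ _))//; move: h1 zx t2; lra.
Qed.

End free_segment_near_manifold.
End free_segment_near.

(** In dimension zero, density of [N] already says that the chart lies in [N]. *)
Lemma free_segment_near (R : realType) n (M : ptopologicalType)
    (S : smooth_structure R n M) (g : riemannian_metric S)
    (mu : {measure set (borel M) -> \bar R}) (N : set M)
    (c : chart R n M) (y0 : 'rV[R]_n) (k rho kappa : R) (x y : 'rV[R]_n) eta :
  riemannian_measure g mu -> sigma_compact M -> capacity g mu (~` N) = 0%E ->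
  atlas S c -> good_box g c y0 k rho kappa -> 0 < k ->
  `|x - y0| < rho -> `|y - y0| < rho -> 0 < eta ->
  exists x' y', [/\ `|x' - x| < eta, `|y' - y| < eta &
    forall s, 0 <= s <= 1 -> N (chart_inv c (x' + s *: (y' - x')))].
Proof.
case: n S g c y0 x y => [|n] S g c y0 x y mur sM cap0 ac gb k0 xr yr eta0; last first.
  exact: (@free_segment_near_pos R n M S g mu mur sM N cap0 c y0 k rho kappa).
have flat (u v : 'rV[R]_0) : u = v by apply/rowP; case.
have [odc _ ck _ _] := atlas_is_chart ac.
have [_ _ /(_ x (ltW xr))[[p dp px] _ _]] := gb.
have [q dq Nq] := capacity0_dense mur sM cap0 odc dp.
exists x, y; rewrite !subrr !normr0; split => // s _.
by rewrite (flat (_ + _) (c q)) ck.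
Qed.

(** * Paths *)

Section pieces.
Context {R : realType}.

(** The partitions of [piecewise_C1], in a form suited to induction. *)
Fixpoint pieces (P : R -> R -> Prop) (a : R) (s : seq R) : Prop :=
  if s is b :: s' then [/\ a < b, P a b & pieces P b s'] else True.

Lemma piecesP P a s : pieces P a s <-> path <%R a s /\
  forall i, (i < size s)%N -> P (nth 0 (a :: s) i) (nth 0 s i).
Proof.
elim: s a => [|b s IH] a /=; first by split.
split=> [[ab Pab /IH[sb Hs]]|[/andP[ab sb] Hs]].
  by rewrite ab sb; split => // -[//|i] /Hs.
by split => //; [exact: (Hs 0%N)|apply/IH; split => // i /(Hs i.+1)].
Qed.

Lemma pieces_cat P a s s' : pieces P a s -> pieces P (last a s) s' ->
  pieces P a (s ++ s').
Proof. by elim: s a => [//|b s IH] a /= [ab Pab Ps] Ps'; split => //; exact: IH. Qed.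

Lemma pieces_le P a s : pieces P a s -> a <= last a s.
Proof. by elim: s a => [//|b s IH] a /= [ab _ /IH]; apply: le_trans; exact: ltW. Qed.

Lemma pieces_sub P P' a s :
  (forall a' b', a <= a' -> a' < b' -> b' <= last a s -> P a' b' -> P' a' b') ->
  pieces P a s -> pieces P' a s.
Proof.
elim: s a => [//|b s IH] a PP' /= [ab Pab Ps]; split => //.
  by apply: PP' => //; exact: pieces_le Ps.
apply: IH => // a' b' ba'; apply: PP'; exact: le_trans (ltW ab) ba'.
Qed.

Lemma pieces_ind P (Q : R -> R -> Prop) a s :
  (forall a' b', a <= a' -> a' < b' -> b' <= last a s -> P a' b' -> Q a' b') ->
  (forall a' m b', a <= a' -> a' < m -> m < b' -> b' <= last a s ->
     Q a' m -> Q m b' -> Q a' b') ->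
  pieces P a s -> a < last a s -> Q a (last a s).
Proof.
elim: s a => [|b s IH] a base glue /=; first by rewrite ltxx.
move=> [ab Pab Ps] _; have := pieces_le Ps; rewrite le_eqVlt => /predU1P[bl|bl].
  by rewrite -bl; apply: base => //=; rewrite -bl.
apply: (glue a b) => //; first by apply: base => //=; exact: ltW.
apply: IH => // [a' b' ba'|a' m b' ba'].
  by apply: base; exact: le_trans (ltW ab) ba'.
by apply: glue; exact: le_trans (ltW ab) ba'.
Qed.

End pieces.

Section paths.
Context {R : realType} {n : nat} {M : ptopologicalType}.
Context {S : smooth_structure R n M} (g : riemannian_metric S).
Local Notation mu := (@lebesgue_measure R).
Implicit Types (gamma : R -> M) (N : set M).

Definition path_on gamma (a b : R) := {within `[a, b], continuous gamma} /\
  exists2 s, pieces (@C1_curve R n M S gamma) a s & last a s = b.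

Lemma path_on01 gamma : @piecewise_C1 R n M S gamma <-> path_on gamma 0 1.
Proof.
split=> -[cg [s]]; first by move=> [s1 s2 s3]; split => //; exists s => //; apply/piecesP.
by move=> /piecesP[s1 s2] s3; split => //; exists s.
Qed.

Lemma within_itv_continuous gamma (a b t : R) :
  {within `[a, b], continuous gamma} -> a < t < b -> {for t, continuous gamma}.
Proof.
move=> /subspace_continuousP cg tab.
have /cg ct : `[a, b]%classic t by rewrite /= in_itv/= !ltW//; case/andP: tab.
move=> V /ct H; have {}H : nbhs t (fun s => `[a, b]%classic s -> V (gamma s)) := H.
have ab : \forall s \near t, s \in `]a, b[ by apply: near_in_itvoo; rewrite in_itv.
have : nbhs t (fun s => V (gamma s)); last by [].
near=> s; have : s \in `]a, b[ by near: s.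
rewrite in_itv/= => /andP[h1 h2].
suff : `[a, b]%classic s -> V (gamma s) by apply; rewrite /= in_itv/= !ltW.
by near: s.
Unshelve. all: by end_near. Qed.

(** Near [t] the speed is computed in one chart, whereas the chart used in its
    definition may jump. *)
Lemma speed_continuous gamma (a b t : R) : {within `[a, b], continuous gamma} ->
  @C1_curve R n M S gamma a b -> a < t < b -> {for t, continuous (speed g gamma)}.
Proof.
move=> cg C1 tab; pose c := chart_at S (gamma t).
have ac : atlas S c by exact: chart_at_atlas.
have dt : chart_dom c (gamma t) by exact: chart_at_dom.
have [od _ ck cc _] := atlas_is_chart ac.
have [H _ _] := C1 c ac.
have ct := within_itv_continuous cg tab.
have near_dom : \forall s \near t, chart_dom c (gamma s).
  by apply: ct; exact: open_nbhs_nbhs.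
have near_ab : \forall s \near t, s \in `]a, b[ by apply: near_in_itvoo; rewrite in_itv.
have eqs : \forall s \near t,
    qnorm (gram_at g c (c (gamma s))) (velocity c gamma s) = speed g gamma s.
  near=> s; have sab : a < s < b.
    by have : s \in `]a, b[ by near: s; exact: near_ab.
  have ds : chart_dom c (gamma s) by near: s.
  rewrite (@speed_chart _ _ _ _ g c)//; first by rewrite /gram_at ck.
    exact: within_itv_continuous sab.
  by have [] := H s sab ds.
have [_ cv] := H t tab dt.
have cig : chart_img c (c (gamma t)) by exists (gamma t).
rewrite /prop_for /continuous_at -(nbhs_singleton eqs).
apply: cvg_trans; first exact: near_eq_cvg eqs.
apply: (@continuous_comp _ _ _ (fun s => qform (gram_at g c (c (gamma s))) (velocity c gamma s)) Num.sqrt);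
  last exact: sqrt_continuous.
rewrite (_ : (fun s => _) = (fun s => \sum_(j < n) \sum_(i < n)
   (velocity c gamma s ord0 i * gram_at g c (c (gamma s)) i j * velocity c gamma s ord0 j))); last first.
  apply/funext => s; rewrite /qform mxE; apply: eq_bigr => j _.
  by rewrite mxE mulr_suml; apply: eq_bigr => i _; rewrite [_^T _ _]mxE.
have cvi i : {for t, continuous (fun s => velocity c gamma s ord0 i)}.
  apply: (@continuous_comp _ _ _ (velocity c gamma) (fun v : 'rV[R]_n => v ord0 i)) => //.
  exact: coord_continuous.
apply: continuous_sum_seq => j; apply: continuous_sum_seq => i.
apply: continuousM; last exact: cvi.
apply: continuousM; first exact: cvi.
apply: (@continuous_comp _ _ _ (fun s => c (gamma s)) (fun y => gram_at g c y i j)).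
  by apply: (@continuous_comp _ _ _ gamma c) => //; exact: cc.
exact: gram_at_continuous.
Unshelve. all: by end_near. Qed.

Lemma path_continuous gamma a b a' b' : {within `[a, b], continuous gamma} ->
  a <= a' -> b' <= b -> {within `[a', b'], continuous gamma}.
Proof.
move=> cg aa bb; apply: continuous_subspaceW cg => t /=; rewrite !in_itv/= => /andP[h1 h2].
by rewrite (le_trans aa)//= (le_trans h2).
Qed.

Lemma measurable_speed gamma a b : a < b -> path_on gamma a b ->
  measurable_fun `]a, b[ (speed g gamma).
Proof.
move=> ab [cg [s ps sb]]; rewrite -{}sb in ab cg *.
apply: (pieces_ind (P := @C1_curve R n M S gamma)
  (Q := fun a b => measurable_fun `]a, b[ (speed g gamma))) => // [a' b' aa' ab' bb' C1|a' m b' aa' am mb bb' h1 h2].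
- apply: open_continuous_measurable_fun; first exact: interval_open.
  move=> t; rewrite inE/= in_itv/= => tab.
  by apply: speed_continuous tab => //; exact: path_continuous cg _ _.
- rewrite (@itv_bndbnd_setU _ _ _ (BLeft m)) ?bnd_simp//; last by rewrite ltW.
  apply/measurable_funU => //; split => //.
  exact/measurable_fun_itv_obnd_cbndP.
Qed.

Lemma speed_ge0 gamma t : 0 <= speed g gamma t.
Proof. exact: sqrtr_ge0. Qed.

(** The open interval leaves out the break points, where the speed is
    arbitrary. *)
Definition length_on gamma a b := (\int[mu]_(t in `]a, b[) (speed g gamma t)%:E)%E.

Lemma curve_lengthE gamma : path_on gamma 0 1 ->
  curve_length g gamma = length_on gamma 0 1.
Proof.
move=> pg; rewrite /curve_length integral_itv_bndoo//.
apply/measurable_EFinP; exact: measurable_speed.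
Qed.

Lemma length_onD gamma (a m b : R) : a < m -> m < b -> measurable_fun `]a, b[ (speed g gamma) ->
  length_on gamma a b = (length_on gamma a m + length_on gamma m b)%E.
Proof.
move=> am mb ms.
have E : `]a, b[%classic = `]a, m[%classic `|` `[m, b[%classic.
  by rewrite (@itv_bndbnd_setU _ _ _ (BLeft m)) ?bnd_simp// ltW.
rewrite /length_on E ge0_integral_setU//.
- rewrite -[X in (_ + X)%E]integral_itv_obnd_cbnd//.
  apply/measurable_EFinP; apply: measurable_funS ms => //.
  by rewrite E => t /= h; right; move: h; rewrite /= !in_itv/= => /andP[/ltW -> ->].
- by rewrite -E; exact/measurable_EFinP.
- by move=> t _; rewrite lee_fin speed_ge0.
- rewrite disj_set2E; apply/eqP/seteqP; split => // t /= []; rewrite !in_itv/=.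
  by move=> /andP[_ tm] /andP[mt _]; have := lt_le_trans tm mt; rewrite ltxx.
Qed.

Section congruence.
Variables (gamma gamma' : R -> M) (a b : R).
Hypothesis eg : forall t, a <= t <= b -> gamma t = gamma' t.

Let near_eg (c : chart R n M) t : a < t < b ->
  \forall s \near t, c (gamma s) = c (gamma' s).
Proof.
move=> tab; have : \forall s \near t, s \in `]a, b[ by apply: near_in_itvoo; rewrite in_itv.
by apply: filterS => s; rewrite in_itv/= => /andP[h1 h2]; rewrite eg// !ltW.
Qed.

Lemma velocity_congr (c : chart R n M) t : a < t < b ->
  velocity c gamma t = velocity c gamma' t.
Proof. by move=> tab; rewrite /velocity !derive1E; exact/near_eq_derive/near_eg. Qed.

Lemma speed_congr t : a < t < b -> speed g gamma t = speed g gamma' t.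
Proof.
move=> tab; rewrite /speed eg; last by case/andP: tab => h1 h2; rewrite !ltW.
by rewrite velocity_congr.
Qed.

Lemma length_congr : length_on gamma a b = length_on gamma' a b.
Proof.
by apply: eq_integral => t; rewrite inE/= in_itv/= => tab; rewrite speed_congr.
Qed.

Lemma C1_curve_congr : a < b ->
  @C1_curve R n M S gamma a b -> @C1_curve R n M S gamma' a b.
Proof.
move=> ab C1 c ac; have [H Ha Hb] := C1 c ac; split.
- move=> t tab; rewrite -eg; last by case/andP: tab => h1 h2; rewrite !ltW.
  move=> /(H t tab)[dt ct]; split; first exact: near_eq_derivable (near_eg c tab) dt.
  rewrite /prop_for /continuous_at -(velocity_congr c tab).
  apply: cvg_trans ct; apply: near_eq_cvg.
  have : \forall s \near t, s \in `]a, b[ by apply: near_in_itvoo; rewrite in_itv.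
  by apply: filterS => s; rewrite in_itv/= => sab; rewrite velocity_congr.
- have haa : a <= a <= b by rewrite lexx ltW.
  rewrite -(eg haa) => /Ha/cvg_ex[l vl]; apply/cvg_ex; exists l.
  apply: cvg_trans vl; apply: near_eq_cvg; near=> s; apply: velocity_congr.
  by apply/andP; split; near: s; [exact: nbhs_right_gt|exact: nbhs_right_lt].
- have hbb : a <= b <= b by rewrite lexx ltW.
  rewrite -(eg hbb) => /Hb/cvg_ex[l vl]; apply/cvg_ex; exists l.
  apply: cvg_trans vl; apply: near_eq_cvg; near=> s; apply: velocity_congr.
  by apply/andP; split; near: s; [exact: nbhs_left_gt|exact: nbhs_left_lt].
Unshelve. all: by end_near. Qed.

End congruence.

Lemma path_on_congr gamma gamma' a b : (forall t, a <= t <= b -> gamma t = gamma' t) ->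
  path_on gamma a b -> path_on gamma' a b.
Proof.
move=> eg [cg [s ps sb]]; split.
  by apply: subspace_eq_continuous cg => t; rewrite inE/= in_itv/=; exact: eg.
exists s => //; apply: pieces_sub ps => a' b' aa' ab' bb'.
apply: C1_curve_congr => // t /andP[h1 h2]; apply: eg.
by rewrite (le_trans aa')//= (le_trans h2)// -sb.
Qed.

Lemma path_on_glue gamma a m b : a < m -> m < b ->
  path_on gamma a m -> path_on gamma m b -> path_on gamma a b.
Proof.
move=> am mb [c1 [s1 p1 l1]] [c2 [s2 p2 l2]]; split.
  rewrite (@itv_bndbnd_setU _ _ _ (BRight m)) ?bnd_simp ?ltW//.
  rewrite (_ : _ `|` _ = `[a, m] `|` `[m, b])%classic.
    by apply: withinU_continuous => //; exact: interval_closed.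
  apply/seteqP; split => t /= []; rewrite !in_itv/=; [by left|move=> /andP[/ltW h1 h2]; right; exact/andP|by left|].
  by move=> /andP[h1 h2]; have [tm|mt] := leP t m; [left; rewrite (le_trans (ltW am) h1)|right].
exists (s1 ++ s2); first by apply: pieces_cat => //; rewrite l1.
by rewrite last_cat l1.
Qed.

(** The interval on which the curve is parametrized is left free so that
    curves can be concatenated without reparametrization. *)
Definition joined N x y (L : R) := forall a b, a < b -> exists gamma,
  [/\ path_on gamma a b, gamma a = x, gamma b = y,
      forall t, a <= t <= b -> N (gamma t) & (length_on gamma a b <= L%:E)%E].

Lemma joined_le N x y L L' : L <= L' -> joined N x y L -> joined N x y L'.
Proof.
move=> LL j a b ab; have [gamma [h1 h2 h3 h4 h5]] := j a b ab.
by exists gamma; split => //; rewrite (le_trans h5)// lee_fin.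
Qed.

Lemma joined_trans N x y z L L' :
  joined N x y L -> joined N y z L' -> joined N x z (L + L').
Proof.
move=> j j' a b ab; pose m := (a + b) / 2.
have am : a < m by rewrite midf_lt.
have mb : m < b by rewrite midf_lt.
have [g1 [p1 g1a g1m N1 L1]] := j a m am.
have [g2 [p2 g2m g2b N2 L2]] := j' m b mb.
pose gamma t := if t <= m then g1 t else g2 t.
have e1 t : a <= t <= m -> g1 t = gamma t by rewrite /gamma => /andP[_ ->].
have e2 t : m <= t <= b -> g2 t = gamma t.
  by rewrite /gamma le_eqVlt => /andP[/predU1P[<-|mt] _]; rewrite ?lexx ?g1m// leNgt mt.
have p1' := path_on_congr e1 p1; have p2' := path_on_congr e2 p2.
have p := path_on_glue am mb p1' p2'.
exists gamma; split => //.
- by rewrite -(e1 a) ?g1a ?lexx ?(ltW am).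
- by rewrite -(e2 b) ?g2b ?lexx ?(ltW mb).
- move=> t /andP[ta tb]; have [tm|/ltW mt] := leP t m.
    by rewrite -(e1 t) ?ta//; apply: N1; rewrite ta.
  by rewrite -(e2 t) ?mt//; apply: N2; rewrite mt.
- rewrite (length_onD am mb (measurable_speed ab p)) EFinD -(length_congr e1) -(length_congr e2).
  exact: leeD.
Qed.

Lemma joined_dist N x y L : joined N x y L -> (riemannian_dist g N x y <= L%:E)%E.
Proof.
move=> /(_ 0 1 ltr01)[gamma [p g0 g1 gN gL]].
apply: le_trans gL; rewrite -curve_lengthE//; apply: ereal_inf_lbound.
by exists gamma => //; split => //; exact/path_on01.
Qed.

End paths.

(** * Chart segments as paths *)

Section chart_segments.
Context {R : realType} {n : nat} {M : ptopologicalType}.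
Context {S : smooth_structure R n M} (g : riemannian_metric S).
Implicit Types (N : set M).

Lemma is_derive_param_line (x w : 'rV[R]_n) (t : R) :
  is_derive t (1 : R) (fun s : R => x + s *: w) w.
Proof.
have dc (i : 'I_n) : is_derive t (1 : R) (fun s : R => (x + s *: w) ord0 i) (w ord0 i).
  rewrite (_ : (fun s => _) = (fun s : R => x ord0 i + w ord0 i * s)).
    have /is_derive_eq := is_deriveD (is_derive_cst (x ord0 i) t 1)
      (is_deriveZ (w ord0 i) (is_derive_id t 1)).
    by apply; rewrite add0r [LHS]mulr1.
  by apply/funext => s; rewrite !rV_coordE mulrC.
have d : derivable (fun s : R => x + s *: w) t 1.
  by apply/derivable_mxP => i j; rewrite (ord1 i); have [] := dc j.
split=> //; rewrite derive_mx//; apply/rowP => i; rewrite mxE.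
by have [_ ->] := dc i.
Qed.

Lemma continuous_row (f : 'I_n -> R -> R) t : (forall j, {for t, continuous (f j)}) ->
  {for t, continuous (fun s => \row_j f j s)}.
Proof.
move=> cf; apply/cvgrPdist_lt => e e0.
have : \forall s \near t, forall j, `|f j t - f j s| < e.
  apply: (@filter_forall _ _ (fun j s => `|f j t - f j s| < e) (nbhs t)) => j.
  by have /cvgrPdist_lt/(_ _ e0) := cf j.
apply: filterS => s fs; apply: norm_lt_coord => // j; rewrite coordB !mxE; exact: fs.
Qed.

(** The line exists on both sides of the end points, so the one-sided limits
    required of a [C^1] curve come from continuity. *)
Lemma C1_curve_chart (c : chart R n M) (gamma : R -> M) (x w : 'rV[R]_n) (a b : R) :
  atlas S c -> a < b ->
  (forall t, a <= t <= b -> chart_img c (x + t *: w)) ->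
  (forall t, gamma t = chart_inv c (x + t *: w)) ->
  [/\ forall t, a <= t <= b -> {for t, continuous gamma},
     @C1_curve R n M S gamma a b &
     forall t, a <= t <= b -> speed g gamma t = qnorm (gram_at g c (x + t *: w)) w].
Proof.
move=> ac ab Hc gE.
have [odc oi ck cc ci] := atlas_is_chart ac.
have cline t : {for t, continuous (fun t : R => x + t *: w)}.
  apply: continuousD; first exact: cst_continuous.
  by apply: continuousZl => //; exact: cvg_id.
have cg t : chart_img c (x + t *: w) -> {for t, continuous gamma}.
  move=> ct; rewrite (_ : gamma = chart_inv c \o (fun t => x + t *: w)).
    by apply: continuous_comp; [exact: cline|exact: ci].
  by apply/funext => s /=; rewrite gE.
have near_img t : chart_img c (x + t *: w) -> \forall s \near t, chart_img c (x + s *: w).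
  by move=> ct; apply: cline; exact: open_nbhs_nbhs.
have cgE t : chart_img c (x + t *: w) -> chart_dom c (gamma t) /\ c (gamma t) = x + t *: w.
  by rewrite gE => -[p dp <-]; rewrite ck.
have dline t : chart_img c (x + t *: w) -> is_derive t (1 : R) (fun s => c (gamma s)) w.
  move=> ct; have : is_derive t (1 : R) (fun s : R => x + s *: w) w.
    exact: is_derive_param_line.
  apply: near_eq_is_derive; have := near_img t ct; apply: filterS => s cs.
  by have [_ ->] := cgE s cs.
have vel t : chart_img c (x + t *: w) -> velocity c gamma t = w.
  by move=> /dline[_ <-]; rewrite /velocity derive1E.
have tr t d : chart_img c (x + t *: w) -> atlas S d -> chart_dom d (gamma t) ->
    derivable (fun s => d (gamma s)) t 1 /\
    velocity d gamma t = w *m transition_jacobian c d (gamma t).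
  move=> ct ad dt; have [dct _] := cgE t ct.
  have [h1 ->] := velocity_transition ac ad (cg t ct) dct dt (@ex_derive _ _ _ _ _ _ _ (dline t ct)).
  by rewrite vel.
have cvel t d : chart_img c (x + t *: w) -> atlas S d -> chart_dom d (gamma t) ->
    {for t, continuous (velocity d gamma)}.
  move=> ct ad dt; have [odd _ _ _ _] := atlas_is_chart ad.
  have [dct cgt] := cgE t ct.
  have near_d : \forall s \near t, chart_dom d (gamma s).
    by apply: (cg t ct); exact: open_nbhs_nbhs.
  pose J s : 'rV[R]_n := \row_j \sum_(i < n)
    w ord0 i * partial i (fun y => d (chart_inv c y) ord0 j) (x + s *: w).
  have eqJ : \forall s \near t, J s = velocity d gamma s.
    near=> s; have cs : chart_img c (x + s *: w) by near: s; exact: near_img.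
    have ds : chart_dom d (gamma s) by near: s.
    have [_ ->] := tr s d cs ad ds; apply/rowP => j; rewrite !mxE.
    by apply: eq_bigr => i _; rewrite mxE; have [_ ->] := cgE s cs.
  rewrite /prop_for /continuous_at -(nbhs_singleton eqJ).
  apply: cvg_trans; first exact: near_eq_cvg eqJ.
  apply: continuous_row => j; apply: continuous_sum_seq => i.
  apply: continuousM; first exact: cst_continuous.
  have h : {for t, continuous (partial i (fun y => d (chart_inv c y) ord0 j) \o
      (fun s => x + s *: w))}.
    apply: continuous_comp; first exact: cline.
    have [_ /(_ i)[_ [+ _]]] := atlas_smooth ac ad j 1%N; apply.
    by exists (gamma t).
  exact: h.
split.
- by move=> t /Hc; exact: cg.
- move=> d ad; split.
  + move=> t /andP[ta tb] dt; have ct : chart_img c (x + t *: w).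
      by apply: Hc; rewrite !ltW.
    by split; [have [] := tr t d ct ad dt|exact: cvel].
  + move=> da; apply/cvg_ex; exists (velocity d gamma a); apply: cvg_at_right_filter.
    by apply: cvel => //; apply: Hc; rewrite lexx ltW.
  + move=> db; apply/cvg_ex; exists (velocity d gamma b); apply: cvg_at_left_filter.
    by apply: cvel => //; apply: Hc; rewrite lexx ltW.
- move=> t /Hc ct; have [dct cgt] := cgE t ct.
  by rewrite (speed_chart _ ac (cg t ct) dct (@ex_derive _ _ _ _ _ _ _ (dline t ct))) vel// /gram_at gE.
Unshelve. all: by end_near. Qed.

Variables (c : chart R n M) (y0 : 'rV[R]_n) (k rho kappa : R).
Hypotheses (ac : atlas S c) (gb : good_box g c y0 k rho kappa) (k0 : 0 < k).
Local Notation q0 := (qnorm (gram_at g c y0)).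

Let posdef0 : posdef (gram_at g c y0).
Proof.
have [rho0 _ Hb] := gb; apply: gram_at_posdef => //.
by have [] := Hb y0; rewrite // subrr normr0 ltW.
Qed.

Lemma joined_segment N (x w : 'rV[R]_n) :
  (forall s, 0 <= s <= 1 -> `|x + s *: w - y0| < rho /\ N (chart_inv c (x + s *: w))) ->
  joined g N (chart_inv c x) (chart_inv c (x + w)) (k * q0 w).
Proof.
move=> Hs a b ab; have [rho0 kappa0 Hb] := gb.
have d0 : 0 < b - a by rewrite subr_gt0.
pose x' := x - (a / (b - a)) *: w; pose w' := (b - a)^-1 *: w.
have xE t : x' + t *: w' = x + ((t - a) / (b - a)) *: w.
  by apply/rowP => i; rewrite !rV_coordE; ring.
have sE t : a <= t <= b -> 0 <= (t - a) / (b - a) <= 1.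
  move=> /andP[ta tb]; rewrite ler_pdivrMr// mul1r lerD2r tb andbT.
  by rewrite divr_ge0 ?subr_ge0// ltW.
have Hc t : a <= t <= b -> chart_img c (x' + t *: w').
  by move=> /sE/Hs[+ _]; rewrite -xE => /ltW/Hb[].
pose gamma t := chart_inv c (x' + t *: w').
have [cg C1 sp] := C1_curve_chart ac ab Hc (fun t => erefl (gamma t)).
have pg : @path_on R n M S gamma a b.
  split; last by exists [:: b] => //=; split.
  apply/subspace_continuousP => t /=; rewrite in_itv/= => /cg ct.
  exact: cvg_within_filter ct.
exists gamma; split => //.
- by rewrite /gamma xE subrr mul0r scale0r addr0.
- by rewrite /gamma xE divff ?gt_eqF// scale1r.
- by move=> t /sE/Hs[_]; rewrite /gamma xE.
- apply: (@le_trans _ _ (\int[lebesgue_measure]_(t in `]a, b[) (k * q0 w')%:E)%E).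
    apply: ge0_le_integral => //.
    + by move=> t _; rewrite lee_fin speed_ge0.
    + by apply/measurable_EFinP; exact: measurable_speed.
    + move=> t /=; rewrite in_itv/= => /andP[ta tb].
      have tab : a <= t <= b by rewrite !ltW.
      rewrite lee_fin sp//; have [+ _] := Hs _ (sE t tab).
      by rewrite -xE => /ltW/Hb[_ _ /(_ w')[]].
  rewrite integral_cst//= lebesgue_measure_itv/= lte_fin ab -EFinB -EFinM lee_fin.
  rewrite /w' qnormZ// ger0_norm ?invr_ge0 ?(ltW d0)//.
  by rewrite -mulrA mulrAC mulVf ?gt_eqF// mul1r.
Qed.

Hypotheses (N : set M) (N_open : open N).
Variable mu : {measure set (borel M) -> \bar R}.
Hypothesis mu_riemannian : riemannian_measure g mu.
Hypothesis M_sigma_compact : sigma_compact M.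
Hypothesis cap0 : capacity g mu (~` N) = 0%E.

(** Two short segments inside [N] connect the end points to those of a free
    segment nearby. *)
Lemma joined_local (x y : 'rV[R]_n) eps : 0 < eps ->
  `|x - y0| < rho -> `|y - y0| < rho ->
  N (chart_inv c x) -> N (chart_inv c y) ->
  joined g N (chart_inv c x) (chart_inv c y) (k * q0 (y - x) + eps).
Proof.
move=> eps0 xr yr Nx Ny; have [rho0 kappa0 Hb] := gb.
have [C C0 HC] := qnorm_bounded posdef0.
have inner (z : 'rV[R]_n) : `|z - y0| < rho -> N (chart_inv c z) ->
    exists2 e, 0 < e & forall z', `|z' - z| < e -> `|z' - y0| < rho /\ N (chart_inv c z').
  move=> zr Nz; have [cz _ _] := Hb z (ltW zr).
  have oV := preimage_chart_inv_open (atlas_is_chart ac) N_open.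
  have /nbhs_ballP[e /= e0 eV] := open_nbhs_nbhs (conj oV (conj cz Nz)).
  exists (Num.min e (rho - `|z - y0|)); first by rewrite lt_min e0 subr_gt0.
  move=> z'; rewrite lt_min => /andP[ze zr']; split.
    by rewrite (le_lt_trans (ler_distD z _ _))//; move: zr'; lra.
  by have [] := eV z'; rewrite // -ball_normE/= distrC.
have [ex ex0 Hx] := inner x xr Nx; have [ey ey0 Hy] := inner y yr Ny.
pose e := eps / (4 * k * C).
have e0 : 0 < e by rewrite divr_gt0// !mulr_gt0.
have ke (u : 'rV[R]_n) : `|u| < e -> k * q0 u <= eps / 4.
  move=> ue; apply: (@le_trans _ _ (k * (C * e))).
    rewrite ler_wpM2l ?(ltW k0)// (le_trans (HC u))// ler_wpM2l ?(ltW C0)//.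
    exact: ltW.
  rewrite (_ : k * (C * e) = eps / 4)// /e; field.
  by rewrite !gt_eqF.
pose eta := Num.min e (Num.min ex ey).
have eta0 : 0 < eta by rewrite !lt_min e0 ex0 ey0.
have [x' [y' [xx yy Nxy]]] :=
  free_segment_near mu_riemannian M_sigma_compact cap0 ac gb k0 xr yr eta0.
have [/andP[xe /andP[xx' _]] /andP[ye /andP[_ yy']]] :
    (`|x' - x| < e) && ((`|x' - x| < ex) && (`|x' - x| < ey)) /\
    (`|y' - y| < e) && ((`|y' - y| < ex) && (`|y' - y| < ey)).
  by rewrite -!lt_min.
have scale (s : R) (u : 'rV[R]_n) : 0 <= s <= 1 -> `|s *: u| <= `|u|.
  by move=> /andP[s0 s1]; rewrite normrZ ger0_norm// ler_piMl.
have j1 : joined g N (chart_inv c x) (chart_inv c x') (k * q0 (x' - x)).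
  rewrite -[in X in joined _ _ _ X _](subrK x x') addrC.
  apply: joined_segment => s s01; apply: Hx.
  by rewrite addrC addKr (le_lt_trans (scale _ _ s01)).
have j3 : joined g N (chart_inv c y') (chart_inv c y) (k * q0 (y - y')).
  rewrite -[in X in joined _ _ _ X _](subrK y' y) addrC.
  apply: joined_segment => s s01; apply: Hy.
  have -> : y' + s *: (y - y') - y = (1 - s) *: (y' - y).
    by apply/rowP => i; rewrite !rV_coordE; ring.
  rewrite (le_lt_trans (scale _ _ _))//.
  by case/andP: s01 => s0 s1; rewrite subr_ge0 s1 lerBlDr lerDl.
have j2 : joined g N (chart_inv c x') (chart_inv c y') (k * q0 (y' - x')).
  rewrite -[in X in joined _ _ _ X _](subrK x' y') addrC.
  apply: joined_segment => s s01; split; last exact: Nxy.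
  have [xr' _] := Hx x' xx'; have [yr' _] := Hy y' yy'.
  have -> : x' + s *: (y' - x') - y0 = (1 - s) *: (x' - y0) + s *: (y' - y0).
    by apply/rowP => i; rewrite !rV_coordE; ring.
  case/andP: s01 => s0 s1.
  rewrite (le_lt_trans (ler_normD _ _))// !normrZ (ger0_norm s0) ger0_norm ?subr_ge0//.
  have [->|s0'] := eqVneq s 0; first by rewrite mul0r addr0 subr0 mul1r.
  have sp : 0 < s by rewrite lt_neqAle eq_sym s0'.
  rewrite (_ : rho = (1 - s) * rho + s * rho); last by ring.
  by rewrite ler_ltD// ?ltr_pM2l// ler_wpM2l ?subr_ge0// ltW.
apply: joined_le (joined_trans (joined_trans j1 j2) j3).
have h1 := ke _ xe; have h3 : k * q0 (y - y') <= eps / 4 by apply: ke; rewrite distrC.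
have h2 : k * q0 (y' - x') <= k * q0 (y - x) + eps / 2.
  have -> : y' - x' = (y' - y) + ((y - x) + (x - x')).
    by apply/rowP => i; rewrite !rV_coordE; ring.
  have t1 := qnorm_triangle (y' - y) ((y - x) + (x - x')) posdef0.
  have t2 := qnorm_triangle (y - x) (x - x') posdef0.
  have h4 := ke _ ye; have h5 : k * q0 (x - x') <= eps / 4 by apply: ke; rewrite distrC.
  apply: (@le_trans _ _ (k * (q0 (y' - y) + (q0 (y - x) + q0 (x - x'))))).
    by rewrite ler_wpM2l ?(ltW k0)// (le_trans t1)// lerD2l.
  by rewrite !mulrDr; move: h4 h5; lra.
by move: h1 h2 h3; lra.
Qed.

End chart_segments.

(** * Lengths of curves and the distance in the open set *)

Section increments.
Context {R : realType} {n : nat}.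

Lemma bform_le_qnorm (g : 'M[R]_n) u v : posdef g ->
  bform g u v <= qnorm g u * qnorm g v.
Proof.
move=> pg; rewrite /qnorm -sqrtrM ?qform_ge0//.
apply: (le_trans (ler_norm _)); rewrite -sqrtr_sqr ler_wsqrtr//.
exact: cauchy_schwarz.
Qed.

Lemma is_derive_bform (g : 'M[R]_n) (f : R -> 'rV[R]_n) u t : derivable f t 1 ->
  is_derive t (1 : R) (fun s => bform g (f s) u) (bform g (derive1 f t) u).
Proof.
move=> df; pose a i := (g *m u^T) i ord0.
have bE v : bform g v u = \sum_(i < n) v ord0 i * a i.
  by rewrite /bform -mulmxA mxE.
have dc i : is_derive t (1 : R) (fun s => f s ord0 i * a i) (derive1 f t ord0 i * a i).
  have di : is_derive t (1 : R) (fun s => f s ord0 i) (derive1 f t ord0 i).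
    rewrite derive1E derive_mx// mxE; apply: derivableP.
    by move/derivable_mxP : df; exact.
  rewrite (_ : (fun s => _) = (fun s => a i * f s ord0 i)); last first.
    by apply/funext => s; rewrite mulrC.
  by rewrite mulrC; exact: is_deriveZ.
rewrite (_ : (fun s => _) = \sum_(i < n) (fun s => f s ord0 i * a i)).
  by rewrite bE; exact: is_derive_sum.
by apply/funext => s; rewrite bE fct_sumE.
Qed.

Context {M : ptopologicalType} {S : smooth_structure R n M}.
Variable g : riemannian_metric S.
Local Notation mu := (@lebesgue_measure R).

Variables (c : chart R n M) (y0 : 'rV[R]_n) (k rho kappa : R).
Hypotheses (ac : atlas S c) (gb : good_box g c y0 k rho kappa) (k0 : 0 < k).
Local Notation q0 := (qnorm (gram_at g c y0)).

Let posdef0 : posdef (gram_at g c y0).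
Proof.
have [rho0 _ Hb] := gb; apply: gram_at_posdef => //.
by have [] := Hb y0; rewrite // subrr normr0 ltW.
Qed.

Variables (gamma : R -> M) (a b l : R).
Hypotheses (ab : a < b) (cg : {within `[a, b], continuous gamma}).
Hypothesis C1 : @C1_curve R n M S gamma a b.
Hypothesis gB : forall t, a <= t <= b ->
  chart_dom c (gamma t) /\ `|c (gamma t) - y0| <= rho.
Hypothesis lg : (length_on g gamma a b <= l%:E)%E.

Let pg : @path_on R n M S gamma a b.
Proof. by split => //; exists [:: b] => //=; split. Qed.

(** The fundamental theorem of calculus, applied to the component of the curve
    along its own increment [u]. Its derivative is at most [q0 u * q0
    velocity] by Cauchy-Schwarz, and [q0] exceeds the Riemannian norm by a
    factor at most [k]. *)
Let increment_inner a' b' : a < a' -> a' < b' -> b' < b ->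
  q0 (c (gamma b') - c (gamma a')) <= k * l.
Proof.
move=> aa ab' bb; set u := c (gamma b') - _.
have [rho0 kappa0 Hb] := gb.
have l0 : 0 <= l.
  by rewrite -lee_fin (le_trans _ lg)//; apply: integral_ge0 => t _; rewrite lee_fin speed_ge0.
have tin t : t \in `[a', b'] -> a < t < b.
  by rewrite in_itv/= => /andP[h1 h2]; rewrite (lt_le_trans aa)//= (le_lt_trans h2).
have [H _ _] := C1 ac.
have dom t : a < t < b -> chart_dom c (gamma t) /\ `|c (gamma t) - y0| <= rho.
  by move=> /andP[ta tb]; apply: gB; rewrite !ltW.
have [qu0|qu0] := eqVneq (q0 u) 0; first by rewrite qu0 mulr_ge0// ltW.
have qu : 0 < q0 u by rewrite lt_neqAle eq_sym qu0 sqrtr_ge0.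
pose h t := bform (gram_at g c y0) (c (gamma t)) u.
pose h' t := bform (gram_at g c y0) (velocity c gamma t) u.
have dh t : a < t < b -> is_derive t (1 : R) h (h' t).
  move=> tab; have [dt _] := dom t tab; have [+ _] := H t tab dt.
  exact: is_derive_bform.
have ch' t : a < t < b -> {for t, continuous h'}.
  move=> tab; have [dt _] := dom t tab; have [_ ct] := H t tab dt.
  rewrite (_ : h' = fun s => \sum_(i < n) velocity c gamma s ord0 i * (gram_at g c y0 *m u^T) i ord0).
    apply: continuous_sum_seq => i; apply: continuousM; last exact: cst_continuous.
    apply: (@continuous_comp _ _ _ (velocity c gamma) (fun v : 'rV[R]_n => v ord0 i)) => //.
    exact: coord_continuous.
  by apply/funext => s; rewrite /h' /bform -mulmxA mxE.
have cs t : a < t < b -> {for t, continuous (speed g gamma)}.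
  exact: speed_continuous.
have within (f : R -> R) : (forall t, a < t < b -> {for t, continuous f}) ->
    {within `[a', b'], continuous f}.
  move=> cf; apply/subspace_continuousP => t /= /tin/cf ct.
  exact: cvg_within_filter ct.
have FTC : (\int[mu]_(t in `[a', b']) (h' t)%:E = (h b')%:E - (h a')%:E)%E.
  apply: continuous_FTC2 => //; first exact: within.
    have dch t : t \in `[a', b'] -> {for t, continuous h}.
      move=> /tin/dh ht; apply/differentiable_continuous/derivable1_diffP.
      exact: (@ex_derive _ _ _ _ _ _ _ ht).
    split.
    - move=> t /subset_itv_oo_cc/tin/dh ht; exact: (@ex_derive _ _ _ _ _ _ _ ht).
    - by apply: cvg_at_right_filter; apply: dch; rewrite in_itv/= lexx ltW.
    - by apply: cvg_at_left_filter; apply: dch; rewrite in_itv/= lexx ltW.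
  by move=> t /subset_itv_oo_cc/tin/dh[_ <-]; rewrite derive1E.
have bound t : a < t < b -> h' t <= k * q0 u * speed g gamma t.
  move=> tab; have [dt ct] := dom t tab; have [dct _] := H t tab dt.
  apply: (le_trans (bform_le_qnorm _ _ posdef0)).
  rewrite mulrAC ler_wpM2r ?(ltW qu)//.
  have [_ _ /(_ (velocity c gamma t))[_ +]] := Hb _ ct.
  rewrite (speed_chart g ac (within_itv_continuous cg tab) dt dct).
  by rewrite /gram_at; have [_ _ -> //] := atlas_is_chart ac.
have int (f : R -> R) : (forall t, a < t < b -> {for t, continuous f}) ->
    mu.-integrable `[a', b'] (EFin \o f).
  by move=> cf; apply: continuous_compact_integrable; [exact: segment_compact|exact: within].
have ms : measurable_fun `[a', b'] (fun t => (speed g gamma t)%:E).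
  have /measurable_EFinP := measurable_speed g ab pg.
  by apply: measurable_funS => // t /= /tin; rewrite in_itv.
have : (((q0 u) ^+ 2)%:E <= (k * q0 u)%:E * l%:E)%E.
  have -> : q0 u ^+ 2 = h b' - h a'.
    rewrite sqr_sqrtr ?qform_ge0// /h -[qform _ _]/(bform _ u u) {1}/u.
    by rewrite bformDl -scaleN1r bformZl mulN1r.
  rewrite EFinB -FTC.
  apply: (@le_trans _ _ (\int[mu]_(t in `[a', b']) ((k * q0 u)%:E * (speed g gamma t)%:E))%E).
    apply: le_integral => //.
    - exact: int.
    - rewrite (_ : (fun t => _) = EFin \o (fun t => k * q0 u * speed g gamma t)).
        by apply: int => t tab; apply: continuousM; [exact: cst_continuous|exact: cs].
      by apply/funext => t /=; rewrite EFinM.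
    - by move=> t /set_mem /= /tin tab; rewrite -EFinM lee_fin; exact: bound.
  rewrite ge0_integralZl_EFin//; last 2 first.
  - by move=> t _; rewrite lee_fin speed_ge0.
  - by rewrite mulr_ge0// ltW.
  rewrite lee_wpmul2l ?lee_fin ?mulr_ge0 ?(ltW k0) ?(ltW qu)//.
  apply: (le_trans _ lg); apply: ge0_subset_integral => //.
  - by apply/measurable_EFinP; exact: measurable_speed.
  - by move=> t _; rewrite lee_fin speed_ge0.
by rewrite -EFinM lee_fin expr2 mulrAC ler_pM2r.
Qed.

(** The curve is only differentiable inside the interval: the end points are
    reached by continuity. *)
Lemma chart_increment : q0 (c (gamma b) - c (gamma a)) <= k * l.
Proof.
have [C C0 HC] := qnorm_bounded posdef0.
have [_ _ _ cc _] := atlas_is_chart ac.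
have [aab bab] : (a <= a <= b) /\ (a <= b <= b) by rewrite !lexx !ltW.
have cw t : a <= t <= b ->
    (fun s => c (gamma s)) @ within `[a, b]%classic (nbhs t) --> c (gamma t).
  move=> tab; apply: (@cvg_comp _ _ _ gamma c _ (nbhs (gamma t))).
    by move/subspace_continuousP : cg; apply; rewrite /= in_itv.
  by apply: cc; have [] := gB tab.
apply/ler_addgt0Pr => e e0; pose eta := e / (2 * C).
have eta0 : 0 < eta by rewrite divr_gt0// mulr_gt0.
have [a' [aa' am ha]] : exists a', [/\ a < a', a' < (a + b) / 2 & `|c (gamma a) - c (gamma a')| < eta].
  have : \forall s \near a^'+, `|c (gamma a) - c (gamma s)| < eta /\ (a < s /\ s < (a + b) / 2).
    near=> s; split; last by split; near: s; [exact: nbhs_right_gt|apply: nbhs_right_lt; rewrite midf_lt].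
    have : `[a, b]%classic s -> `|c (gamma a) - c (gamma s)| < eta.
      near: s; apply: (@cvg_within _ (nbhs a)).
      by have /cvgrPdist_lt/(_ _ eta0) := cw a aab.
    apply; rewrite /= in_itv/=; apply/andP; split; apply: ltW; near: s;
      [exact: nbhs_right_gt|exact: nbhs_right_lt].
  by case/(@filter_ex _ _ (at_right_proper_filter a)) => s [h1 [h2 h3]]; exists s.
have [b' [bm bb' hb]] : exists b', [/\ (a + b) / 2 < b', b' < b & `|c (gamma b) - c (gamma b')| < eta].
  have : \forall s \near b^'-, `|c (gamma b) - c (gamma s)| < eta /\ (s < b /\ (a + b) / 2 < s).
    near=> s; split; last by split; near: s; [exact: nbhs_left_lt|apply: nbhs_left_gt; rewrite midf_lt].
    have : `[a, b]%classic s -> `|c (gamma b) - c (gamma s)| < eta.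
      near: s; apply: (@cvg_within _ (nbhs b)).
      by have /cvgrPdist_lt/(_ _ eta0) := cw b bab.
    apply; rewrite /= in_itv/=; apply/andP; split; apply: ltW; near: s;
      [exact: nbhs_left_gt|exact: nbhs_left_lt].
  by case/(@filter_ex _ _ (at_left_proper_filter b)) => s [h1 [h2 h3]]; exists s.
have inner := increment_inner aa' (lt_trans am bm) bb'.
have -> : c (gamma b) - c (gamma a) = (c (gamma b) - c (gamma b')) +
    ((c (gamma b') - c (gamma a')) + (c (gamma a') - c (gamma a))).
  by apply/rowP => i; rewrite !rV_coordE; ring.
have small (u : 'rV[R]_n) : `|u| < eta -> q0 u <= e / 2.
  move=> ue; rewrite (le_trans (HC u))//.
  rewrite (_ : e / 2 = C * eta); first by rewrite ler_wpM2l// ltW.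
  by rewrite /eta; field; rewrite gt_eqF.
apply: (le_trans (qnorm_triangle _ _ posdef0)).
apply: (le_trans (lerD (small _ hb) (qnorm_triangle _ _ posdef0))).
have := small (c (gamma a') - c (gamma a)); rewrite distrC => /(_ ha).
move: inner; lra.
Unshelve. all: by end_near. Qed.

End increments.

(** Real induction on the supremum of the points related to [a]. *)
Lemma interval_chain {R : realType} (Q : R -> R -> Prop) a b : a < b ->
  (forall s m t, a <= s -> s < m -> m < t -> t <= b -> Q s m -> Q m t -> Q s t) ->
  (forall t, a <= t <= b -> exists2 d, 0 < d &
    (forall s, a <= s -> t - d < s -> s < t -> Q s t) /\
    (forall u, u <= b -> t < u -> u < t + d -> Q t u)) ->
  Q a b.
Proof.
move=> ab trans loc; pose E := [set t | a < t <= b /\ Q a t].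
have [d0 d00 [_ Q0]] := loc a (introT andP (conj (lexx a) (ltW ab))).
have E0 : E !=set0.
  exists (Num.min b (a + d0 / 2)); split.
    by rewrite lt_min ab ltrDl divr_gt0//= ge_min lexx.
  apply: Q0; first by rewrite ge_min lexx.
    by rewrite lt_min ab ltrDl divr_gt0.
  by rewrite gt_min orbC ltrD2l ltr_pdivrMr// ltr_pMr// ltr1n.
have ubE : ubound E b by move=> t [/andP[]].
have supE : has_sup E by split => //; exists b.
set tau := sup E.
have taub : tau <= b by exact: ge_sup.
have atau : a < tau.
  by have [t Et] := E0; have [/andP[at_ _] _] := Et; apply: lt_le_trans at_ (ub_le_sup _ Et); exists b.
have [d d0' [Ql Qr]] := loc tau (introT andP (conj (ltW atau) taub)).
have Qtau : Q a tau.
  have [t Et tt] := sup_adherent d0' supE.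
  have [/andP[at_ tb] Qt] := Et.
  have : t <= tau by apply: ub_le_sup Et; exists b.
  rewrite le_eqVlt => /predU1P[<-//|ttau].
  by apply: (trans a t tau) => //; apply: Ql => //; exact: ltW.
have [<-//|tb] := eqVneq tau b.
have {tb}tb : tau < b by rewrite lt_neqAle tb.
pose u := Num.min b (tau + d / 2).
have tu : tau < u by rewrite lt_min tb ltrDl divr_gt0.
have ub : u <= b by rewrite ge_min lexx.
have Qu : Q tau u.
  by apply: Qr => //; rewrite gt_min orbC ltrD2l ltr_pdivrMr// ltr_pMr// ltr1n.
have Eu : E u by split; [rewrite (lt_trans atau tu)|exact: trans Qtau Qu].
have : u <= tau by apply: ub_le_sup Eu; exists b.
by rewrite leNgt tu.
Qed.

Section distance.
Context {R : realType} {n : nat} {M : ptopologicalType}.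
Context {S : smooth_structure R n M} (g : riemannian_metric S).
Variable mu : {measure set (borel M) -> \bar R}.
Hypothesis mu_riemannian : riemannian_measure g mu.
Hypothesis M_sigma_compact : sigma_compact M.
Variable N : set M.
Hypotheses (N_open : open N) (cap0 : capacity g mu (~` N) = 0%E).

Definition chart_ball (c : chart R n M) (z : 'rV[R]_n) r :=
  [set p | chart_dom c p /\ `|c p - z| < r].

Lemma nbhs_chart_ball c z r p : is_chart c -> chart_ball c z r p ->
  nbhs p (chart_ball c z r).
Proof.
move=> [odc _ _ cc _] [dp pr].
have near_d : \forall q \near p, chart_dom c q by exact: open_nbhs_nbhs.
have near_b : \forall q \near p, `|c p - c q| < r - `|c p - z|.
  by have /cvgrPdist_lt := cc p dp; apply; rewrite subr_gt0.
near=> q; split; first by near: q.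
rewrite (le_lt_trans (ler_distD (c p) _ _))// distrC -ltrBrDr.
by near: q.
Unshelve. all: by end_near. Qed.

Lemma joined_chart_ball (c : chart R n M) y0 k rho kappa x y eps :
  atlas S c -> good_box g c y0 k rho kappa -> 0 < k -> 0 < eps ->
  chart_ball c y0 rho x -> chart_ball c y0 rho y -> N x -> N y ->
  joined g N x y (k * qnorm (gram_at g c y0) (c y - c x) + eps).
Proof.
move=> ac gb k0 eps0 [dx xr] [dy yr] Nx Ny.
have [_ _ ck _ _] := atlas_is_chart ac.
rewrite -[x in joined _ _ x _ _](ck x dx) -[y in joined _ _ _ y _](ck y dy).
by apply: (joined_local ac gb k0 N_open mu_riemannian M_sigma_compact cap0) => //;
  rewrite ck.
Qed.

Lemma exists_chart_ball p (k : R) : 1 < k -> exists c rho kappa,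
  [/\ atlas S c, good_box g c (c p) k rho kappa & chart_ball c (c p) rho p].
Proof.
move=> k1; pose c := chart_at S p.
have ac : atlas S c by exact: chart_at_atlas.
have dp : chart_dom c p by exact: chart_at_dom.
have cp : chart_img c (c p) by exists p.
have [rho [kappa gb]] := exists_good_box g ac cp k1.
exists c, rho, kappa; split => //; split => //.
by rewrite subrr normr0; case: gb.
Qed.

(** The curve may leave [N], so this is a relation between the points of [N]
    near its end points. It holds vacuously if the length is infinite. *)
Definition joined_near (K : R) (gamma : R -> M) (a b : R) := forall l eps, 0 < eps ->
  (length_on g gamma a b <= l%:E)%E ->
  exists V V', [/\ nbhs (gamma a) V, nbhs (gamma b) V' &
    forall x y, V x -> V' y -> N x -> N y -> joined g N x y (K * l + eps)].

(** Density of [N] provides a point to pass through near [gamma m]. *)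
Lemma joined_near_trans K gamma (a m b : R) : a < m -> m < b -> 0 < K ->
  measurable_fun `]a, b[ (speed g gamma) ->
  joined_near K gamma a m -> joined_near K gamma m b -> joined_near K gamma a b.
Proof.
move=> am mb K0 ms j1 j2 l eps eps0; rewrite (length_onD am mb ms).
have L0 a' b' : (0 <= length_on g gamma a' b')%E.
  by apply: integral_ge0 => t _; rewrite lee_fin speed_ge0.
have := j1 (fine (length_on g gamma a m)) (eps / 2); rewrite divr_gt0// => /(_ isT) {}j1.
have := j2 (fine (length_on g gamma m b)) (eps / 2); rewrite divr_gt0// => /(_ isT) {}j2.
move=> Ll.
have f1 : length_on g gamma a m \is a fin_num.
  rewrite ge0_fin_numE// (le_lt_trans _ (ltry l))// (le_trans _ Ll)//.
  by rewrite leeDl.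
have f2 : length_on g gamma m b \is a fin_num.
  rewrite ge0_fin_numE// (le_lt_trans _ (ltry l))// (le_trans _ Ll)//.
  by rewrite leeDr.
rewrite !fineK// in j1 j2.
have [V [V1 [nV nV1 HV]]] := j1 (lexx _).
have [V2 [V' [nV2 nV' HV']]] := j2 (lexx _).
exists V, V'; split => // x y Vx Vy Nx Ny.
have [G [oG Gm] GV] : exists2 G, open_nbhs (gamma m) G & G `<=` V1 `&` V2.
  have : nbhs (gamma m) (V1 `&` V2) by exact: filterI.
  by rewrite nbhsE => -[G nG GV]; exists G.
have [z /GV[V1z V2z] Nz] := capacity0_dense mu_riemannian M_sigma_compact cap0 oG Gm.
apply: joined_le (joined_trans (HV x z Vx V1z Nx Nz) (HV' z y V2z Vy Nz Ny)).
have : fine (length_on g gamma a m) + fine (length_on g gamma m b) <= l.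
  by rewrite -lee_fin EFinD !fineK.
by move=> /(ler_wpM2l (ltW K0)); rewrite mulrDr; lra.
Qed.

Lemma C1_curve_sub gamma a b a' b' : a <= a' -> a' < b' -> b' <= b ->
  @C1_curve R n M S gamma a b -> @C1_curve R n M S gamma a' b'.
Proof.
move=> aa ab bb C1 c ac; have [H Ha Hb] := C1 c ac; split.
- move=> t /andP[t1 t2]; apply: H.
  by rewrite (le_lt_trans aa)//= (lt_le_trans t2).
- move: aa; rewrite le_eqVlt => /predU1P[<-//|aa] da.
  apply/cvg_ex; exists (velocity c gamma a'); apply: cvg_at_right_filter.
  by have [] := H a' _ da; rewrite ?aa//= (lt_le_trans ab).
- move: bb; rewrite le_eqVlt => /predU1P[->//|bb] db.
  apply/cvg_ex; exists (velocity c gamma b'); apply: cvg_at_left_filter.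
  by have [] := H b' _ db; rewrite ?bb ?andbT// (le_lt_trans aa).
Qed.

(** One factor [k] comes from the increment of the curve in the chart and one
    from the path that follows it in [N]. *)
Lemma joined_near_local (k : R) gamma a b c y0 rho kappa : 1 < k -> a < b ->
  {within `[a, b], continuous gamma} -> @C1_curve R n M S gamma a b ->
  atlas S c -> good_box g c y0 k rho kappa ->
  (forall t, a <= t <= b -> chart_ball c y0 rho (gamma t)) ->
  joined_near (k * k) gamma a b.
Proof.
move=> k1 ab cg C1 ac gb gB l eps eps0 Ll.
have k0 : 0 < k by exact: lt_trans k1.
have [rho0 _ Hb] := gb.
have pg0 : posdef (gram_at g c y0).
  by apply: gram_at_posdef => //; have [] := Hb y0; rewrite // subrr normr0 ltW.
have [C C0 HC] := qnorm_bounded pg0.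
have inc := chart_increment ac gb k0 ab cg C1 _ Ll.
have {}inc : qnorm (gram_at g c y0) (c (gamma b) - c (gamma a)) <= k * l.
  by apply: inc => t /gB[dt /ltW].
have ha : chart_ball c y0 rho (gamma a) by apply: gB; rewrite lexx ltW.
have hb : chart_ball c y0 rho (gamma b) by apply: gB; rewrite lexx ltW.
pose e := eps / (4 * k * C).
have e0 : 0 < e by rewrite divr_gt0// !mulr_gt0.
have self p : chart_dom c p -> chart_ball c (c p) e p by split => //; rewrite subrr normr0.
have ic := atlas_is_chart ac.
exists (chart_ball c y0 rho `&` chart_ball c (c (gamma a)) e),
  (chart_ball c y0 rho `&` chart_ball c (c (gamma b)) e); split.
- by apply: filterI; apply: nbhs_chart_ball => //; apply: self; case: ha.
- by apply: filterI; apply: nbhs_chart_ball => //; apply: self; case: hb.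
move=> x y [xr [_ xe]] [yr [_ ye]] Nx Ny.
apply: joined_le (joined_chart_ball ac gb k0 (divr_gt0 eps0 (ltr0n R 2)) xr yr Nx Ny).
have ke (u : 'rV[R]_n) : `|u| < e -> k * qnorm (gram_at g c y0) u <= eps / 4.
  move=> ue; apply: (@le_trans _ _ (k * (C * e))).
    rewrite ler_wpM2l ?(ltW k0)// (le_trans (HC u))// ler_wpM2l ?(ltW C0)//.
    exact: ltW.
  rewrite (_ : k * (C * e) = eps / 4)// /e; field.
  by rewrite !gt_eqF.
have -> : c y - c x = (c y - c (gamma b)) + ((c (gamma b) - c (gamma a)) + (c (gamma a) - c x)).
  by apply/rowP => i; rewrite !rV_coordE; ring.
have t1 := qnorm_triangle (c y - c (gamma b)) ((c (gamma b) - c (gamma a)) + (c (gamma a) - c x)) pg0.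
have t2 := qnorm_triangle (c (gamma b) - c (gamma a)) (c (gamma a) - c x) pg0.
have := ler_wpM2l (ltW k0) (le_trans t1 (lerD (lexx _) t2)).
have h1 := ke _ ye; have h2 : k * qnorm (gram_at g c y0) (c (gamma a) - c x) <= eps / 4.
  by apply: ke; rewrite distrC.
have h3 := ler_wpM2l (ltW k0) inc.
by rewrite !mulrDr mulrA in h3 *; move: h1 h2 h3; lra.
Qed.

Lemma joined_near_path (k : R) gamma a b : 1 < k -> a < b ->
  @path_on R n M S gamma a b -> joined_near (k * k) gamma a b.
Proof.
move=> k1 ab pg; have ms := measurable_speed g ab pg.
have [cg [s ps sb]] := pg; have k0 : 0 < k by exact: lt_trans k1.
have trans s' m t' : a <= s' -> s' < m -> m < t' -> t' <= b ->
    joined_near (k * k) gamma s' m -> joined_near (k * k) gamma m t' ->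
    joined_near (k * k) gamma s' t'.
  move=> as' sm mt tb; apply: joined_near_trans => //; first exact: mulr_gt0.
  apply: measurable_funS ms => // r /=; rewrite !in_itv/= => /andP[h1 h2].
  by rewrite (le_lt_trans as')//= (lt_le_trans h2).
rewrite -{}sb in ab cg trans *.
apply: (pieces_ind (P := @C1_curve R n M S gamma) (Q := joined_near (k * k) gamma)) => //.
move=> a' b' aa' ab' bb' C1; have cg' := path_continuous cg aa' bb'.
apply: interval_chain => // [s' m t' as' sm mt tb'|t tab].
  by apply: trans => //; [exact: le_trans as'|exact: le_trans bb'].
have [c [rho [kappa [ac gb tball]]]] := exists_chart_ball (gamma t) k1.
have [d d0 Hd] : exists2 d, 0 < d & forall s', a' <= s' <= b' -> `|t - s'| < d ->
    chart_ball c (c (gamma t)) rho (gamma s').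
  have ct : gamma @ within `[a', b']%classic (nbhs t) --> gamma t.
    by move/subspace_continuousP : cg'; apply; rewrite /= in_itv.
  have : nbhs t (fun s' => `[a', b']%classic s' ->
      chart_ball c (c (gamma t)) rho (gamma s')).
    exact: (ct _ (nbhs_chart_ball (atlas_is_chart ac) tball)).
  move=> /nbhs_ballP[d /= d0 dH]; exists d => // s' s'ab ts'.
  by apply: dH => //=; rewrite in_itv.
have loc u v : a' <= u -> u < v -> v <= b' -> t - d < u -> v < t + d -> (u <= t <= v) ->
    joined_near (k * k) gamma u v.
  move=> a'u uv vb' tu vt /andP[ut tv].
  apply: (joined_near_local k1 uv _ (C1_curve_sub a'u uv vb' C1) ac gb).
    exact: path_continuous cg' a'u vb'.
  move=> r /andP[ur rv]; apply: Hd; first by rewrite (le_trans a'u)//= (le_trans rv).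
  by rewrite ltr_norml; lra.
case/andP: tab => a't tb'; exists d => //; split => [u a'u tu ut|v vb' tv vt].
  by apply: loc; rewrite ?ltrDl ?lexx ?(ltW ut).
by apply: loc; rewrite ?gtrBl ?lexx ?(ltW tv).
Qed.

Lemma dist_capacity0 p q : N p -> N q ->
  riemannian_dist g [set: M] p q = riemannian_dist g N p q.
Proof.
move=> Np Nq; apply/eqP; rewrite eq_le; apply/andP; split.
  apply: le_ereal_inf => _ [gamma [h1 h2 h3 h4] <-]; exists gamma => //.
apply: le_ereal_inf_tmp => _ [gamma [/path_on01 pg g0 g1 _] <-].
rewrite curve_lengthE//.
have l0 : (0 <= length_on g gamma 0%R 1%R)%E.
  by apply: integral_ge0 => t _; rewrite lee_fin speed_ge0.
have [lfin|] := boolP (length_on g gamma 0 1 \is a fin_num); last first.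
  by rewrite ge0_fin_numE// -leNgt leye_eq => /eqP->; rewrite leey.
move: l0; rewrite -(fineK lfin); set l := fine _ => l0; rewrite lee_fin in l0.
apply/lee_addgt0Pr => e e0; rewrite -EFinD.
pose eta := Num.min 1 (e / (6 * (l + 1))).
have l1 : 0 < l + 1 by rewrite ltr_wpDl.
have eta0 : 0 < eta by rewrite lt_min ltr01 divr_gt0// mulr_gt0.
have k1 : 1 < 1 + eta by rewrite ltrDl.
have Ll : (length_on g gamma 0%R 1%R <= l%:E)%E by rewrite /l fineK.
have [V [V' [nV nV' HV]]] := joined_near_path k1 ltr01 pg (divr_gt0 e0 (ltr0n R 2)) Ll.
have j : joined g N p q ((1 + eta) * (1 + eta) * l + e / 2).
  by apply: HV => //; [rewrite -g0; exact: nbhs_singleton|rewrite -g1; exact: nbhs_singleton].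
apply: (le_trans (joined_dist j)); rewrite lee_fin.
have h1 : eta <= 1 by rewrite ge_min lexx.
have h2 : eta * (l + 1) <= e / 6.
  rewrite (_ : e / 6 = e / (6 * (l + 1)) * (l + 1)); last by field; rewrite gt_eqF.
  by rewrite ler_pM2r// ge_min lexx orbT.
have h3 : eta * eta * l <= eta * l by rewrite -mulrA ler_piMl// mulr_ge0// ltW.
move: h2 h3 eta0; lra.
Qed.

Hypothesis M_connected : connected [set: M].

(** The points with a neighbourhood in which all points of [N] are joined to
    [p] form an open and closed set, since points of [N] in a common chart
    ball are joined. *)
Lemma joined_capacity0 p q : N p -> N q -> exists L, joined g N p q L.
Proof.
move=> Np; pose V := [set m : M | exists2 W, nbhs m W &
  forall x, W x -> N x -> exists L, joined g N p x L].
have k2 : 1 < (2 : R) by rewrite ltr1n.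
have nbhs_open (m : M) W : nbhs m W -> exists2 z, W z & N z.
  rewrite nbhsE => -[G [oG Gm] GW].
  by have [z /GW Wz Nz] := capacity0_dense mu_riemannian M_sigma_compact cap0 oG Gm; exists z.
have extend m : closure V m -> V m.
  have [c [rho [kappa [ac gb mball]]]] := exists_chart_ball m k2.
  have nW := nbhs_chart_ball (atlas_is_chart ac) mball.
  move=> /(_ _ nW)[m' [[W' nW' HW'] Wm']].
  have [z [W'z Wz] Nz] := nbhs_open _ _ (filterI nW' (nbhs_chart_ball (atlas_is_chart ac) Wm')).
  have [L jL] := HW' z W'z Nz.
  exists (chart_ball c (c m) rho) => // x Wx Nx.
  have jx := joined_chart_ball ac gb (ltr0n R 2) ltr01 Wz Wx Nz Nx.
  by eexists; exact: joined_trans jL jx.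
have VT : V = setT.
  apply: M_connected.
  - exists p; have [c [rho [kappa [ac gb pball]]]] := exists_chart_ball p k2.
    exists (chart_ball c (c p) rho); first exact: nbhs_chart_ball (atlas_is_chart ac) pball.
    move=> x Wx Nx; eexists.
    exact: joined_chart_ball ac gb (ltr0n R 2) ltr01 pball Wx Np Nx.
  - exists V; last by rewrite setTI.
    rewrite openE => m [W /nbhs_interior nW HW]; rewrite /interior.
    apply: filterS nW => m' nW; exists W => //.
  - by exists V; rewrite ?setTI.
move=> Nq; have [W nW HW] : V q by rewrite VT.
by apply: HW => //; exact: nbhs_singleton.
Qed.

Lemma connected_capacity0 : connected N.
Proof.
have [[p Np]|N0] := pselect (N !=set0); last first.
  rewrite (_ : N = set0); first exact: connected0.
  by apply/seteqP; split => // x Nx; apply: N0; exists x.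
have /choice[f Hf] : forall q, exists gamma : R -> M, N q ->
    [/\ {within `[0, 1], continuous gamma}, gamma 0 = p, gamma 1 = q &
     forall t, 0 <= t <= 1 -> N (gamma t)].
  move=> q; have [Nq|nNq] := pselect (N q); last by exists (fun=> p).
  have [L /(_ 0 1 ltr01)[gamma [[cg _] h1 h2 h3 _]]] := joined_capacity0 Np Nq.
  by exists gamma.
have -> : N = \bigcup_(q in N) (f q @` `[0, 1]).
  apply/seteqP; split => [q Nq|_ [q Nq [t /= + <-]]].
    exists q => //; have [_ _ h1 _] := Hf q Nq; exists 1 => //=.
    by rewrite in_itv/= lexx ler01.
  by rewrite in_itv/= => t01; have [_ _ _] := Hf q Nq; exact.
apply: bigcup_connected.
  exists p => q Nq; have [_ h0 _ _] := Hf q Nq; exists 0 => //=.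
  by rewrite in_itv/= lexx ler01.
move=> q Nq; have [cf _ _ _] := Hf q Nq.
by apply: connected_continuous_connected => //; exact: segment_connected.
Qed.

End distance.

(** * Removing a set of capacity zero *)

Theorem theorem2p1 (R : realType) (n : nat) (M : ptopologicalType)
  (S : smooth_structure R n M) (g : riemannian_metric S)
  (mu : {measure set (borel M) -> \bar R})
  (M_hausdorff : hausdorff_space M) (M_sigma_compact : sigma_compact M)
  (M_connected : connected [set: M]) (mu_riemannian : riemannian_measure g mu)
  (N : set M) (N_open : open N) (cap0 : capacity g mu (~` N) = 0%E) :
  connected N /\
  forall p q, N p -> N q ->
    riemannian_dist g [set: M] p q = riemannian_dist g N p q.
Proof.
split.
  exact: (connected_capacity0 mu_riemannian M_sigma_compact N_open cap0 M_connected).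
by move=> p q; exact: (dist_capacity0 mu_riemannian M_sigma_compact N_open cap0).
Qed.
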